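(* Let $K$ be an algebraically closed field. Any basic connected finite dimensional right $3$-Nakayama $K$-algebra is a special biserial algebra of finite representation type.
   Context: All modules are finitely generated right modules. Put $\mathrm{rad}^0(M)=M$. A module is uniserial ($1$-factor serial) if it has a unique composition series (the zero module counts as uniserial). For $n>1$, a non-uniserial module $M$ of length $l\geq n$ is $n$-factor serial if $M/\mathrm{rad}^{l-n}(M)$ is uniserial and $M/\mathrm{rad}^{l-n+1}(M)$ is not uniserial. For $n>1$, an algebra $\Lambda$ is right $n$-Nakayama if every indecomposable right $\Lambda$-module is $i$-factor serial for some $1\leq i\leq n$ and there exists at least one indecomposable $n$-factor serial right $\Lambda$-module. A finite dimensional $K$-algebra $\Lambda=KQ/I$ ($Q$ a finite quiver, $I$ an admissible ideal, paths composed from left to right) is special biserial if: (1) for every vertex $a$, at most two arrows start at $a$ and at most two arrows end at $a$; (2) for every arrow $\alpha$ there is at most one arrow $\beta$ and at most one arrow $\gamma$ such that $\alpha\beta$ and $\gamma\alpha$ are not in $I$. Finite (representation) type means finitely many isomorphism classes of indecomposable finitely generated modules. *)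

(* Defs.v *)
From HB Require Import structures.
From mathcomp Require Import all_boot all_algebra all_field.
From mathcomp Require Import boolp finmap monalg.

Set Implicit Arguments.
Unset Strict Implicit.
Unset Printing Implicit Defensive.

Import GRing.Theory.
Local Open Scope ring_scope.

(* A finitely generated module over a finite dimensional algebra is the same
   thing as a module that is finite dimensional over the ground field.  The
   space may be zero. *)
Record rmodule (K : fieldType) (A : falgType K) := RModule {
  rm_space :> vectType K;
  ract : rm_space -> A -> rm_space;
  ract_linear_l : forall a, linear (ract^~ a);
  ract_linear_r : forall x, linear (ract x);
  ract1 : forall x, ract x 1 = x;
  ractM : forall x a b, ract x (a * b) = ract (ract x a) b
}.

Section Modules.
Variables (K : fieldType) (A : falgType K).
Implicit Types M N : rmodule A.

Definition rm_iso M N : Prop :=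
  exists2 f : {linear M -> N},
    bijective f & forall x a, f (ract x a) = ract (f x) a.

Lemma ractBl M (x y : M) a : ract (x - y) a = ract x a - ract y a.
Proof. by rewrite addrC -scaleN1r ract_linear_l scaleN1r addrC. Qed.

Definition stable M (U : {vspace M}) : Prop :=
  forall x a, x \in U -> ract x a \in U.

Record submodule M := Submodule {
  submod_space :> {vspace M};
  submod_stable : stable submod_space
}.

Lemma stable_full M : stable (fullv : {vspace M}).
Proof. by move=> x a _; rewrite memvf. Qed.

Definition full_submodule M : submodule M := Submodule (@stable_full M).

Section Restriction.
Variables (M : rmodule A) (U : submodule M).

Definition sub_act (x : subvs_of U) (a : A) : subvs_of U :=
  vsproj U (ract (vsval x) a).

Lemma sub_actE x a : vsval (sub_act x a) = ract (vsval x) a.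
Proof. by rewrite vsprojK // submod_stable // subvsP. Qed.

Lemma sub_act_linear_l a : linear (sub_act^~ a).
Proof.
by move=> c x y; rewrite /sub_act linearP /= ract_linear_l linearP.
Qed.

Lemma sub_act_linear_r x : linear (sub_act x).
Proof. by move=> c a b; rewrite /sub_act ract_linear_r linearP. Qed.

Lemma sub_act1 x : sub_act x 1 = x.
Proof. by apply: val_inj; rewrite /= sub_actE ract1. Qed.

Lemma sub_actM x a b : sub_act x (a * b) = sub_act (sub_act x a) b.
Proof. by apply: val_inj; rewrite /= !sub_actE ractM. Qed.

Definition restrict_module : rmodule A :=
  RModule sub_act_linear_l sub_act_linear_r sub_act1 sub_actM.

End Restriction.

(* M/U is realised on the complement U^C of U: the class of x is represented
   by the projection of x to U^C along U.  The lemmas quot_proj_act,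
   quot_proj_surj and quot_proj_ker show that this is the quotient. *)
Section Quotient.
Variables (M : rmodule A) (U : submodule M).

Definition quot_proj (x : M) : subvs_of (U^C)%VS :=
  vsproj (U^C)%VS (daddv_pi (U^C)%VS U x).

Lemma quot_proj_linear : linear quot_proj.
Proof. by move=> c x y; rewrite /quot_proj !linearP. Qed.

HB.instance Definition _ :=
  GRing.isLinear.Build K M (subvs_of (U^C)%VS) *:%R quot_proj quot_proj_linear.

Lemma capCv0 : (U^C :&: U)%VS = 0%VS.
Proof. by rewrite capvC capv_compl. Qed.

Lemma quot_proj_val y : quot_proj (vsval y) = y.
Proof. by rewrite /quot_proj (daddv_pi_id capCv0) ?subvsP // vsvalK. Qed.

Lemma quot_proj_surj y : exists x, quot_proj x = y.
Proof. by exists (vsval y); exact: quot_proj_val. Qed.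

Lemma quot_projB x : x - vsval (quot_proj x) \in (U : {vspace M}).
Proof.
rewrite /quot_proj vsprojK ?memv_pi //.
have Ux : x \in (U^C + U)%VS by rewrite addvC addv_complf memvf.
by rewrite -{1}(daddv_pi_add capCv0 Ux) addrC addKr memv_pi.
Qed.

Lemma quot_proj_ker x : (quot_proj x == 0) = (x \in (U : {vspace M})).
Proof.
apply/eqP/idP => [p0|Ux].
  by have := quot_projB x; rewrite p0 linear0 addr0.
have Up : vsval (quot_proj x) \in (U : {vspace M}).
  by rewrite -[vsval _](subKr x) memvB // quot_projB.
apply: val_inj => /=; apply/eqP; rewrite -memv0 -capCv0 memv_cap Up andbT.
exact: subvsP.
Qed.

Definition quot_act (y : subvs_of (U^C)%VS) (a : A) : subvs_of (U^C)%VS :=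
  quot_proj (ract (vsval y) a).

Lemma quot_proj_act x a : quot_proj (ract x a) = quot_act (quot_proj x) a.
Proof.
apply/eqP; rewrite -subr_eq0 -linearB quot_proj_ker.
by rewrite -ractBl; apply: submod_stable; exact: quot_projB.
Qed.

Lemma quot_act_linear_l a : linear (quot_act^~ a).
Proof. by move=> c x y; rewrite /quot_act linearP /= ract_linear_l linearP. Qed.

Lemma quot_act_linear_r x : linear (quot_act x).
Proof. by move=> c a b; rewrite /quot_act ract_linear_r linearP. Qed.

Lemma quot_act1 x : quot_act x 1 = x.
Proof. by rewrite /quot_act ract1 quot_proj_val. Qed.

Lemma quot_actM x a b : quot_act x (a * b) = quot_act (quot_act x a) b.
Proof. by rewrite -[quot_act x a]/(quot_proj _) -quot_proj_act -ractM. Qed.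

Definition quot_module : rmodule A :=
  RModule quot_act_linear_l quot_act_linear_r quot_act1 quot_actM.

End Quotient.

Definition maximal_submodule M (W U : {vspace M}) : Prop :=
  [/\ stable W, (W <= U)%VS, W <> U &
      forall X : {vspace M}, stable X -> (W <= X)%VS -> (X <= U)%VS ->
        X = W \/ X = U].

Definition composition_series M (s : seq {vspace M}) : Prop :=
  [/\ (0 < size s)%N, head 0%VS s = 0%VS, last 0%VS s = fullv &
      forall i, (i.+1 < size s)%N ->
        maximal_submodule (nth 0%VS s i) (nth 0%VS s i.+1)].

Definition has_length M (l : nat) : Prop :=
  exists2 s : seq {vspace M}, composition_series s & size s = l.+1.

Definition uniserial M : Prop :=
  exists! s : seq {vspace M}, composition_series s.

Lemma family_cap M (P : {vspace M} -> Prop) :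
  {W : {vspace M} | forall x, x \in W <-> forall X, P X -> x \in X}.
Proof.
apply: cid.
pose good (W : {vspace M}) := forall x, (forall X, P X -> x \in X) -> x \in W.
pose p n := `[< exists2 W, good W & \dim W = n >].
have p0 : exists n, p n.
  exists (\dim (fullv : {vspace M})); apply/asboolP; exists fullv => // x _.
  exact: memvf.
case: (ex_minnP p0) => n /asboolP[W gW <-] minW.
exists W => x; split=> [Wx X PX|]; last exact: gW.
have /minW : p (\dim (W :&: X)).
  apply/asboolP; exists (W :&: X)%VS => // y Py.
  by rewrite memv_cap gW //= Py.
have := dimv_leqif_eq (capvSl W X) => /geq_leqif -> /eqP WX.
by move: Wx; rewrite -WX memv_cap => /andP[].
Qed.

(* The intersection of U with all its maximal submodules. *)
Definition rad_space M (U : {vspace M}) : {vspace M} :=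
  (U :&: sval (family_cap (fun X => maximal_submodule X U)))%VS.

Lemma rad_spaceP M (U : {vspace M}) x :
  x \in rad_space U <->
  x \in U /\ forall X, maximal_submodule X U -> x \in X.
Proof.
rewrite /rad_space; case: family_cap => W PW /=.
rewrite memv_cap; split=> [/andP[-> /PW]//|[-> ?]].
exact/PW.
Qed.

Lemma rad_stable M (U : submodule M) : stable (rad_space U).
Proof.
move=> x a /rad_spaceP[Ux Px]; apply/rad_spaceP; split.
  exact: submod_stable.
by move=> X maxX; case: (maxX) => stX _ _ _; apply: stX; apply: Px.
Qed.

Definition rad M (U : submodule M) : submodule M := Submodule (@rad_stable M U).

Definition radn M (k : nat) : submodule M := iter k (@rad M) (full_submodule M).

Definition factor_serial (n : nat) M : Prop :=
  match n with
  | 0 => False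
  | 1 => uniserial M
  | _ => ~ uniserial M /\
         exists l, [/\ has_length M l, (n <= l)%N,
                       uniserial (quot_module (radn M (l - n))) &
                       ~ uniserial (quot_module (radn M (l - n + 1)))]
  end.

Definition indecomposable M : Prop :=
  (fullv : {vspace M}) <> 0%VS /\
  forall U W : submodule M, (U + W)%VS = fullv -> (U :&: W)%VS = 0%VS ->
    U = 0%VS :> {vspace M} \/ W = 0%VS :> {vspace M}.

End Modules.

Section Algebras.
Variables (K : fieldType) (A : falgType K).

Definition right_nakayama (n : nat) : Prop :=
  [/\ (1 < n)%N,
      forall M : rmodule A, indecomposable M ->
        exists2 i, (1 <= i <= n)%N & factor_serial i M &
      exists2 M : rmodule A, indecomposable M & factor_serial n M].

(* The F i need not be indecomposable or pairwise non-isomorphic: only finitely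
   many isomorphism classes have to be covered. *)
Definition finite_type : Prop :=
  exists (n : nat) (F : 'I_n -> rmodule A),
    forall M : rmodule A, indecomposable M -> exists i, rm_iso M (F i).

Definition connected_alg : Prop :=
  ~ exists (B C : falgType K) (f : {lrmorphism A -> (B * C)%type}), bijective f.

Lemma reg_linear_l (a : A) : linear ((@GRing.mul A)^~ a).
Proof. by move=> c x y; rewrite mulrDl scalerAl. Qed.

Lemma reg_linear_r (x : A) : linear (@GRing.mul A x).
Proof. by move=> c a b; rewrite mulrDr scalerAr. Qed.

Definition regular_module : rmodule A :=
  RModule reg_linear_l reg_linear_r (@mulr1 A) (@mulrA A).

Lemma right_ideal_stable (e : A) :
  stable (limg (amull e) : {vspace regular_module}).
Proof.
move=> x a /memv_imgP[y _ ->]; rewrite lfunE /= -mulrA.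
by apply/memv_imgP; exists (y * a); rewrite ?memvf // lfunE.
Qed.

Definition right_ideal (e : A) : rmodule A :=
  restrict_module (Submodule (@right_ideal_stable e)).

Definition primitive_idempotent (e : A) : Prop :=
  [/\ e <> 0, e * e = e &
      forall f g : A, f * f = f -> g * g = g -> f * g = 0 -> g * f = 0 ->
        e = f + g -> f = 0 \/ g = 0].

Definition complete_primitive_idempotents (n : nat) (e : 'I_n -> A) : Prop :=
  [/\ forall i, primitive_idempotent (e i),
      forall i j, i <> j -> e i * e j = 0 &
      \sum_(i < n) e i = 1].

Definition basic_alg : Prop :=
  exists (n : nat) (e : 'I_n -> A),
    complete_primitive_idempotents e /\
    forall i j, rm_iso (right_ideal (e i)) (right_ideal (e j)) -> i = j.

End Algebras.

(* Two-sided and proper: an algType satisfies 1 != 0, so the quotient by the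
   unit ideal would not be one.  Admissible ideals are always proper. *)
Record ideal (R : nzRingType) := Ideal {
  ideal_pred : {pred R};
  ideal_zmod : zmod_closed ideal_pred;
  ideal_mull : forall a x, x \in ideal_pred -> a * x \in ideal_pred;
  ideal_mulr : forall a x, x \in ideal_pred -> x * a \in ideal_pred;
  ideal_proper : 1 \notin ideal_pred
}.

HB.instance Definition _ (R : nzRingType) (I : ideal R) :=
  GRing.isZmodClosed.Build R (ideal_pred I) (ideal_zmod I).

Section QuotientAlgebra.
Variables (K : fieldType) (B : algType K) (I : ideal B).

Definition quot_alg := Quotient.quot (ideal_pred I).

HB.instance Definition _ := GRing.Zmodule.on quot_alg.
HB.instance Definition _ := EqQuotient.on quot_alg.

Definition quot_pi (x : B) : quot_alg := (\pi x)%qT.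

Lemma quot_piP x y : quot_pi x = quot_pi y <-> x - y \in ideal_pred I.
Proof.
by rewrite Quotient.idealrBE; split=> [?|/eqP//]; apply/eqP.
Qed.

Lemma quot_piD x y : quot_pi (x + y) = quot_pi x + quot_pi y.
Proof. exact: (raddfD (\pi_(Quotient.quot (ideal_pred I))%qT)). Qed.

Lemma quot_reprK (x : quot_alg) : quot_pi (repr x) = x.
Proof. exact: reprK. Qed.

Lemma quot_repr_pi x : repr (quot_pi x) - x \in ideal_pred I.
Proof. by apply/quot_piP; rewrite quot_reprK. Qed.

Definition quot_one : quot_alg := quot_pi 1.
Definition quot_mul (x y : quot_alg) : quot_alg := quot_pi (repr x * repr y).
Definition quot_scale (c : K) (x : quot_alg) : quot_alg := quot_pi (c *: repr x).

Lemma quot_piM x y : quot_pi (x * y) = quot_mul (quot_pi x) (quot_pi y).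
Proof.
apply/esym/quot_piP.
set x' := repr _; set y' := repr _.
have -> : x' * y' - x * y = (x' - x) * y' + x * (y' - y).
  by rewrite mulrBl mulrBr addrA subrK.
by apply: rpredD; [apply: ideal_mulr|apply: ideal_mull]; apply: quot_repr_pi.
Qed.

Lemma quot_piZ c x : quot_pi (c *: x) = quot_scale c (quot_pi x).
Proof.
apply/esym/quot_piP; rewrite -scalerBr -[X in c *: X]mul1r scalerAl.
exact: (ideal_mull _ (quot_repr_pi _)).
Qed.

Let piE := (=^~ quot_piM, =^~ quot_piD, =^~ quot_piZ).

Lemma quot_mulA : associative quot_mul.
Proof.
by move=> x y z; rewrite -[x]quot_reprK -[y]quot_reprK -[z]quot_reprK !piE mulrA.
Qed.

Lemma quot_mul1q : left_id quot_one quot_mul.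
Proof. by move=> x; rewrite -[x]quot_reprK /quot_one !piE mul1r. Qed.

Lemma quot_mulq1 : right_id quot_one quot_mul.
Proof. by move=> x; rewrite -[x]quot_reprK /quot_one !piE mulr1. Qed.

Lemma quot_mulDl : left_distributive quot_mul +%R.
Proof.
by move=> x y z; rewrite -[x]quot_reprK -[y]quot_reprK -[z]quot_reprK !piE mulrDl.
Qed.

Lemma quot_mulDr : right_distributive quot_mul +%R.
Proof.
by move=> x y z; rewrite -[x]quot_reprK -[y]quot_reprK -[z]quot_reprK !piE mulrDr.
Qed.

Lemma quot_one_neq0 : quot_one != 0.
Proof.
apply/eqP=> h; move: (ideal_proper I); rewrite -[1]subr0.
move/negP; apply; apply/quot_piP.
by rewrite -[LHS]/quot_one h; apply: (@addrI _ (quot_pi 0)); rewrite -quot_piD !addr0.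
Qed.

HB.instance Definition _ := GRing.Zmodule_isNzRing.Build quot_alg
  quot_mulA quot_mul1q quot_mulq1 quot_mulDl quot_mulDr quot_one_neq0.

Lemma quot_scaleA c d x : quot_scale c (quot_scale d x) = quot_scale (c * d) x.
Proof. by rewrite -[x]quot_reprK !piE scalerA. Qed.

Lemma quot_scale1 : left_id 1 quot_scale.
Proof. by move=> x; rewrite -[x]quot_reprK !piE scale1r. Qed.

Lemma quot_scaleDr : right_distributive quot_scale +%R.
Proof.
by move=> c x y; rewrite -[x]quot_reprK -[y]quot_reprK !piE scalerDr.
Qed.

Lemma quot_scaleDl x : {morph quot_scale^~ x : c d / c + d}.
Proof. by move=> c d; rewrite -[x]quot_reprK /= !piE scalerDl. Qed.

HB.instance Definition _ := GRing.Zmodule_isLmodule.Build K quot_alg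
  quot_scaleA quot_scale1 quot_scaleDr quot_scaleDl.

Lemma quot_scaleAl (c : K) (x y : quot_alg) : c *: (x * y) = (c *: x) * y.
Proof.
change (quot_scale c (quot_mul x y) = quot_mul (quot_scale c x) y).
by rewrite -[x]quot_reprK -[y]quot_reprK !piE scalerAl.
Qed.

HB.instance Definition _ := GRing.Lmodule_isLalgebra.Build K quot_alg quot_scaleAl.

Lemma quot_scaleAr (c : K) (x y : quot_alg) : c *: (x * y) = x * (c *: y).
Proof.
change (quot_scale c (quot_mul x y) = quot_mul x (quot_scale c y)).
by rewrite -[x]quot_reprK -[y]quot_reprK !piE scalerAr.
Qed.

HB.instance Definition _ := GRing.Lalgebra_isAlgebra.Build K quot_alg quot_scaleAr.

End QuotientAlgebra.

(* The set of vertices is nonempty so that the path algebra is not zero. *)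
Record quiver := Quiver {
  vertex : finType;
  arrow : finType;
  src : arrow -> vertex;
  tgt : arrow -> vertex;
  vertex_gt0 : (0 < #|vertex|)%N
}.

Section Paths.
Variable Q : quiver.

(* The sequence s of arrows is a walk starting at v, each arrow starting where
   the previous one ends. *)
Fixpoint walk (v : vertex Q) (s : seq (arrow Q)) : bool :=
  if s is a :: s' then (src a == v) && walk (tgt a) s' else true.

Definition walk_end (v : vertex Q) (s : seq (arrow Q)) : vertex Q :=
  last v (map (@tgt Q) s).

(* The start is recorded since it is not determined by the arrows for the
   stationary paths (v, [::]). *)
Record qpath := QPath {
  qpath_val : vertex Q * seq (arrow Q);
  qpath_walk : walk qpath_val.1 qpath_val.2
}.

HB.instance Definition _ := [isSub for qpath_val].
HB.instance Definition _ := [Choice of qpath by <:].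

Definition path_src (p : qpath) : vertex Q := (val p).1.
Definition path_arrows (p : qpath) : seq (arrow Q) := (val p).2.
Definition path_tgt (p : qpath) : vertex Q :=
  walk_end (path_src p) (path_arrows p).
Definition path_length (p : qpath) : nat := size (path_arrows p).

Definition stationary (v : vertex Q) : qpath := @QPath (v, [::]) isT.

Lemma arrow_walk (a : arrow Q) : walk (src a) [:: a].
Proof. by rewrite /= eqxx. Qed.

Definition arrow_path (a : arrow Q) : qpath := @QPath (src a, [:: a]) (arrow_walk a).

Lemma walk_cat v s t : walk v (s ++ t) = walk v s && walk (walk_end v s) t.
Proof. by elim: s v => [|a s IH] v //=; rewrite IH andbA. Qed.

Lemma walk_end_cat v s t : walk_end v (s ++ t) = walk_end (walk_end v s) t.
Proof. by rewrite /walk_end map_cat last_cat. Qed.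

(* First p, then q; None when they do not compose. *)
Definition path_cat (p q : qpath) : option qpath :=
  if path_tgt p == path_src q
  then insub (path_src p, path_arrows p ++ path_arrows q) else None.

Lemma path_cat_some p q : path_tgt p = path_src q ->
  exists2 r, path_cat p q = Some r &
    val r = (path_src p, path_arrows p ++ path_arrows q).
Proof.
move=> pq; rewrite /path_cat pq eqxx.
case: insubP => [r _ er|]; first by exists r.
rewrite /= walk_cat (qpath_walk p) -[walk_end _ _]/(path_tgt p) pq.
by rewrite (qpath_walk q).
Qed.

Lemma path_cat_none p q : path_tgt p != path_src q -> path_cat p q = None.
Proof. by rewrite /path_cat => /negbTE->. Qed.

Lemma path_catA p q r :
  obind (fun x => path_cat x r) (path_cat p q) =
  obind (path_cat p) (path_cat q r).
Proof.
have [pq|pq] := eqVneq (path_tgt p) (path_src q); last first.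
  rewrite (path_cat_none pq) /=.
  have [qr|qr] := eqVneq (path_tgt q) (path_src r); last first.
    by rewrite (path_cat_none qr).
  have [x -> ex] := path_cat_some qr => /=.
  by rewrite path_cat_none // [path_src x]/path_src ex.
have [x -> ex] := path_cat_some pq => /=.
have tx : path_tgt x = path_tgt q.
  by rewrite {1}/path_tgt /path_src /path_arrows ex walk_end_cat -/(path_tgt p) pq.
have [qr|qr] := eqVneq (path_tgt q) (path_src r); last first.
  by rewrite (path_cat_none qr) path_cat_none // tx.
have [y -> ey] := path_cat_some qr => /=.
have [u -> eu] : exists2 u, path_cat x r = Some u &
   val u = (path_src x, path_arrows x ++ path_arrows r).
  by apply: path_cat_some; rewrite tx.
have [w -> ew] : exists2 w, path_cat p y = Some w &
   val w = (path_src p, path_arrows p ++ path_arrows y).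
  by apply: path_cat_some; rewrite pq /path_src ey.
congr Some; apply: val_inj; rewrite eu ew /path_src /path_arrows ex ey /=.
by rewrite catA.
Qed.

Lemma path_cat_stationaryl v q :
  path_cat (stationary v) q = if v == path_src q then Some q else None.
Proof.
rewrite /path_cat -[path_tgt (stationary v)]/v.
case: eqP => // ->; rewrite -[_ ++ _]/(path_arrows q).
exact: etrans (congr1 _ (esym (surjective_pairing (val q)))) (valK q).
Qed.

Lemma path_cat_stationaryr v p :
  path_cat p (stationary v) = if v == path_tgt p then Some p else None.
Proof.
rewrite /path_cat [v == _]eq_sym -[path_src (stationary v)]/v.
case: eqP => // _; rewrite cats0.
exact: etrans (congr1 _ (esym (surjective_pairing (val p)))) (valK p).
Qed.

End Paths.

(* Bilinear products on the free module {malg K[T]} given on basis elements by a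
   partial product on T. *)
Definition malg_basis (K : fieldType) (T : choiceType) (p : T) : {malg K[T]} :=
  << p >>.
Arguments malg_basis K {T} p.

HB.lock Definition malg_mul (K : fieldType) (T : choiceType)
    (op : T -> T -> option T) (f g : {malg K[T]}) : {malg K[T]} :=
  \sum_(p <- msupp f) \sum_(q <- msupp g)
     (f@_p * g@_q) *: oapp (malg_basis K) 0 (op p q).

Section FreeProduct.
Variables (K : fieldType) (T : choiceType) (op : T -> T -> option T).
Local Notation V := {malg K[T]}.
Implicit Types (f g h : V) (p q r : T).

Local Notation malg_mul := (@malg_mul K T op).
Local Notation malg_basis := (malg_basis K).

Lemma malg_mulEw (d e : {fset T}) f g :
  (msupp f `<=` d)%fset -> (msupp g `<=` e)%fset ->
  malg_mul f g =
  \sum_(p <- d) \sum_(q <- e) (f@_p * g@_q) *: oapp malg_basis 0 (op p q).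
Proof.
move=> fd ge; rewrite malg_mul.unlock (big_fset_incl _ fd) => [|p _ pf]; last first.
  by rewrite big1 // => q _; rewrite (mcoeff_outdom pf) mul0r scale0r.
apply: eq_bigr => p _; rewrite (big_fset_incl _ ge) // => q _ qg.
by rewrite (mcoeff_outdom qg) mulr0 scale0r.
Qed.

Lemma malg_mulDl : left_distributive malg_mul +%R.
Proof.
move=> f g h; pose d := (msupp f `|` msupp g)%fset.
rewrite (@malg_mulEw d (msupp h) (f + g)) ?msuppD_le //.
rewrite (@malg_mulEw d (msupp h) f) ?fsubsetUl //.
rewrite (@malg_mulEw d (msupp h) g) ?fsubsetUr //.
rewrite -big_split; apply: eq_bigr => p _; rewrite -big_split; apply: eq_bigr => q _.
by rewrite mcoeffD mulrDl scalerDl.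
Qed.

Lemma malg_mulDr : right_distributive malg_mul +%R.
Proof.
move=> h f g; pose d := (msupp f `|` msupp g)%fset.
rewrite (@malg_mulEw (msupp h) d _ (f + g)) ?msuppD_le //.
rewrite (@malg_mulEw (msupp h) d _ f) ?fsubsetUl //.
rewrite (@malg_mulEw (msupp h) d _ g) ?fsubsetUr //.
rewrite -big_split; apply: eq_bigr => p _; rewrite -big_split; apply: eq_bigr => q _.
by rewrite mcoeffD mulrDr scalerDl.
Qed.

Lemma malg_scaleAl c f g :
  c *: malg_mul f g = malg_mul (c *: f) g.
Proof.
rewrite (@malg_mulEw (msupp f) (msupp g) (c *: f)) ?msuppZ_le //.
rewrite malg_mul.unlock scaler_sumr; apply: eq_bigr => p _.
rewrite scaler_sumr; apply: eq_bigr => q _.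
by rewrite mcoeffZ scalerA mulrA.
Qed.

Lemma malg_scaleAr c f g :
  c *: malg_mul f g = malg_mul f (c *: g).
Proof.
rewrite (@malg_mulEw (msupp f) (msupp g) f (c *: g)) ?msuppZ_le //.
rewrite malg_mul.unlock scaler_sumr; apply: eq_bigr => p _.
rewrite scaler_sumr; apply: eq_bigr => q _.
by rewrite mcoeffZ scalerA mulrCA.
Qed.

Lemma malg_mul0l g : malg_mul 0 g = 0.
Proof. by have := malg_scaleAl 0 0 g; rewrite !scale0r => <-. Qed.

Lemma malg_mul0r f : malg_mul f 0 = 0.
Proof. by have := malg_scaleAr 0 f 0; rewrite !scale0r => <-. Qed.

Lemma malg_mul_basis p q :
  malg_mul (malg_basis p) (malg_basis q) = oapp malg_basis 0 (op p q).
Proof.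
rewrite malg_mul.unlock !msuppU oner_eq0 !big_seq_fset1.
by rewrite !mcoeffUU mulr1 scale1r.
Qed.

Lemma malg_ind (P : V -> Prop) :
  P 0 -> (forall f g, P f -> P g -> P (f + g)) ->
  (forall c f, P f -> P (c *: f)) -> (forall p, P (malg_basis p)) ->
  forall f, P f.
Proof.
move=> P0 PD PZ Pb f; rewrite [f]monalgE; apply: big_ind => // p _.
have -> : << f@_p *g p >> = f@_p *: malg_basis p.
  by apply/malgP=> q; rewrite mcoeffZ /malg_basis !mcoeffU mulrnAr mulr1.
by apply: PZ.
Qed.

Lemma malg_mulA_of_op : (forall p q r, obind (fun x => op x r) (op p q) = obind (op p) (op q r)) ->
  associative malg_mul.
Proof.
move=> opA f g h; elim/malg_ind: f => [|f f' Hf Hf'|c f Hf|p].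
- by rewrite !malg_mul0l.
- by rewrite (malg_mulDl f f') (malg_mulDl f f') malg_mulDl Hf Hf'.
- by rewrite -(malg_scaleAl c f) -(malg_scaleAl c f) -malg_scaleAl Hf.
elim/malg_ind: g => [|g g' Hg Hg'|c g Hg|q].
- by rewrite malg_mul0l !malg_mul0r malg_mul0l.
- rewrite (malg_mulDl g g') (malg_mulDr _ g g').
  by rewrite malg_mulDl malg_mulDr Hg Hg'.
- rewrite -(malg_scaleAl c g) -(malg_scaleAr c _ g).
  by rewrite -malg_scaleAl -malg_scaleAr Hg.
elim/malg_ind: h => [|h h' Hh Hh'|c h Hh|r].
- by rewrite !malg_mul0r.
- rewrite (malg_mulDr _ h h') (malg_mulDr _ h h').
  by rewrite malg_mulDr Hh Hh'.
- rewrite -(malg_scaleAr c _ h) -(malg_scaleAr c _ h).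
  by rewrite -malg_scaleAr Hh.
rewrite !malg_mul_basis; have := opA p q r.
case: (op p q) => [x|]; case: (op q r) => [y|] //=.
- by rewrite !malg_mul_basis => ->.
- by rewrite malg_mul_basis malg_mul0r => ->.
- by rewrite malg_mul_basis malg_mul0l => <-.
- by rewrite malg_mul0l malg_mul0r.
Qed.

Lemma malg_mul_idl (I : finType) (e : I -> T) (s : T -> I) :
  (forall i q, op (e i) q = if i == s q then Some q else None) ->
  left_id (\sum_i malg_basis (e i)) malg_mul.
Proof.
move=> opE; elim/malg_ind => [|g g' Hg Hg'|c g Hg|q].
- by rewrite malg_mul0r.
- by rewrite malg_mulDr Hg Hg'.
- by rewrite -malg_scaleAr Hg.
rewrite (big_morph (malg_mul^~ _) (id1 := 0) (op1 := +%R)); first last.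
- by rewrite malg_mul0l.
- by move=> x y; exact: malg_mulDl.
rewrite (bigD1 (s q)) //= malg_mul_basis opE eqxx /=.
by rewrite big1 ?addr0 // => i /negbTE iq; rewrite malg_mul_basis opE iq.
Qed.

Lemma malg_mul_idr (I : finType) (e : I -> T) (t : T -> I) :
  (forall i p, op p (e i) = if i == t p then Some p else None) ->
  right_id (\sum_i malg_basis (e i)) malg_mul.
Proof.
move=> opE; elim/malg_ind => [|g g' Hg Hg'|c g Hg|p].
- by rewrite malg_mul0l.
- by rewrite malg_mulDl Hg Hg'.
- by rewrite -malg_scaleAl Hg.
rewrite (big_morph (malg_mul _) (id1 := 0) (op1 := +%R)); first last.
- by rewrite malg_mul0r.
- by move=> x y; exact: malg_mulDr.
rewrite (bigD1 (t p)) //= malg_mul_basis opE eqxx /=.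
by rewrite big1 ?addr0 // => i /negbTE ip; rewrite malg_mul_basis opE ip.
Qed.

End FreeProduct.

Section PathAlgebra.
Variables (K : fieldType) (Q : quiver).

Definition path_alg := {malg K[qpath Q]}.

HB.instance Definition _ := GRing.Lmodule.on path_alg.

Implicit Types (f g h : path_alg) (p q r : qpath Q).

Definition path_elt p : path_alg := malg_basis K p.

Definition path_alg_mul : path_alg -> path_alg -> path_alg :=
  malg_mul (@path_cat Q).

Definition path_alg_one : path_alg :=
  \sum_(v : vertex Q) path_elt (stationary v).

Lemma path_alg_mul1l : left_id path_alg_one path_alg_mul.
Proof. exact: malg_mul_idl (@path_cat_stationaryl Q). Qed.

Lemma path_alg_mul1r : right_id path_alg_one path_alg_mul.
Proof. exact: malg_mul_idr (@path_cat_stationaryr Q). Qed.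

Lemma path_alg_one_neq0 : path_alg_one != 0.
Proof.
have /card_gt0P[v _] := vertex_gt0 Q.
apply/eqP => /(congr1 (mcoeff (stationary v))) /eqP.
rewrite mcoeff0 raddf_sum (bigD1 v) //= mcoeffUU big1 ?addr0 ?oner_eq0 //.
move=> w wv; rewrite mcoeffU; case: eqP => // /(congr1 (@path_src Q)) e.
by rewrite -[w]/(path_src (stationary w)) e eqxx in wv.
Qed.

HB.instance Definition _ := GRing.Zmodule_isNzRing.Build path_alg
  (malg_mulA_of_op (@path_catA Q)) path_alg_mul1l path_alg_mul1r
  (@malg_mulDl _ _ _) (@malg_mulDr _ _ _) path_alg_one_neq0.

HB.instance Definition _ :=
  GRing.Lmodule_isLalgebra.Build K path_alg (@malg_scaleAl _ _ _).

HB.instance Definition _ :=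
  GRing.Lalgebra_isAlgebra.Build K path_alg (@malg_scaleAr _ _ _).

Lemma path_elt_mul p q :
  path_elt p * path_elt q = oapp path_elt 0 (path_cat p q).
Proof. exact: malg_mul_basis. Qed.

Definition arrow_elt (a : arrow Q) : path_alg := path_elt (arrow_path a).

(* R^m, for R the two-sided ideal generated by the arrows: the subspace spanned
   by the paths of length at least m. *)
Definition arrow_ideal_pow (m : nat) (f : path_alg) : Prop :=
  forall p, p \in msupp f -> (m <= path_length p)%N.

Definition admissible (I : ideal path_alg) : Prop :=
  (forall f, f \in ideal_pred I -> arrow_ideal_pow 2 f) /\
  exists2 m, (2 <= m)%N & forall f, arrow_ideal_pow m f -> f \in ideal_pred I.

Definition special_biserial_pair (I : ideal path_alg) : Prop :=
  [/\ forall v : vertex Q, (#|[set a | src a == v]| <= 2)%N,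
      forall v : vertex Q, (#|[set a | tgt a == v]| <= 2)%N,
      forall a b b' : arrow Q,
        arrow_elt a * arrow_elt b \notin ideal_pred I ->
        arrow_elt a * arrow_elt b' \notin ideal_pred I -> b = b' &
      forall a c c' : arrow Q,
        arrow_elt c * arrow_elt a \notin ideal_pred I ->
        arrow_elt c' * arrow_elt a \notin ideal_pred I -> c = c'].

End PathAlgebra.

(* A is identified with K Q / I up to isomorphism of algebras. *)
Definition special_biserial (K : fieldType) (A : falgType K) : Prop :=
  exists (Q : quiver) (I : ideal (path_alg K Q)),
    [/\ admissible I, special_biserial_pair I &
        exists f : {lrmorphism quot_alg I -> A}, bijective f].

(* Main.v *)
(* Since A is basic over an algebraically closed field, A / J is a product of
   copies of K, and length is dimension. In a right 3-Nakayama algebra an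
   indecomposable module that is not local has dimension at most 3, and a
   projective P_v = e_v A with two arrows out of v has dimension at most 4.

   Everything follows from one construction: glue two local modules L and L'
   along isomorphic simple submodules. The result has a two-dimensional top and
   dimension dim L + dim L' - 1, so if this exceeds 3 it decomposes, and then the
   identification of the two simple submodules is induced by a homomorphism
   L -> L' or L' -> L. Applied to small quotients of the projectives this excludes
   parallel arrows, three arrows out of a vertex, two nonzero products a b and
   a b' and two nonzero products a b and a' b. Three arrows into a vertex are
   excluded by a four-dimensional module with simple socle.

   As to finite type, an indecomposable module that is not local has two top
   vertices and a simple socle, and these vertices determine it. A local module
   is P_v / X. If at most one arrow leaves v then P_v is uniserial. Otherwise,
   after an automorphism of P_v, X is spanned by some of the at most three basis
   vectors of e_v J. *)

Require Import Defs.
From HB Require Import structures.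
From mathcomp Require Import all_boot all_algebra all_field.
From mathcomp Require Import boolp zify finmap monalg.

Set Implicit Arguments.
Unset Strict Implicit.
Unset Printing Implicit Defensive.

Import GRing.Theory.
Local Open Scope ring_scope.

(** The bounds 3 and 4 come from the index in the definition of factor serial modules. If M / rad^k
    M is not uniserial and M of length l is i-factor serial, then l - i < k, so i <= 3 gives l <= k
    + 2. Modules with a top of dimension at least 2 are the case k = 1, and projectives with two
    arrows out of their vertex the case k = 2. To apply a bound it suffices to exhibit two
    incomparable submodules that contain rad^k M. A local module is taken as A / X for a right ideal
    X, so that homomorphisms are left multiplications by elements m of A. Arrows are elements of e_i
    J e_j outside J^2. Their coordinate functions modulo J^2, extended by 0 to the idempotents, obey
    a Leibniz rule relative to the characters, and this computes what m does to an arrow. Algebraic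
    closedness yields the characters: an element of e A e, for e primitive, is a scalar plus a
    nilpotent. The delicate case is a nonzero product of two arrows inside J^3, which the quotient
    by J^3 does not detect. It is reduced to a loop, and loops of this kind are excluded by
    gluing. *)

(** A subspace of largest dimension inside [P] already contains every [x] with [P x], since adding
    the line of [x] stays inside [P]. Kernels, annihilators and images are turned into subspaces in
    this way. *)
Lemma subspace_of_pred (K : fieldType) (V : vectType K) (P : V -> Prop) :
  P 0 -> (forall c x y, P x -> P y -> P (c *: x + y)) ->
  {W : {vspace V} | forall x, x \in W <-> P x}.
Proof.
move=> P0 PD; apply: cid.
pose good (W : {vspace V}) := forall x, x \in W -> P x.
pose p n := `[< exists2 W, good W & \dim W = n >].
have p0 : exists n, p n.
  by exists (\dim (0%VS : {vspace V})); apply/asboolP; exists 0%VS => // x; rewrite memv0 => /eqP->.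
have pb n : p n -> (n <= \dim {:V})%N.
  by move=> /asboolP[W _ <-]; apply: dimvS; apply: subvf.
case: (ex_maxnP p0 pb) => n /asboolP[W gW <-] maxW.
exists W => x; split=> [|Px]; first exact: gW.
have gWx : good (W + <[x]>)%VS.
  move=> y /memv_addP[w Ww [z /vlineP[c ->] ->]].
  by rewrite addrC; apply: PD => //; apply: gW.
have /maxW : p (\dim (W + <[x]>)%VS) by apply/asboolP; exists (W + <[x]>)%VS.
move=> le; have := dimv_leqif_eq (addvSl W <[x]>) => /geq_leqif; rewrite le => /esym/eqP ->.
by apply: subvP (addvSr _ _) _ _; apply: memv_line.
Qed.

Lemma joint_kernel (K : fieldType) (A : falgType K) (n : nat)
    (chi : 'I_n -> {lrmorphism A -> K | *%R}) :
  {J : {vspace A} | forall x, x \in J <-> forall i, chi i x = 0}.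
Proof.
apply: subspace_of_pred => [i|c x y x0 y0 i]; first by rewrite linear0.
by rewrite linearP /= x0 y0 mulr0 addr0.
Qed.

(** * Local idempotents and the radical *)

Section Fitting.
Variables (K : closedFieldType) (A : falgType K).
Implicit Types (a b e f : A).

Lemma poly_annihilator a : exists2 p : {poly K}, p != 0 & horner_alg a p = 0.
Proof.
pose d := \dim {:A}.
pose X := [seq a ^+ i | i <- iota 0 d.+1].
have nfX : ~~ free X.
  apply/negP => fX; have := dimvS (subvf <<X>>%VS).
  by rewrite (eqP fX) size_map size_iota ltnn.
have [k s0 [i ki]] : exists2 k : 'I_(size X) -> K,
    \sum_(i < size X) k i *: X`_i = 0 & exists i, k i != 0.
  apply: contrapT => nk; case/negP: nfX; rewrite -[X]in_tupleE; apply/freeP.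
  move=> k sk i; apply: contrapT => /eqP ki; apply: nk; exists k => //.
  by exists i.
have szX : size X = d.+1 by rewrite size_map size_iota.
exists (\poly_(j < size X) (if insub j is Some j' then k j' else 0)).
  apply/eqP => /(congr1 (fun p : {poly K} => p`_i)).
  rewrite coef_poly ltn_ord coef0 insubT // => ii k0.
  case/eqP: ki; rewrite -[RHS]k0; congr k; exact: val_inj.
rewrite poly_def raddf_sum /= -[RHS]s0; apply: eq_bigr => j _.
rewrite linearZ /= rmorphXn /= horner_algX insubT ?ltn_ord // => jj.
rewrite (nth_map 0) ?size_iota -?szX // nth_iota -?szX // add0n mulr_algl.
by congr (k _ *: _); exact: val_inj.
Qed.

Lemma comm_horner_alg a b (p : {poly K}) :
  GRing.comm a b -> GRing.comm a (horner_alg b p).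
Proof.
move=> ab; elim/poly_ind: p => [|p c IH]; first by rewrite rmorph0; apply: commr0.
rewrite rmorphD rmorphM /= horner_algX horner_algC; apply: commrD.
  exact: commrM.
by rewrite /GRing.comm mulr_algl mulr_algr.
Qed.

(* Write an annihilating polynomial of b as X^m q with q(0) <> 0. *)
Lemma power_stabilizes b :
  exists m y, [/\ (0 < m)%N, forall a, GRing.comm a b -> GRing.comm a y &
    b ^+ m = y * b ^+ m.+1].
Proof.
have [p p0 pb] := poly_annihilator b.
have [m [q]] := multiplicity_XsubC p 0; rewrite p0 /= subr0 => rq pE.
pose h := drop_poly 1 q.
have qE : q = h * 'X + (q`_0)%:P.
  rewrite -[LHS](poly_take_drop 1) addrC expr1; congr (_ + _).
  by apply/polyP => i; rewrite coef_take_poly coefC; case: i.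
have q0 : q`_0 != 0 by move: rq; rewrite /root horner_coef0.
(* From b^m q(b) = 0 and q = h X + q(0) one gets b^m = - q(0)^-1 h(b) b^(m+1). The exponent is
   raised by one to make it positive. *)
exists m.+1, (- (q`_0)^-1 *: horner_alg b h); split=> //.
  move=> a ab; rewrite /GRing.comm -scalerAl -scalerAr.
  by congr (_ *: _); apply: comm_horner_alg.
have bm : q`_0 *: b ^+ m = - (horner_alg b h * b ^+ m.+1).
  apply/eqP; rewrite -addr_eq0 addrC exprS mulrA -mulr_algl -mulrDl -pb pE rmorphM rmorphXn /=.
  by rewrite {2}qE rmorphD rmorphM /= horner_algX horner_algC.
have bmE : b ^+ m = - (q`_0)^-1 *: (horner_alg b h * b ^+ m.+1).
  by rewrite scaleNr -scalerN -bm scalerA mulVf // scale1r.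
by rewrite [LHS]exprSr {1}bmE -!scalerAl -mulrA -[_ * b]exprSr.
Qed.

Definition in_corner e a := e * a = a /\ a * e = a.
Definition nilpotent a := exists k, a ^+ k = 0.
Definition local_idempotent e :=
  [/\ e != 0, e * e = e & forall f, f * f = f -> in_corner e f -> f = 0 \/ f = e].

Lemma primitive_local e : primitive_idempotent e -> local_idempotent e.
Proof.
case=> e0 ee pe; split=> //; first exact/eqP.
move=> f ff [ef fe].
have eE : e = f + (e - f) by rewrite addrC subrK.
have f1 : (e - f) * (e - f) = e - f.
  by rewrite mulrBl !mulrBr ee ef fe ff subrr subr0.
have f2 : f * (e - f) = 0 by rewrite mulrBr fe ff subrr.
have f3 : (e - f) * f = 0 by rewrite mulrBl ef ff subrr.
have [|/eqP] := pe f (e - f) ff f1 f2 f3 eE; first by left.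
by rewrite subr_eq0 => /eqP <-; right.
Qed.

Section Corner.
Variable e : A.
Hypothesis eP : local_idempotent e.
Local Notation corner := (in_corner e).

Let ee : e * e = e. Proof. by case: eP. Qed.

Lemma cornerM a b : corner a -> corner b -> corner (a * b).
Proof. by move=> [ea ae] [eb be]; split; rewrite ?mulrA ?ea -?mulrA ?be. Qed.

Lemma cornerD a b : corner a -> corner b -> corner (a + b).
Proof. by move=> [ea ae] [eb be]; split; rewrite ?mulrDr ?mulrDl ?ea ?eb ?ae ?be. Qed.

Lemma cornerZ c a : corner a -> corner (c *: a).
Proof. by move=> [ea ae]; split; rewrite -?scalerAr -?scalerAl ?ea ?ae. Qed.

Lemma corner_e : corner e. Proof. by split; rewrite ee. Qed.

Lemma cornerP a : corner (e * a * e).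
Proof. by split; rewrite ?mulrA ?ee // -mulrA ee. Qed.

(** Fitting's lemma in e A e: with [y] from [power_stabilizes], the element y^m b^m is an idempotent
    of the corner because b^m = y^m b^(2m). As [e] is local, this idempotent is 0, and [b] is
    nilpotent, or it is [e], and [b] is invertible. *)
Lemma corner_fitting b : corner b ->
  nilpotent b \/ exists c, [/\ corner c, b * c = e & c * b = e].
Proof.
move=> [eb be]; have [m [y [m0 cy bm]]] := power_stabilizes b.
have cby : GRing.comm b y by apply: cy.
have cey : GRing.comm e y by apply: cy; rewrite /GRing.comm eb be.
have ebm : e * b ^+ m = b ^+ m by case: m m0 {bm} => // m _; rewrite exprS mulrA eb.
have bme : b ^+ m * e = b ^+ m by case: m m0 {bm ebm} => // m _; rewrite exprSr -mulrA be.
have bmk k : b ^+ m = y ^+ k * b ^+ (m + k).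
  elim: k => [|k IH]; first by rewrite mul1r addn0.
  by rewrite {1}IH exprD bm -mulrA -exprD addSn mulrA -exprSr addnS.
pose f := y ^+ m * b ^+ m.
have ff : f * f = f.
  rewrite /f -mulrA; congr (_ * _).
  have -> : b ^+ m * (y ^+ m * b ^+ m) = y ^+ m * (b ^+ m * b ^+ m).
    by rewrite !mulrA; congr (_ * _); apply: commrX; apply/commr_sym/commrX/commr_sym.
  by rewrite -exprD -bmk.
have ceym : GRing.comm e (y ^+ m) by apply: commrX.
have fc : corner f.
  by split; rewrite /f ?mulrA ?[e * _]ceym -mulrA ?ebm ?bme.
case: eP => _ _ /(_ f ff fc)[f0|fe].
  left; exists m; rewrite (bmk m) exprD mulrA -/f f0 mul0r //.
right; exists (e * y ^+ m * b ^+ m.-1); split.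
- split; first by rewrite !mulrA ee.
  rewrite -!mulrA; have -> : b ^+ m.-1 * e = e * b ^+ m.-1.
    by apply/commr_sym/commrX; rewrite /GRing.comm eb be.
  by rewrite !mulrA; congr (_ * _); rewrite -mulrA -ceym mulrA ee.
- rewrite mulrA [b * _](_ : _ = y ^+ m * b).
    by rewrite -mulrA -exprS prednK.
  by rewrite mulrA be; apply: commrX.
by rewrite -mulrA -exprSr prednK // -mulrA -/f fe ee.
Qed.

Lemma corner_invX x z k : corner x -> corner z -> x * z = e ->
  x ^+ k.+1 * z ^+ k.+1 = e.
Proof.
move=> [ex xe] [ez ze] xz; elim: k => [|k IH]; first by rewrite !expr1.
rewrite exprSr [z ^+ k.+2]exprS mulrA -[_ * x * z]mulrA xz -mulrA.
by rewrite -[in RHS]IH; congr (_ * _); rewrite exprS mulrA ez.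
Qed.

Lemma nilpotent_not_rinv x z : corner x -> corner z -> x * z = e -> ~ nilpotent x.
Proof.
move=> cx cz xz [k xk]; have := corner_invX k cx cz xz.
by rewrite exprS xk mulr0 mul0r => e0; case: eP; rewrite -e0 eqxx.
Qed.

Lemma nilpotentMr x y : corner x -> corner y -> nilpotent x -> nilpotent (x * y).
Proof.
move=> cx cy nx; have [//|[c [cc xyc _]]] := corner_fitting (cornerM cx cy).
by case: (@nilpotent_not_rinv x (y * c)) => //; [apply: cornerM|rewrite mulrA].
Qed.

Lemma nilpotentZ c x : nilpotent x -> nilpotent (c *: x).
Proof. by case=> k xk; exists k; rewrite exprZn xk scaler0. Qed.

Lemma corner_sub_nilpotent n : corner n -> nilpotent n ->
  exists2 z, corner z & (e - n) * z = e.
Proof.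
move=> [en ne] [k nk]; exists (e * (\sum_(i < k) n ^+ i) * e); first exact: cornerP.
have -> : (e - n) * (e * (\sum_(i < k) n ^+ i) * e) = e * ((1 - n) * (\sum_(i < k) n ^+ i)) * e.
  by rewrite !mulrA mulrBl mulrBr ee ne mulr1 en.
by rewrite -[1 - n]opprB mulNr -subrX1 nk sub0r opprK mulr1.
Qed.

(** If x + y had an inverse c, then y c = e - x c would have a right inverse, x c being nilpotent;
    but y c is nilpotent too. *)
Lemma nilpotentD x y : corner x -> corner y -> nilpotent x -> nilpotent y ->
  nilpotent (x + y).
Proof.
move=> cx cy nx ny; have [//|[c [cc xyc _]]] := corner_fitting (cornerD cx cy).
have [z cz yz] := corner_sub_nilpotent (cornerM cx cc) (nilpotentMr cx cc nx).
have yE : e - x * c = y * c by rewrite -xyc mulrDl addrC addKr.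
case: (@nilpotent_not_rinv (y * c) z) => //; first exact: cornerM.
  by rewrite -yE.
exact: nilpotentMr.
Qed.

Lemma corner_split_prod a (r : seq K) : corner a ->
  (forall z, z \in r -> ~ nilpotent (a - z *: e)) ->
  exists d, e * (\prod_(z <- r) (a - z%:A)) * d = e.
Proof.
move=> ca; elim: r => [|z r IH] nr.
  by exists e; rewrite big_nil mulr1 ee.
have [|d Pd] := IH; first by move=> y yr; apply: nr; rewrite inE yr orbT.
have cz : corner (a - z *: e).
  by rewrite -scaleNr; apply: cornerD => //; apply: cornerZ; apply: corner_e.
have [|[c [cc zc _]]] := corner_fitting cz.
  by move/nr; rewrite inE eqxx => /(_ isT).
exists (d * c); rewrite big_cons.
have -> : e * ((a - z%:A) * \prod_(j <- r) (a - j%:A)) =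
    (a - z *: e) * (e * \prod_(j <- r) (a - j%:A)).
  rewrite !mulrA; congr (_ * _); case: (ca) => ea ae.
  by rewrite mulrBr mulrBl ea ae -scalerAl -scalerAr ee mulr1.
by rewrite mulrA -[_ * _ * d]mulrA Pd [_ * e](proj2 cz).
Qed.

(** Here the field is algebraically closed: an annihilating polynomial of [a] splits, and if every a
    - z e were invertible in the corner, the vanishing product of the factors would have a right
    inverse. *)
Lemma corner_eigenvalue a : corner a -> exists c, nilpotent (a - c *: e).
Proof.
move=> ca; apply: contrapT => na.
have [p p0 pa] := poly_annihilator a.
have [r pE] := closed_field_poly_normal p.
have [z _|d] := @corner_split_prod a r ca.
  by move=> nz; apply: na; exists z.
suff -> : \prod_(z <- r) (a - z%:A) = 0.
  by rewrite mulr0 mul0r => e0; case: eP; rewrite -e0 eqxx.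
move: pa; rewrite pE linearZ /= rmorph_prod /=.
rewrite (eq_bigr (fun z => a - z%:A)); last first.
  by move=> z _; rewrite rmorphB /= horner_algX horner_algC.
by rewrite mulr_algl => /eqP; rewrite scaler_eq0 lead_coef_eq0 (negbTE p0) => /eqP.
Qed.

Lemma corner_eigenvalue_uniq a c d : corner a ->
  nilpotent (a - c *: e) -> nilpotent (a - d *: e) -> c = d.
Proof.
move=> ca nc nd; apply/eqP; rewrite -subr_eq0; apply: contrapT => /negP cd.
have cN z : corner (a - z *: e).
  by rewrite -scaleNr; apply: cornerD => //; apply: cornerZ; apply: corner_e.
have : nilpotent ((c - d) *: e).
  have -> : (c - d) *: e = (a - d *: e) + (-1) *: (a - c *: e).
    by rewrite scaleN1r scalerBl opprB [RHS]addrC addrA subrK.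
  by apply: nilpotentD => //; [apply: cornerZ|apply: nilpotentZ].
apply: (@nilpotent_not_rinv _ ((c - d)^-1 *: e)).
- by apply: cornerZ; apply: corner_e.
- by apply: cornerZ; apply: corner_e.
- by rewrite -scalerAl -scalerAr scalerA mulfV // scale1r ee.
Qed.

End Corner.
End Fitting.

(** * Characters of a basic algebra and nilpotence of their joint kernel *)

Section BasicAlgebra.
Variables (K : closedFieldType) (A : falgType K) (n : nat) (e : 'I_n -> A).
Hypothesis eP : complete_primitive_idempotents e.
Hypothesis basic : forall i j, rm_iso (right_ideal (e i)) (right_ideal (e j)) -> i = j.

Lemma idem_local i : local_idempotent (e i).
Proof. by case: eP => /(_ i)/primitive_local. Qed.
#[local] Hint Resolve idem_local : core.

Lemma idemM i j : e i * e j = if i == j then e i else 0.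
Proof.
case: eqP => [->|]; first by case: (idem_local j).
by case: eP => _ + _; apply.
Qed.

(** Left multiplications by [v] and by [u] are inverse isomorphisms between e_i A and e_j A. *)
Lemma right_ideal_iso i j u v : e i * u = u -> u * e j = u ->
  e j * v = v -> v * e i = v -> u * v = e i -> v * u = e j -> i = j.
Proof.
move=> eu ue ev ve uv vu; apply: basic.
have memP k (a : A) : (a \in limg (amull (e k))) = (e k * a == a).
  apply/memv_imgP/eqP => [[b _ ->]|<-]; last by exists a; rewrite ?memvf ?lfunE.
  by rewrite lfunE /= mulrA idemM eqxx.
have Rv k (x : right_ideal (e k)) : e k * vsval x = vsval x.
  by apply/eqP; rewrite -memP; apply: subvsP.
have inv l y (a : A) : e l * y = y -> y * a \in limg (amull (e l)).
  by move=> ly; rewrite memP mulrA ly.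
pose f (x : right_ideal (e i)) : right_ideal (e j) := vsproj _ (v * vsval x).
pose g (x : right_ideal (e j)) : right_ideal (e i) := vsproj _ (u * vsval x).
have fE x : vsval (f x) = v * vsval x by apply: vsprojK; apply: inv.
have gE x : vsval (g x) = u * vsval x by apply: vsprojK; apply: inv.
have flin : linear f.
  by move=> c x y; rewrite /f linearP /= mulrDr -scalerAr linearP.
pose f' : {linear right_ideal (e i) -> right_ideal (e j)} :=
  HB.pack f (GRing.isLinear.Build K (right_ideal (e i)) (right_ideal (e j)) *:%R f flin).
exists f'.
  exists g => x; apply: val_inj => /=.
    by rewrite gE fE mulrA uv Rv.
  by rewrite fE gE mulrA vu Rv.
move=> x a; apply: val_inj.
change (vsval (f (sub_act x a)) = vsval (sub_act (f x) a)).
by rewrite fE !sub_actE fE /= mulrA.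
Qed.

(** If x y had an inverse c in e_i A e_i, then v = y c would satisfy x v = e_i, and v x would be a
    nonzero idempotent of e_j A e_j, hence e_j. Then x and v make e_i A and e_j A isomorphic,
    against [basic]. *)
Lemma nilpotent_through i j a b : i != j -> in_corner (e i) (e i * a * e j * (e j * b * e i)) /\
  nilpotent (e i * a * e j * (e j * b * e i)).
Proof.
move=> ij; set x := e i * a * e j; set y := e j * b * e i.
have ex : e i * x = x by rewrite /x !mulrA idemM eqxx.
have xe : x * e j = x by rewrite /x -!mulrA idemM eqxx.
have ey : e j * y = y by rewrite /y !mulrA idemM eqxx.
have ye : y * e i = y by rewrite /y -!mulrA idemM eqxx.
have cxy : in_corner (e i) (x * y) by split; [rewrite mulrA ex|rewrite -mulrA ye].
split=> //; have [//|[c [[ec ce] xyc _]]] := corner_fitting (idem_local i) cxy.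
pose v := y * c.
have uv : x * v = e i by rewrite mulrA.
have ev : e j * v = v by rewrite mulrA ey.
have ve : v * e i = v by rewrite -mulrA ce.
have [e0 _ /(_ (v * x))[||v0|vx]] := idem_local j.
- by rewrite mulrA -[v * x * v]mulrA uv ve.
- by split; [rewrite mulrA ev|rewrite -mulrA xe].
- have : x * (v * x) * v = 0 by rewrite v0 mulr0 mul0r.
  rewrite mulrA uv ex uv => e00; have [] := idem_local i; by rewrite e00 eqxx.
by case/eqP: ij; apply: (right_ideal_iso ex xe ev ve uv vx).
Qed.

Lemma idem_decomp i a : exists c, nilpotent (e i * a * e i - c *: e i).
Proof. by apply: corner_eigenvalue => //; apply: cornerP. Qed.

Definition character i a : K := sval (cid (idem_decomp i a)).

Lemma characterP i a c : nilpotent (e i * a * e i - c *: e i) -> character i a = c.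
Proof.
move=> nc; rewrite /character; case: cid => d /= nd.
exact: (corner_eigenvalue_uniq (idem_local i) (cornerP (idem_local i) a) nd nc).
Qed.

Lemma character_nilpotent i a : nilpotent (e i * a * e i - character i a *: e i).
Proof. by rewrite /character; case: cid. Qed.

Let cC i a c : in_corner (e i) (e i * a * e i - c *: e i).
Proof.
rewrite -scaleNr; apply: cornerD => //; first exact: cornerP.
by apply: cornerZ; apply: corner_e.
Qed.

Lemma character_linear i : scalar (character i).
Proof.
move=> c a b; apply: characterP.
have -> : e i * (c *: a + b) * e i - (c * character i a + character i b) *: e i =
   c *: (e i * a * e i - character i a *: e i) + (e i * b * e i - character i b *: e i).
  rewrite mulrDr mulrDl -scalerAr -scalerAl scalerDl -scalerA scalerBr opprD.
  by rewrite addrACA.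
apply: (nilpotentD (idem_local i)); [exact: cornerZ|exact: cC| |exact: character_nilpotent].
exact/nilpotentZ/character_nilpotent.
Qed.

(** Insert the sum of the e_j between a and b. The term j = i multiplies the scalar parts up to
    nilpotents, and the other terms pass through another vertex and are nilpotent by
    [nilpotent_through]. In a local corner the nilpotents are closed under sums. *)
Lemma character_monoid i : monoid_morphism (character i).
Proof.
split=> [|a b]; apply: characterP.
  by rewrite mulr1 idemM eqxx scale1r subrr; exists 1; rewrite expr1.
case: eP => _ _ e1.
set x := character i a; set y := character i b.
pose p := e i * a * e i - x *: e i; pose q := e i * b * e i - y *: e i.
have cp : in_corner (e i) p by apply: cC.
have cq : in_corner (e i) q by apply: cC.
have np : nilpotent p by apply: character_nilpotent.
have nq : nilpotent q by apply: character_nilpotent.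
have pE : e i * a * e i = p + x *: e i by rewrite subrK.
have qE : e i * b * e i = q + y *: e i by rewrite subrK.
clearbody p q.
have -> : e i * (a * b) * e i - (x * y) *: e i =
   (p * q + y *: p + x *: q) +
     \sum_(j < n | j != i) e i * a * e j * (e j * b * e i).
  rewrite -[a * b]mulr1 -[1 in LHS]mul1r.
  have -> : e i * (a * b * (1 * 1)) * e i = \sum_(j < n) e i * a * e j * (e j * b * e i).
    rewrite !mulr1 -[a in LHS]mulr1 -e1 mulr_sumr mulr_suml mulr_sumr mulr_suml.
    apply: eq_bigr => j _; rewrite !mulrA; congr (_ * _ * _); rewrite -[RHS]mulrA.
    by rewrite idemM eqxx.
  rewrite (bigD1 i) //= -addrA addrC -addrA [in RHS]addrC; congr (_ + _).
  rewrite pE qE.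
  rewrite mulrDl !mulrDr -!scalerAl -!scalerAr (proj2 cp) (proj1 cq) idemM eqxx scalerA.
  by rewrite addrC addrA addrK.
have [cs ns] : in_corner (e i) (\sum_(j < n | j != i) e i * a * e j * (e j * b * e i)) /\
   nilpotent (\sum_(j < n | j != i) e i * a * e j * (e j * b * e i)).
  apply: (big_ind (fun x => in_corner (e i) x /\ nilpotent x)).
    by split; [split; rewrite ?mulr0 ?mul0r|exists 1; rewrite expr1].
    by move=> u v [cu nu] [cv nv]; split; [apply: cornerD|apply: (nilpotentD (idem_local i))].
  by move=> j ji; apply: nilpotent_through; rewrite eq_sym.
apply: (nilpotentD (idem_local i)) => //.
  by apply: cornerD; [apply: cornerD; [apply: cornerM|apply: cornerZ]|apply: cornerZ].
apply: (nilpotentD (idem_local i)); [|exact: cornerZ| |exact: nilpotentZ].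
  by apply: cornerD; [apply: cornerM|apply: cornerZ].
apply: (nilpotentD (idem_local i)); [exact: cornerM|exact: cornerZ| |exact: nilpotentZ].
exact: (nilpotentMr (idem_local i)).
Qed.

Lemma exists_characters : exists chi : 'I_n -> {lrmorphism A -> K | *%R},
  (forall i j, chi i (e j) = (i == j)%:R) /\
  (forall i a, chi i a = 0 -> nilpotent (e i * a * e i)).
Proof.
pose chi i : {lrmorphism A -> K | *%R} :=
  HB.pack (character i) (GRing.isLinear.Build _ _ _ _ _ (character_linear i))
   (GRing.isMonoidMorphism.Build _ _ _ (character_monoid i)).
exists chi; split=> [i j|i a a0].
  apply: characterP; rewrite idemM; case: (eqVneq i j) => [_|_].
    by rewrite idemM eqxx scale1r subrr; exists 1; rewrite expr1.
  by rewrite mul0r scale0r subrr; exists 1; rewrite expr1.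
by have := character_nilpotent i a; rewrite [character i a]a0 scale0r subr0.
Qed.

Variable chi : 'I_n -> {lrmorphism A -> K | *%R}.
Hypothesis chi_nil : forall i a, chi i a = 0 -> nilpotent (e i * a * e i).

(** The powers of [J] stabilise at some I = J^(m+1). If I is not zero, choose X maximal among the
    right ideals properly inside I. For some y = x e_i outside X one finds y J <= X and I = X + y A,
    hence I J <= X, although I J = I. *)
Lemma char_radical_nilpotent (J : {vspace A}) :
  (forall x, x \in J <-> forall i, chi i x = 0) -> exists m, (J ^+ m = 0)%VS.
Proof.
move=> JP.
have Jr x a : x \in J -> x * a \in J.
  by move=> /JP x0; apply/JP => i; rewrite rmorphM /= x0 mul0r.
have decr m : (J ^+ m.+1 * fullv <= J ^+ m.+1)%VS.
  rewrite expvSr -prodvA; apply: prodvSr; apply/prodvP => x a Jx _; exact: Jr.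
have decrS m : (J ^+ m.+2 <= J ^+ m.+1)%VS.
  by rewrite expvSr; apply: subv_trans (decr m); apply: prodvSr; apply: subvf.
have [m eqm] : exists m, (J ^+ m.+2 = J ^+ m.+1)%VS.
  apply: contrapT => nm.
  have lt k : (\dim (J ^+ k.+1) + k <= \dim {:A})%N.
    elim: k => [|k IH]; first by rewrite addn0; apply: dimvS; apply: subvf.
    apply: leq_trans IH; rewrite addnS ltn_add2r ltn_neqAle dimvS ?andbT //.
    apply/negP => /eqP E; apply: nm; exists k; apply/eqP.
    by rewrite eqEdim decrS E leqnn.
  by have := lt (\dim {:A}).+1; rewrite addnS ltnNge leq_addl.
exists m.+1; apply: contrapT => /eqP I0.
set I := (J ^+ m.+1)%VS in I0 eqm.
pose good (X : {vspace A}) := [/\ (X <= I)%VS, X != I & forall x a, x \in X -> x * a \in X].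
pose p k := `[< exists2 X, good X & \dim X = k >].
have p0 : exists k, p k.
  exists 0; apply/asboolP; exists 0%VS; last exact: dimv0.
  by split; rewrite ?sub0v // 1?eq_sym // => x a; rewrite !memv0 => /eqP ->; rewrite mul0r.
have pb k : p k -> (k <= \dim I)%N by move=> /asboolP[X [XI _ _] <-]; apply: dimvS.
case: (ex_maxnP p0 pb) => k /asboolP[X [XI XnI Xs] <-] maxX.
have [x Ix Xx] : exists2 x, x \in I & x \notin X.
  apply/subvPn; apply: contra XnI => IX; by rewrite eqEsubv XI IX.
have Is y a : y \in I -> y * a \in I.
  by move=> Iy; apply: (subvP (decr m)); apply: memv_mul => //; apply: memvf.
have [i Xxi] : exists i, x * e i \notin X.
  apply: contrapT => nX; case/negP: Xx.
  rewrite -[x]mulr1; case: eP => _ _ <-; rewrite mulr_sumr; apply: memv_suml => i _.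
  by apply: contrapT => /negP ?; apply: nX; exists i.
pose y := x * e i.
have Iy : y \in I by apply: Is.
have ye : y * e i = y by rewrite -mulrA idemM eqxx.
have big (Z : {vspace A}) : (X <= Z)%VS -> (Z <= I)%VS -> (forall z a, z \in Z -> z * a \in Z) ->
   (exists2 z, z \in Z & z \notin X) -> Z = I.
  move=> XZ ZI Zs [z Zz Xz]; apply: contrapT => /eqP ZnI.
  have /maxX : p (\dim Z) by apply/asboolP; exists Z.
  move=> le; have := dimv_leqif_eq XZ => /geq_leqif; rewrite le => /esym/eqP E.
  by rewrite E Zz in Xz.
(* Otherwise X + y J is all of I and contains y, so y = u + y b with u in X and b in J. As chi_i b =
   0, the element e_i b e_i is nilpotent and e_i - e_i b e_i has a right inverse; multiplying by it
   puts y into X. *)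
have yJ j : j \in J -> y * j \in X.
  move=> Jj; apply: contrapT => /negP nyj.
  have [W WP] : {W : {vspace A} | forall z,
      z \in W <-> exists u b, [/\ u \in X, b \in J & z = u + y * b]}.
    apply: subspace_of_pred => [|c z1 z2 [u1 [b1 [Xu1 Jb1 ->]]] [u2 [b2 [Xu2 Jb2 ->]]]].
      by exists 0, 0; rewrite !mem0v mulr0 addr0.
    exists (c *: u1 + u2), (c *: b1 + b2); rewrite !memvD ?memvZ //; split=> //.
    by rewrite mulrDr scalerDr -scalerAr addrACA.
  have WI : W = I.
    apply: big.
    - by apply/subvP => u Xu; apply/WP; exists u, 0; rewrite mem0v mulr0 addr0.
    - by apply/subvP => z /WP[u [b [Xu Jb ->]]]; rewrite memvD ?Is // (subvP XI).
    - move=> z a /WP[u [b [Xu Jb ->]]]; apply/WP; exists (u * a), (b * a).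
      by rewrite Xs ?Jr // mulrDl mulrA.
    - by exists (y * j) => //; apply/WP; exists 0, j; rewrite mem0v add0r.
  have /WP[u [b [Xu Jb yE]]] : y \in W by rewrite WI.
  have cb : in_corner (e i) (e i * b * e i) by apply: cornerP.
  have nb : nilpotent (e i * b * e i) by apply: chi_nil; move/JP: Jb.
  have [z cz bz] := corner_sub_nilpotent (idem_local i) cb nb.
  case/negP: Xxi; rewrite -/y -[y]ye -bz mulrA; apply: (Xs).
  rewrite mulrBr ye.
  have -> : y * (e i * b * e i) = (y - u) * e i.
    by rewrite [in RHS]yE addrC addKr !mulrA ye.
  by rewrite mulrBl ye opprB addrC subrK Xs.
have [W WP] : {W : {vspace A} | forall z, z \in W <-> exists u a, u \in X /\ z = u + y * a}.
  apply: subspace_of_pred => [|c z1 z2 [u1 [b1 [Xu1 ->]]] [u2 [b2 [Xu2 ->]]]].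
    by exists 0, 0; rewrite !mem0v mulr0 addr0.
  exists (c *: u1 + u2), (c *: b1 + b2); rewrite !memvD ?memvZ //; split=> //.
  by rewrite mulrDr scalerDr -scalerAr addrACA.
have WI : W = I.
  apply: big.
  - by apply/subvP => u Xu; apply/WP; exists u, 0; rewrite mulr0 addr0.
  - by apply/subvP => z /WP[u [b [Xu ->]]]; rewrite memvD ?Is // (subvP XI).
  - move=> z a /WP[u [b [Xu ->]]]; apply/WP; exists (u * a), (b * a).
    by rewrite Xs // mulrDl mulrA.
  - by exists y => //; apply/WP; exists 0, 1; rewrite mem0v add0r mulr1.
have IX : (I <= X)%VS.
  rewrite -[X in (X <= _)%VS]eqm expvSr -/I -[X in (X * _)%VS]WI.
  apply/prodvP => z j /WP[u [a [Xu ->]]] Jj.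
  rewrite mulrDl; apply: memvD; first exact: Xs.
  by rewrite -mulrA; apply: yJ; apply/JP => l; rewrite rmorphM /= (proj1 (JP j) Jj) mulr0.
by case/negP: XnI; rewrite eqEsubv XI IX.
Qed.

End BasicAlgebra.

(* The characters chi i identify A / jac with a product of copies of K, so jac
   is the Jacobson radical and the idempotents are the vertices. *)
Record split_data (K : fieldType) (A : falgType K) := SplitData {
  nvert : nat;
  idem : 'I_nvert -> A;
  chi : 'I_nvert -> {lrmorphism A -> K | *%R};
  jac : {vspace A};
  nilindex : nat;
  idem_mul : forall i j, idem i * idem j = if i == j then idem i else 0;
  idem_sum : \sum_i idem i = 1;
  chi_idem : forall i j, chi i (idem j) = (i == j)%:R;
  jacP : forall x, x \in jac <-> forall i, chi i x = 0;
  jac_nilp : (jac ^+ nilindex = 0)%VS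
}.

Lemma basic_split (K : closedFieldType) (A : falgType K) :
  basic_alg A -> exists D : split_data A, True.
Proof.
move=> [n [e [eP basic]]].
have [chi [chie chin]] := exists_characters eP basic.
have [J JP] := joint_kernel chi.
have [m Jm] := char_radical_nilpotent eP chin JP.
have [_ _ e1] := eP.
by exists (SplitData (idemM eP) e1 chie JP Jm).
Qed.

(** * Modules over a split algebra *)

Section Action.
Variables (K : fieldType) (A : falgType K) (M : rmodule A).
Implicit Types (x y : M) (a b : A).

Lemma ractDl x y a : ract (x + y) a = ract x a + ract y a.
Proof. by have := ract_linear_l a 1 x y; rewrite !scale1r. Qed.

Lemma ractDr x a b : ract x (a + b) = ract x a + ract x b.
Proof. by have := ract_linear_r x 1 a b; rewrite !scale1r. Qed.

Lemma ract0l a : ract (0 : M) a = 0.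
Proof. by apply: (@addrI _ (ract 0 a)); rewrite -ractDl !addr0. Qed.

Lemma ract0r x : ract x 0 = 0.
Proof. by apply: (@addrI _ (ract x 0)); rewrite -ractDr !addr0. Qed.

Lemma ractZl c x a : ract (c *: x) a = c *: ract x a.
Proof. by have := ract_linear_l a c x 0; rewrite !addr0 ract0l addr0. Qed.

Lemma ractZr x c a : ract x (c *: a) = c *: ract x a.
Proof. by have := ract_linear_r x c a 0; rewrite !addr0 ract0r addr0. Qed.

Lemma ractBr x a b : ract x (a - b) = ract x a - ract x b.
Proof. by rewrite ractDr -scaleN1r ractZr scaleN1r. Qed.

Lemma ract_sumr x (I : finType) (P : pred I) (F : I -> A) :
  ract x (\sum_(i | P i) F i) = \sum_(i | P i) ract x (F i).
Proof. by apply: (big_morph _ (ractDr x) (ract0r x)). Qed.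

End Action.

Section SplitAlgebra.
Variables (K : fieldType) (A : falgType K) (D : split_data A).
Local Notation e := (@idem _ _ D).
Local Notation chi := (@chi _ _ D).
Local Notation J := (jac D).
Implicit Types (a b : A).

(** The recursion starts at the whole algebra, whereas [J ^+ 0] is only the line of 1; from k = 1 on
    these are the powers of J. *)
Fixpoint radp k : {vspace A} := if k is k'.+1 then (radp k' * J)%VS else fullv.

Lemma jac0 i x : x \in J -> chi i x = 0.
Proof. by move/jacP. Qed.

Lemma jac_mulr x a : x \in J -> x * a \in J.
Proof. by move=> Jx; apply/jacP => i; rewrite rmorphM /= (jac0 i Jx) mul0r. Qed.

Lemma jac_mull x a : x \in J -> a * x \in J.
Proof. by move=> Jx; apply/jacP => i; rewrite rmorphM /= (jac0 i Jx) mulr0. Qed.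

Lemma radp1 : radp 1 = J.
Proof.
apply/eqP; rewrite eqEsubv /=; apply/andP; split.
  by apply/prodvP => a x _; apply: jac_mull.
by apply/subvP => x Jx; rewrite -[x]mul1r memv_mul ?memvf.
Qed.

Lemma radpE k : radp k.+1 = (J ^+ k.+1)%VS.
Proof. by elim: k => [|k IH]; [rewrite radp1|rewrite expvSr -IH]. Qed.

Lemma mem_radpS k x y : x \in radp k -> y \in J -> x * y \in radp k.+1.
Proof. exact: memv_mul. Qed.

Lemma mem_radpSl k x y : x \in J -> y \in radp k -> x * y \in radp k.+1.
Proof.
case: k => [|k] Jx; first by rewrite radp1 => _; apply: jac_mulr.
by rewrite !radpE [(J ^+ k.+2)%VS]expvSl => Jy; apply: memv_mul.
Qed.

Lemma radp_subv k (U : {vspace A}) :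
  (forall x y, x \in radp k -> y \in J -> x * y \in U) -> (radp k.+1 <= U)%VS.
Proof. by move=> h; apply/prodvP => x y; apply: h. Qed.

Lemma radp_subvl k (U : {vspace A}) :
  (forall x y, x \in J -> y \in radp k -> x * y \in U) -> (radp k.+1 <= U)%VS.
Proof.
case: k => [|k] h.
  by rewrite radp1; apply/subvP => x Jx; rewrite -[x]mulr1 h ?memvf.
by rewrite radpE expvSl; apply/prodvP => x y; rewrite -radpE; apply: h.
Qed.

Lemma radp_mulr k x a : x \in radp k -> x * a \in radp k.
Proof.
case: k => [|k] xR; first by rewrite memvf.
have le : (radp k.+1 * fullv <= radp k.+1)%VS.
  rewrite /= -prodvA; apply: prodvSr; apply/prodvP => u v Ju _; exact: jac_mulr.
by apply: (subvP le); apply: memv_mul => //; apply: memvf.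
Qed.

Lemma radp_mull k x a : x \in radp k -> a * x \in radp k.
Proof.
case: k => [|k] xR; first by rewrite memvf.
have le : (fullv * radp k.+1 <= radp k.+1)%VS.
  rewrite radpE expvSl prodvA; apply: prodvSl; apply/prodvP => u v _; exact: jac_mull.
by apply: (subvP le); apply: memv_mul => //; apply: memvf.
Qed.

Lemma radpW k l x : (l <= k)%N -> x \in radp k -> x \in radp l.
Proof.
move/subnK <-; elim: (k - l)%N => [//|d IH]; rewrite addSn => xR; apply: IH.
move: x xR; apply/subvP; apply: radp_subv => x y xR _; exact: radp_mulr.
Qed.

Lemma nilindex_gt0 : (0 < nilindex D)%N.
Proof.
have := jac_nilp D; case: (nilindex D) => // /eqP.
by rewrite expv0 (negbTE (vspace1_neq0 A)).
Qed.

Lemma radp_nil : radp (nilindex D) = 0%VS.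
Proof. by have := jac_nilp D; case: (nilindex D) nilindex_gt0 => // k _; rewrite radpE. Qed.

(** The component in J for the decomposition of A into the span of the e_i and J. *)
Definition jpart a := a - \sum_i chi i a *: e i.

Lemma jpartP a : jpart a \in J.
Proof.
apply/jacP => i; rewrite raddfB raddf_sum /= (bigD1 i) //= linearZ /= chi_idem eqxx mulr1.
rewrite big1 ?addr0 ?subrr // => j ji.
by rewrite linearZ /= chi_idem eq_sym (negbTE ji) mulr0.
Qed.

Lemma jpartE a : a = \sum_i chi i a *: e i + jpart a.
Proof. by rewrite addrC subrK. Qed.

Lemma idem_diag i : e i * e i = e i.
Proof. by rewrite idem_mul eqxx. Qed.

Lemma idem_off i j a : i != j -> e i * a * e j \in J.
Proof.
move=> ij; apply/jacP => k; rewrite !rmorphM /= !chi_idem.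
case: eqP => [->|_]; last by rewrite !mul0r.
by rewrite (negbTE ij) mulr0.
Qed.

(** Iterating gives x = x y^k, and y^k vanishes once k reaches the nilpotency index. *)
Lemma jac_unit x y : y \in J -> x = x * y -> x = 0.
Proof.
move=> Jy xy; have xk k : x = x * y ^+ k.
  by elim: k => [|k IH]; [rewrite mulr1|rewrite exprS mulrA -xy].
have yk k : y ^+ k \in radp k.
  by elim: k => [|k IH]; [rewrite memvf|rewrite exprSr mem_radpS].
by apply/eqP; rewrite -memv0 -radp_nil (xk (nilindex D)) radp_mull.
Qed.

Section Modules.
Variable M : rmodule A.
Implicit Types (U V W X H : {vspace M}).

Lemma ract_idem_sum (x : M) : x = \sum_i ract x (e i).
Proof. by rewrite -ract_sumr idem_sum ract1. Qed.

Lemma ract_split (x : M) a :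
  ract x a = \sum_i chi i a *: ract x (e i) + ract x (jpart a).
Proof.
rewrite {1}(jpartE a) ractDr ract_sumr; congr (_ + _).
by apply: eq_bigr => i _; rewrite ractZr.
Qed.

Lemma stable_split U :
  (forall x i, x \in U -> ract x (e i) \in U) ->
  (forall x j, x \in U -> j \in J -> ract x j \in U) -> stable U.
Proof.
move=> Ue UJ x a Ux; rewrite ract_split memvD ?UJ ?jpartP //.
by apply: memv_suml => i _; rewrite memvZ ?Ue.
Qed.

(** Let W0 consist of the y in V with y e_i in U. For y in V, both y J and the y e_k with k
    different from i fall into W0, so every subspace between W0 and V is stable. A complement of the
    line of x in V that contains W0 is therefore a maximal submodule. *)
Lemma hyperplane i V U (x : M) : stable V -> stable U ->
  (forall y j, y \in V -> j \in J -> ract y j \in U) ->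
  x \in V -> ract x (e i) = x -> x \notin U ->
  exists H, [/\ maximal_submodule H V, (U :&: V <= H)%VS, x \notin H &
     (V <= H + <[x]>)%VS].
Proof.
move=> sV sU VJ Vx xe nUx.
have [W0 W0P] : {W : {vspace M} | forall y, y \in W <-> y \in V /\ ract y (e i) \in U}.
  apply: subspace_of_pred => [|c y z [Vy Uy] [Vz Uz]].
    by rewrite ract0l !mem0v.
  by rewrite ractDl ractZl !memvD ?memvZ.
have W0V : (W0 <= V)%VS by apply/subvP => y /W0P[].
have nW0x : x \notin W0 by apply/negP => /W0P[_]; rewrite xe; apply/negP.
pose Z := (W0 + <[x]>)%VS; pose H := (W0 + (V :\: Z))%VS.
have HV : (H <= V)%VS by rewrite subv_add W0V diffvSl.
have VH : (V <= H + <[x]>)%VS.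
  rewrite /H -addvA [(_ + <[x]>)%VS]addvC addvA -/Z addvC addv_diff.
  exact: addvSl.
have nHx : x \notin H.
  apply/negP => /memv_addP[w Ww [d Dd xE]].
  have dE : d = x - w by rewrite xE addrC addKr.
  have : d \in ((V :\: Z) :&: Z)%VS.
    rewrite memv_cap Dd dE memvB //.
      by apply: (subvP (addvSr _ _)); apply: memv_line.
    exact: (subvP (addvSl _ _)).
  by rewrite capv_diff memv0 dE subr_eq0 => /eqP xw; rewrite xw Ww in nW0x.
have sH : stable H.
  have W0H y : y \in W0 -> y \in H by apply/subvP; apply: addvSl.
  have offi y k : y \in V -> k != i -> ract y (e k) \in W0.
    move=> Vy ki; apply/W0P; split; first exact: sV.
    by rewrite -ractM idem_mul (negbTE ki) ract0r mem0v.
  apply: stable_split => [y k Hy|y j Hy Jj]; last first.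
    apply: W0H; apply/W0P; split; first by apply: sV; apply: (subvP HV).
    by apply: sU; apply: VJ => //; apply: (subvP HV).
  have [->|ki] := eqVneq k i; last by apply/W0H/offi => //; apply: (subvP HV).
  have := Hy; rewrite {1}[y]ract_idem_sum (bigD1 i) //= => Hs.
  rewrite -[ract y (e i)](addrK (\sum_(l < nvert D | l != i) ract y (e l))).
  rewrite memvB //; apply: memv_suml => l li; apply/W0H/offi => //.
  exact: (subvP HV).
exists H; split=> //.
  split=> //; first by move=> E; rewrite E Vx in nHx.
  move=> X sX HX XV; have [|/subvPn[y Xy nHy]] := boolP (X <= H)%VS.
    by move=> XH; left; apply/eqP; rewrite eqEsubv XH.
  right; apply/eqP; rewrite eqEsubv XV /=; apply: (subv_trans VH).
  have /memv_addP[h Hh [z /vlineP[c ->] yE]] := subvP VH _ (subvP XV _ Xy).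
  have c0 : c != 0 by apply: contraNneq nHy => c0; rewrite yE c0 scale0r addr0.
  rewrite subv_add HX -memvE.
  have -> : x = c^-1 *: (y - h) by rewrite yE addrC addKr scalerA mulVf // scale1r.
  by rewrite memvZ // memvB // (subvP HX).
apply: subv_trans (addvSl _ _); apply/subvP => y; rewrite memv_cap => /andP[Uy Vy].
by apply/W0P; split=> //; apply: sU.
Qed.

Lemma exists_component U (x : M) : x \notin U -> exists i, ract x (e i) \notin U.
Proof.
move=> nUx; apply: contrapT => nU; case/negP: nUx.
rewrite [x]ract_idem_sum; apply: memv_suml => i _.
by apply: contrapT => /negP ?; apply: nU; exists i.
Qed.

(** An element outside U has a component at some vertex outside U, and [hyperplane] gives a maximal
    submodule that misses this component. Applied repeatedly, this bounds the radical powers from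
    above. *)
Lemma rad_space_sub (V : submodule M) U : stable U ->
  (forall y j, y \in (V : {vspace M}) -> j \in J -> ract y j \in U) ->
  (rad_space V <= U)%VS.
Proof.
move=> sU VJ; apply/subvP => x rx; apply: contrapT => /negP /exists_component[i nUx].
have rxi : ract x (e i) \in rad_space V by apply: rad_stable.
have /rad_spaceP[Vxi Pxi] := rxi.
have xee : ract (ract x (e i)) (e i) = ract x (e i) by rewrite -ractM idem_diag.
have [H [maxH _ nHx _]] := hyperplane (@submod_stable _ _ _ V) sU VJ Vxi xee nUx.
by rewrite Pxi in nHx.
Qed.

(** Simple modules are one-dimensional: move an element of U outside W along powers of J as far as
    it stays outside W, and cut it down to one vertex. The result y satisfies y J <= W, so W plus
    the line of y is stable and equals U. *)
Lemma maximal_submodule_dim W U : stable U -> maximal_submodule W U ->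
  (\dim U <= (\dim W).+1)%N.
Proof.
move=> sU [sW WU nWU maxW].
have [x Ux nWx] : exists2 x, x \in U & x \notin W.
  apply/subvPn; apply/negP => UW; apply: nWU.
  by apply/eqP; rewrite eqEsubv WU UW.
pose p k := `[< forall a, a \in radp k -> ract x a \in W >].
have exp : exists k, p k.
  exists (nilindex D); apply/asboolP => a; rewrite radp_nil memv0 => /eqP ->.
  by rewrite ract0r mem0v.
case: (ex_minnP exp) => -[|k] /asboolP pk mink.
  by have := pk 1 (memvf _); rewrite ract1 (negbTE nWx).
have [a [aR nWa]] : exists a, a \in radp k /\ ract x a \notin W.
  apply: contrapT => na; have /mink : p k.
    by apply/asboolP => a aR; apply: contrapT => /negP ?; apply: na; exists a.
  by rewrite ltnn.
have [i nWi] := exists_component nWa.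
set y := ract _ _ in nWi.
have yi : ract y (e i) = y by rewrite -ractM idem_diag.
have yo j : j != i -> ract y (e j) = 0.
  by move=> ji; rewrite -yi -ractM idem_mul eq_sym (negbTE ji) ract0r.
have yJ j : j \in J -> ract y j \in W.
  by move=> Jj; rewrite -!ractM; apply: pk; apply: mem_radpS => //; apply: jac_mull.
have sWy : stable (W + <[y]>)%VS.
  have WWy z : z \in W -> z \in (W + <[y]>)%VS by apply/subvP; apply: addvSl.
  apply: stable_split => [z k' |z j] /memv_addP[w Ww [_ /vlineP[c ->] ->]].
    rewrite ractDl ractZl; apply: memvD; first by apply/WWy/sW.
    have [->|ki] := eqVneq k' i; last by rewrite yo // scaler0 mem0v.
    by rewrite yi memvZ // (subvP (addvSr _ _)) // memv_line.
  by move=> Jj; apply: WWy; rewrite ractDl ractZl memvD ?memvZ ?yJ // sW.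
have Uy : y \in U by do 2!apply: (sU).
have [||WE|<-] := maxW _ sWy; first exact: addvSl.
- by rewrite subv_add WU -memvE.
- by case/negP: nWi; rewrite -WE (subvP (addvSr _ _)) // memv_line.
apply: leq_trans (dimv_add_leqif _ _) _.
by rewrite -addn1 leq_add2l dim_vline leq_b1.
Qed.

Lemma has_length_dim l : has_length M l -> (\dim {:M} <= l)%N.
Proof.
move=> [s [s0 hs ls maxs] szs].
have st i : (i < size s)%N -> stable (nth 0%VS s i).
  move=> lt; have [lt'|] := ltnP i.+1 (size s); first by case: (maxs _ lt').
  move=> ge; have -> : i = (size s).-1.
    by apply/eqP; rewrite eqn_leq; rewrite -ltnS prednK // lt -ltnS prednK.
  by rewrite nth_last ls => x a _; rewrite memvf.
have le i : (i < size s)%N -> (\dim (nth 0%VS s i) <= i)%N.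
  elim: i => [|i IH] lt; first by rewrite nth0 hs dimv0.
  apply: leq_trans (maximal_submodule_dim (st _ lt) (maxs _ lt)) _.
  by rewrite ltnS IH // ltnW.
have <- : nth 0%VS s l = fullv by rewrite -[l in LHS]/(l.+1.-1) -szs nth_last.
by apply: le; rewrite szs.
Qed.

End Modules.
End SplitAlgebra.

(** * Uniserial modules and the dimension bound *)

Section Uniserial.
Variables (K : fieldType) (A : falgType K).

(** A stable subspace of least dimension among those strictly above X and inside Y gives a maximal
    step; the rest is induction on the codimension. *)
Lemma maximal_chain (M : rmodule A) (X Y : {vspace M}) : stable X -> stable Y -> (X <= Y)%VS ->
  exists2 t, path (fun W U => `[< maximal_submodule W U >]) X t & last X t = Y.
Proof.
move: {2}(\dim Y - \dim X)%N (leqnn (\dim Y - \dim X)) => d.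
elim: d X => [|d IH] X led sX sY XY.
  exists [::] => //=; apply/eqP; rewrite eqEdim XY /=.
  by move: led; rewrite leqn0 subn_eq0.
have [->|nXY] := eqVneq X Y; first by exists [::].
pose good (Z : {vspace M}) := [/\ stable Z, (X <= Z)%VS, (Z <= Y)%VS & X <> Z].
pose p k := `[< exists2 Z, good Z & \dim Z = k >].
have p0 : exists k, p k.
  by exists (\dim Y); apply/asboolP; exists Y => //; split=> //; apply/eqP.
case: (ex_minnP p0) => k /asboolP[Z [sZ XZ ZY nXZ] <-] minZ.
have ltXZ : (\dim X < \dim Z)%N.
  rewrite ltn_neqAle dimvS // andbT; apply/negP => E; case: nXZ.
  by apply/eqP; rewrite eqEdim XZ (eqP E) leqnn.
have [|//|//|//|t pt lt] := IH Z.
  rewrite -ltnS; apply: leq_trans led; apply: ltn_sub2l => //.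
  by apply: leq_trans ltXZ (dimvS ZY).
exists (Z :: t) => //=; rewrite pt andbT; apply/asboolP; split=> // V sV XV VZ.
have [->|/eqP nXV] := eqVneq X V; [by left|right; apply/eqP].
by rewrite eqEdim VZ minZ //; apply/asboolP; exists V => //; split=> //; apply: subv_trans ZY.
Qed.

(** Refine 0 <= X <= M and 0 <= Y <= M to composition series. By uniqueness X and Y are members of
    one and the same chain. *)
Lemma uniserial_comparable (M : rmodule A) (X Y : {vspace M}) :
  uniserial M -> stable X -> stable Y -> (X <= Y)%VS \/ (Y <= X)%VS.
Proof.
move=> [s [_ us]] sX sY.
have s0 : stable (0%VS : {vspace M}).
  by move=> x a; rewrite !memv0 => /eqP->; rewrite ract0l.
have sF : stable (fullv : {vspace M}) by move=> x a _; rewrite memvf.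
pose R (W U : {vspace M}) := `[< maximal_submodule W U >].
have series Z : stable Z -> exists t, [/\ s = 0%VS :: t, path R 0%VS t & Z \in 0%VS :: t].
  move=> sZ; have [t1 p1 l1] := maximal_chain s0 sZ (sub0v _).
  have [t2 p2 l2] := maximal_chain sZ sF (subvf _).
  exists (t1 ++ t2); have pp : path R 0%VS (t1 ++ t2) by rewrite cat_path p1 l1.
  split=> //; last by rewrite -cat_cons mem_cat -l1 mem_last.
  apply: us; split=> //=; first by rewrite last_cat l1.
  by move=> i; rewrite ltnS => lt; have /pathP/(_ i lt)/asboolP := pp.
have [t [sE pt Xt]] := series X sX.
have [t' [sE' _ Yt']] := series Y sY.
have Yt : Y \in 0%VS :: t by move: Yt'; have [->] : 0%VS :: t = 0%VS :: t' by rewrite -sE.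
have pS : path (fun W U : {vspace M} => (W <= U)%VS) 0%VS t.
  by apply: sub_path pt => W U /asboolP[].
have tr : transitive (fun W U : {vspace M} => (W <= U)%VS).
  by move=> V W U; apply: subv_trans.
have [iX ltX <-] := nthP 0%VS Xt.
have [iY ltY <-] := nthP 0%VS Yt.
have mono i j : (i <= j)%N -> (j < size (0%VS :: t))%N ->
    (nth 0%VS (0%VS :: t) i <= nth 0%VS (0%VS :: t) j)%VS.
  move=> ij jt; apply: (sorted_leq_nth tr (@subvv _ _)) => //; rewrite inE //.
  exact: leq_ltn_trans jt.
by case/orP: (leq_total iX iY) => le; [left|right]; apply: mono.
Qed.

Lemma uniserial_quot_comparable (M : rmodule A) (U : submodule M) (X Y : {vspace M}) :
  uniserial (quot_module U) -> stable X -> stable Y -> (U <= X)%VS -> (U <= Y)%VS ->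
  (X <= Y)%VS \/ (Y <= X)%VS.
Proof.
move=> uU sX sY UX UY.
pose im (Z : {vspace M}) : {vspace quot_module U} := (linfun (@quot_proj K A M U) @: Z)%VS.
have sim Z : stable Z -> stable (im Z).
  move=> sZ y a /memv_imgP[z Zz ->]; rewrite lfunE /= -quot_proj_act.
  by apply/memv_imgP; exists (ract z a); rewrite ?lfunE //; apply: sZ.
have back Z Z' : (U <= Z')%VS -> (im Z <= im Z')%VS -> (Z <= Z')%VS.
  move=> UZ' /subvP le; apply/subvP => z Zz.
  have /memv_imgP[z' Zz'] : linfun (@quot_proj K A M U) z \in im Z'.
    by apply: le; apply: memv_img.
  rewrite !lfunE /= => /eqP; rewrite -subr_eq0 -linearB quot_proj_ker => Uzz'.
  by rewrite -[z](subrK z') memvD // (subvP UZ').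
by have [/back|/back] := uniserial_comparable uU (sim _ sX) (sim _ sY); [left|right]; auto.
Qed.

Lemma radn_sub (M : rmodule A) k l : (k <= l)%N -> (radn M l <= radn M k)%VS.
Proof.
move/subnK <-; elim: (l - k)%N => [|d IH]; first exact: subvv.
apply: subv_trans IH; rewrite addSn /=; apply/subvP => x /rad_spaceP[].
by [].
Qed.

(* X and Y show that M / rad^k M is not uniserial, so that in a decomposition
   of the length as l = (l - i) + i only l - i < k is possible. *)
Lemma nakayama3_dim (D : split_data A) (M : rmodule A) k (X Y : {vspace M}) :
  right_nakayama A 3 -> indecomposable M -> (0 < k)%N ->
  stable X -> stable Y -> ~~ (X <= Y)%VS -> ~~ (Y <= X)%VS ->
  (radn M k <= X)%VS -> (radn M k <= Y)%VS -> (\dim {:M} <= k + 2)%N.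
Proof.
move=> [_ nak _] indM k0 sX sY nXY nYX kX kY.
have nu : ~ uniserial M.
  by move/uniserial_comparable => /(_ X Y sX sY)[]; apply/negP.
have [[|[|i]] // i3] := nak M indM.
case=> _ [l [hl il ul _]].
apply: leq_trans (has_length_dim D hl) _.
have [kl|lk] := leqP k (l - i.+2).
  have rX := subv_trans (radn_sub M kl) kX.
  have rY := subv_trans (radn_sub M kl) kY.
  by have [] := uniserial_quot_comparable ul sX sY rX rY;
    [rewrite (negbTE nXY)|rewrite (negbTE nYX)].
have {}i3 : (i <= 1)%N by case/andP: i3.
move: lk; rewrite ltn_subLR // => lk; rewrite -ltnS; apply: leq_trans lk _.
by rewrite addnC -addnS leq_add2l ltnS ltnS.
Qed.

End Uniserial.

Section MoreModules.
Variables (K : fieldType) (A : falgType K).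

HB.instance Definition _ (M : rmodule A) (x : M) :=
  GRing.isLinear.Build K A M *:%R (ract x) (ract_linear_r x).

Lemma dimv_add_line (V : vectType K) (W : {vspace V}) x :
  x \notin W -> \dim (W + <[x]>)%VS = (\dim W).+1.
Proof.
move=> Wx; have x0 : x != 0 by apply: contraNneq Wx => ->; rewrite mem0v.
rewrite dimv_disjoint_sum ?dim_vline ?x0 ?addn1 //.
apply/eqP; rewrite -subv0; apply/subvP => y; rewrite memv_cap => /andP[Wy /vlineP[c yE]].
have [c0|c0] := eqVneq c 0; first by rewrite yE c0 scale0r mem0v.
by case/negP: Wx; rewrite -[x]scale1r -(mulVf c0) -scalerA -yE memvZ.
Qed.

Definition pair_act (x : (A * A)%type) (a : A) : (A * A)%type := (x.1 * a, x.2 * a).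

Lemma pair_act_linear_l a : linear (pair_act^~ a).
Proof.
by move=> c [x x'] [y y']; rewrite /pair_act /= !mulrDl -!scalerAl.
Qed.

Lemma pair_act_linear_r x : linear (pair_act x).
Proof.
by move=> c a b; rewrite /pair_act /= !mulrDr -!scalerAr.
Qed.

Lemma pair_act1 x : pair_act x 1 = x.
Proof. by case: x => x y; rewrite /pair_act !mulr1. Qed.

Lemma pair_actM x a b : pair_act x (a * b) = pair_act (pair_act x a) b.
Proof. by rewrite /pair_act /= !mulrA. Qed.

Definition pair_module : rmodule A :=
  RModule pair_act_linear_l pair_act_linear_r pair_act1 pair_actM.

Lemma quot_dim (M : rmodule A) (U : submodule M) :
  (\dim {:quot_module U} + \dim U = \dim {:M})%N.
Proof.
rewrite (_ : \dim {:quot_module U} = \dim (U^C)%VS).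
  by rewrite dimv_compl subnK // dimvS // subvf.
by rewrite dimvf /dim /=.
Qed.

End MoreModules.

(** * Gluing two local modules along simple submodules *)

Section TwoGenerators.
Variables (K : fieldType) (A : falgType K) (D : split_data A).
Local Notation e := (@idem _ _ D).
Local Notation chi := (@chi _ _ D).
Local Notation J := (jac D).

Lemma jac_inv y : y \in J -> exists z, (1 - y) * z = 1.
Proof.
move=> Jy; exists (\sum_(i < nilindex D) y ^+ i).
have yk k : y ^+ k \in radp D k.
  by elim: k => [|k IH]; [rewrite memvf|rewrite exprSr mem_radpS].
rewrite -[1 - y]opprB mulNr -subrX1.
by have := yk (nilindex D); rewrite radp_nil memv0 => /eqP ->; rewrite sub0r opprK.
Qed.

Lemma corner_jac u (a : A) : chi u a = 0 -> e u * a * e u \in J.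
Proof.
move=> a0; apply/jacP => k; rewrite !rmorphM /= !chi_idem.
by case: eqP => [->|_]; rewrite ?a0 ?mulr0 ?mul0r.
Qed.

Lemma corner_split u (a : A) : exists2 j, j \in J & e u * a * e u = chi u a *: e u + j.
Proof.
exists (e u * (a - chi u a *: 1) * e u).
  by apply: corner_jac; rewrite linearB linearZ /= rmorph1 mulr1 subrr.
rewrite mulrBr mulrBl -scalerAr mulr1 -scalerAl idem_diag.
by rewrite addrC subrK.
Qed.

Lemma corner_inv u (a : A) : chi u a != 0 -> exists z, e u * a * e u * z = e u.
Proof.
move=> a0; have [j Jj aE] := corner_split u a.
have [z zE] : exists z, (1 - (- ((chi u a)^-1 *: j))) * z = 1.
  by apply: jac_inv; rewrite memvN memvZ.
exists ((chi u a)^-1 *: (z * e u)).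
have ej : e u * j = j.
  have -> : j = e u * a * e u - chi u a *: e u by rewrite aE addrC addKr.
  by rewrite mulrBr !mulrA idem_diag -scalerAr idem_diag.
rewrite aE -scalerAr scalerAl scalerDr scalerA mulVf // scale1r.
have -> : e u + (chi u a)^-1 *: j = e u * (1 - (- ((chi u a)^-1 *: j))).
  by rewrite opprK mulrDr mulr1 -scalerAr ej.
by rewrite !mulrA -[_ * _ * z]mulrA zE mulr1 idem_diag.
Qed.

Variables (M : rmodule A) (u u' : 'I_(nvert D)) (p q : M) (l1 l2 : M -> K).
(* l1 and l2 are the coordinates on the top of M. *)
Hypothesis l1D : {morph l1 : x y / x + y}.
Hypothesis l2D : {morph l2 : x y / x + y}.
Hypothesis l1a : forall y a, l1 (ract y a) = l1 y * chi u a.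
Hypothesis l2a : forall y a, l2 (ract y a) = l2 y * chi u' a.
Hypothesis (l1p : l1 p = 1) (l1q : l1 q = 0) (l2p : l2 p = 0) (l2q : l2 q = 1).
Hypothesis pe : ract p (e u) = p.
Hypothesis qe : ract q (e u') = q.
Hypothesis gen : forall y, exists a b, y = ract p a + ract q b.

Lemma two_gen y : exists a b,
  [/\ y = ract p a + ract q b, e u * a = a, e u' * b = b, l1 y = chi u a & l2 y = chi u' b].
Proof.
have [a [b yE]] := gen y; exists (e u * a), (e u' * b).
rewrite !ractM pe qe !mulrA !idem_diag; split=> //.
  by rewrite yE l1D !l1a l1p l1q mul1r mul0r addr0 rmorphM /= chi_idem eqxx mul1r.
by rewrite yE l2D !l2a l2p l2q mul1r mul0r add0r rmorphM /= chi_idem eqxx mul1r.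
Qed.

Lemma left_corner_jac v a : e v * a = a -> chi v a = 0 -> a \in J.
Proof.
move=> <-; rewrite rmorphM /= chi_idem eqxx mul1r => a0; apply/jacP => k.
rewrite rmorphM /= chi_idem; case: (eqVneq k v) => [->|_]; last by rewrite mul0r.
by rewrite a0 mulr0.
Qed.

Section Decomposition.
Variables (U W : {vspace M}) (p1 p2 q1 q2 : M).
Hypotheses (sU : stable U) (sW : stable W) (UW0 : (U :&: W = 0)%VS).
Hypotheses (Up : p1 \in U) (Uq : q1 \in U) (Wp : p2 \in W) (Wq : q2 \in W).
Hypotheses (pE : p = p1 + p2) (qE : q = q1 + q2).

Lemma direct_eq y y' z z' : y \in U -> y' \in U -> z \in W -> z' \in W ->
  y + z = y' + z' -> y = y' /\ z = z'.
Proof.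
move=> Uy Uy' Wz Wz' E.
have d : y - y' = z' - z.
  by apply/eqP; rewrite subr_eq addrC addrA eq_sym subr_eq addrC [z' + _]addrC E.
have : y - y' \in (U :&: W)%VS by rewrite memv_cap memvB //= d memvB.
rewrite UW0 memv0 => /eqP d0; split; apply/eqP; first by rewrite -subr_eq0 d0.
by rewrite eq_sym -subr_eq0 -d d0.
Qed.

Lemma comp_eq y z a b : y \in U -> z \in W -> y + z = ract p a + ract q b ->
  y = ract p1 a + ract q1 b /\ z = ract p2 a + ract q2 b.
Proof.
move=> Uy Wz E; apply: direct_eq => //; first by rewrite memvD ?sU.
  by rewrite memvD ?sW.
by rewrite E pE qE !ractDl addrACA.
Qed.

Lemma comp_split_eq a b : ract p a = ract q b ->
  ract p1 a = ract q1 b /\ ract p2 a = ract q2 b.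
Proof.
move=> E; apply: direct_eq; rewrite ?sU ?sW //.
by rewrite -!ractDl -pE -qE.
Qed.

Lemma compU y : y \in U -> exists a b,
  [/\ y = ract p1 a + ract q1 b, 0 = ract p2 a + ract q2 b, e u * a = a, e u' * b = b &
     l1 y = chi u a /\ l2 y = chi u' b].
Proof.
move=> Uy; have [a [b [yE ea eb ca cb]]] := two_gen y.
have [] := @comp_eq y 0 a b Uy (mem0v _); first by rewrite addr0.
by exists a, b.
Qed.

Lemma compW y : y \in W -> exists a b,
  [/\ y = ract p2 a + ract q2 b, 0 = ract p1 a + ract q1 b, e u * a = a, e u' * b = b &
     l1 y = chi u a /\ l2 y = chi u' b].
Proof.
move=> Wy; have [a [b [yE ea eb ca cb]]] := two_gen y.
have [] := @comp_eq 0 y a b (mem0v _) Wy; first by rewrite add0r.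
by exists a, b.
Qed.

Lemma comp_idem : ract p1 (e u) = p1 /\ ract p2 (e u) = p2.
Proof.
have [] := @comp_eq (ract p1 (e u)) (ract p2 (e u)) 1 0; rewrite ?sU ?sW //.
  by rewrite ract1 ract0r addr0 -ractDl -pE pe.
by rewrite !ract1 !ract0r !addr0.
Qed.

Lemma comp_idem' : ract q1 (e u') = q1 /\ ract q2 (e u') = q2.
Proof.
have [] := @comp_eq (ract q1 (e u')) (ract q2 (e u')) 0 1; rewrite ?sU ?sW //.
  by rewrite ract1 ract0r add0r -ractDl -qE qe.
by rewrite !ract1 !ract0r !add0r.
Qed.

(** Zero coordinates force the coefficients that express p2 and q2 through themselves into J. As 1
    minus an element of J is invertible, q2 can be eliminated, and then p2 vanishes. *)
Lemma top_zero : l1 p2 = 0 -> l2 p2 = 0 -> l1 q2 = 0 -> l2 q2 = 0 -> W = 0%VS.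
Proof.
move=> z1 z2 z3 z4.
have [a [b [p2E _ ea eb [ca cb]]]] := compW Wp.
have [c [d [q2E _ ec ed [cc cd]]]] := compW Wq.
have Ja : a \in J by apply: left_corner_jac ea _; rewrite -ca.
have Jb : b \in J by apply: left_corner_jac eb _; rewrite -cb.
have Jc : c \in J by apply: left_corner_jac ec _; rewrite -cc.
have Jd : d \in J by apply: left_corner_jac ed _; rewrite -cd.
have [z dz] := jac_inv Jd.
have q2E' : q2 = ract p2 (c * z).
  rewrite ractM -[q2]ract1 -dz ractM; congr ract.
  by rewrite ractBr ract1 {1}q2E addrK.
have p20 : p2 = 0.
  have E : p2 = ract p2 (a + c * z * b).
    by rewrite ractDr ractM -q2E' -p2E.
  have [z' dz'] : exists z', (1 - (a + c * z * b)) * z' = 1.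
    by apply: jac_inv; rewrite memvD // jac_mulr // jac_mulr.
  by rewrite -[p2]ract1 -dz' ractM ractBr ract1 -E subrr ract0l.
have q20 : q2 = 0 by rewrite q2E' p20 ract0l.
apply/eqP; rewrite -subv0; apply/subvP => y Wy.
have [a' [b' [-> _ _ _ _]]] := compW Wy.
by rewrite p20 q20 !ract0l addr0 mem0v.
Qed.

(** For u = u' the projection to W acts on the top by an idempotent 2 x 2 matrix. An off-diagonal
    entry of its square is that entry times the trace, so it vanishes with the diagonal. For
    distinct u and u' these entries vanish because of the vertices. *)
Lemma off_diag : l1 p2 = 0 -> l2 q2 = 0 -> l2 p2 = 0 /\ l1 q2 = 0.
Proof.
move=> z1 z4.
have [pe1 pe2] := comp_idem; have [qe1 qe2] := comp_idem'.
have [uu'|nuu'] := eqVneq u u'; last first.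
  split; first by rewrite -pe2 l2a chi_idem eq_sym (negbTE nuu') mulr0.
  by rewrite -qe2 l1a chi_idem (negbTE nuu') mulr0.
have [a [b [p2E _ ea eb [ca cb]]]] := compW Wp.
have [c [d [q2E _ ec ed [cc cd]]]] := compW Wq.
split.
  by rewrite p2E l2D !l2a z4 mul0r addr0 -uu' -ca z1 mulr0.
by rewrite q2E l1D !l1a z1 mul0r add0r uu' -cd z4 mulr0.
Qed.

End Decomposition.

(** A coefficient with nonzero character is invertible in its corner, so the relations between the
    components can be solved. The first alternative follows if l2 q1 is not 1 and l1 p1 is not 0,
    the second if l1 p1 is not 1 and l2 q1 is not 0. What remains is (0, 0) or (1, 1) for the pair
    of l1 p1 and l2 q1; there U or W has zero top and vanishes. *)
Lemma decomposition_generators (U W : {vspace M}) (p1 p2 q1 q2 : M) :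
  stable U -> stable W -> (U :&: W = 0)%VS -> U != 0%VS -> W != 0%VS ->
  p1 \in U -> q1 \in U -> p2 \in W -> q2 \in W -> p = p1 + p2 -> q = q1 + q2 ->
  (exists m m', q1 = ract p1 m /\ p2 = ract q2 m') \/
  (exists m m', p1 = ract q1 m /\ q2 = ract p2 m').
Proof.
move=> sU sW UW0 U0 W0 Up Uq Wp Wq pE qE.
have WU0 : (W :&: U = 0)%VS by rewrite capvC.
have [pe1 pe2] := comp_idem sU sW UW0 Up Uq Wp Wq pE qE.
have [qe1 qe2] := comp_idem' sU sW UW0 Up Uq Wp Wq pE qE.
have pE' : p = p2 + p1 by rewrite addrC.
have qE' : q = q2 + q1 by rewrite addrC.
have [a [b [p1E zp1 ea eb [ca cb]]]] := compU sU sW UW0 Up Uq Wp Wq pE qE Up.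
have [c [d [q1E zq1 ec ed [cc cd]]]] := compU sU sW UW0 Up Uq Wp Wq pE qE Uq.
have solve (x x' : M) v f g : ract x (e v) = x ->
    ract x f = ract x' g -> chi v f != 0 -> exists m, x = ract x' m.
  move=> xv E f0; have [z fz] := corner_inv f0.
  by exists (g * (e v * z)); rewrite -[LHS]xv -[in LHS]fz !ractM xv E.
have l11 : l1 p1 + l1 p2 = 1 by rewrite -l1D -pE.
have l22 : l2 q1 + l2 q2 = 1 by rewrite -l2D -qE.
have solA : l2 q1 != 1 -> l1 p1 != 0 ->
    exists m m', q1 = ract p1 m /\ p2 = ract q2 m'.
  move=> h1 h2.
  have [||m mE] := solve q1 p1 u' (1 - d) c qe1.
  - by rewrite ractBr ract1 {1}q1E addrK.
  - by rewrite linearB rmorph1 /= -cd subr_eq0 eq_sym.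
  have [||m' m'E] := solve p2 q2 u a (- b) pe2.
  - by apply/eqP; rewrite raddfN -addr_eq0 -zp1.
  - by rewrite -ca.
  by exists m, m'.
have solB : l1 p1 != 1 -> l2 q1 != 0 ->
    exists m m', p1 = ract q1 m /\ q2 = ract p2 m'.
  move=> h1 h2.
  have [||m mE] := solve p1 q1 u (1 - a) b pe1.
  - by rewrite ractBr ract1 {1}p1E addrC addKr.
  - by rewrite linearB rmorph1 /= -ca subr_eq0 eq_sym.
  have [||m' m'E] := solve q2 p2 u' d (- c) qe2.
  - by apply/eqP; rewrite raddfN -addr_eq0 addrC -zq1.
  - by rewrite -cd.
  by exists m, m'.
have [E1|N1] := eqVneq (l2 q1) 1; last first.
  have [E2|N2] := eqVneq (l1 p1) 0; last by left; apply: solA.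
  have [E3|N3] := eqVneq (l2 q1) 0; last first.
    by right; apply: solB => //; rewrite E2 eq_sym oner_eq0.
  have [E4 E5] := off_diag sW sU WU0 Wp Wq Up Uq pE' qE' E2 E3.
  by rewrite (top_zero sW sU WU0 Wp Wq Up Uq pE' qE' E2 E4 E5 E3) eqxx in U0.
have [E2|N2] := eqVneq (l1 p1) 1; last first.
  by right; apply: solB => //; rewrite E1 oner_eq0.
have z1 : l1 p2 = 0 by apply: (@addrI _ 1); rewrite addr0 -[RHS]l11 E2.
have z4 : l2 q2 = 0 by apply: (@addrI _ 1); rewrite addr0 -[RHS]l22 E1.
have [E4 E5] := off_diag sU sW UW0 Up Uq Wp Wq pE qE z1 z4.
by rewrite (top_zero sU sW UW0 Up Uq Wp Wq pE qE z1 E4 E5 z4) eqxx in W0.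
Qed.

End TwoGenerators.

Section Gluing.
Variables (K : fieldType) (A : falgType K) (D : split_data A).
Local Notation e := (@idem _ _ D).
Local Notation chi := (@chi _ _ D).
Local Notation J := (jac D).

(* A / X is a local module whose top is the simple module at the vertex u. *)
Definition local_ideal u (X : {vspace A}) :=
  [/\ forall x a, x \in X -> x * a \in X, 1 - e u \in X & forall x, x \in X -> chi u x = 0].

(* The class of s spans a simple submodule of A / X at the vertex w. *)
Definition socle_elt w (X : {vspace A}) (s : A) :=
  [/\ s \notin X, s - s * e w \in X & forall j, j \in J -> s * j \in X].

Lemma socle_mul w0 (Z : {vspace A}) t a : (forall x a, x \in Z -> x * a \in Z) ->
  socle_elt w0 Z t -> t * a - chi w0 a *: t \in Z.
Proof.
move=> sZ [_ tw tJ].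
pose b := a - chi w0 a *: 1.
have b0 : chi w0 b = 0 by rewrite linearB linearZ /= rmorph1 mulr1 subrr.
have -> : t * a - chi w0 a *: t = t * b.
  by rewrite mulrBr -scalerAr mulr1.
have -> : t * b = (t - t * e w0) * b + t * (e w0 * b).
  by rewrite mulrBl mulrA subrK.
apply: memvD; first exact: sZ.
apply: tJ; apply: (@left_corner_jac _ _ D w0).
  by rewrite mulrA idem_diag.
by rewrite rmorphM /= b0 mulr0.
Qed.

Variables (u u' w : 'I_(nvert D)) (X X' : {vspace A}) (s s' : A).
Hypotheses (lX : local_ideal u X) (lX' : local_ideal u' X').
Hypotheses (sX : socle_elt w X s) (sX' : socle_elt w X' s').
Hypotheses (us : chi u s = 0) (us' : chi u' s' = 0).

Let glue_pred (z : (A * A)%type) := exists c, z.1 - c *: s \in X /\ z.2 + c *: s' \in X'.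

(* The kernel of the map from A + A onto the module in which s is identified
   with s'. *)
Lemma glue_space : {Y : {vspace (A * A)%type} | forall z, z \in Y <-> glue_pred z}.
Proof.
apply: subspace_of_pred => [|c x y [a [Xa Xa']] [b [Xb Xb']]].
  by exists 0; rewrite !scale0r subrr addr0 !mem0v.
exists (c * a + b); split => /=.
  have -> : c *: x.1 + y.1 - (c * a + b) *: s = c *: (x.1 - a *: s) + (y.1 - b *: s).
    by rewrite scalerBr scalerA scalerDl opprD addrACA.
  by rewrite memvD ?memvZ.
have -> : c *: x.2 + y.2 + (c * a + b) *: s' = c *: (x.2 + a *: s') + (y.2 + b *: s').
  by rewrite scalerDr scalerA scalerDl addrACA.
by rewrite memvD ?memvZ.
Qed.

Let Y := sval glue_space.
Let YP z : z \in Y <-> glue_pred z. Proof. exact: (svalP glue_space). Qed.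

Lemma glue_stable : @stable _ _ (pair_module A) Y.
Proof.
case: (lX) => rX _ _; case: (lX') => rX' _ _.
move=> z a /YP[c [Xz Xz']]; apply/YP; exists (c * chi w a); split=> /=.
  have -> : z.1 * a - (c * chi w a) *: s = (z.1 - c *: s) * a + c *: (s * a - chi w a *: s).
    by rewrite mulrBl scalerBr scalerA -scalerAl addrA subrK.
  by rewrite memvD ?rX // memvZ // socle_mul.
have -> : z.2 * a + (c * chi w a) *: s' = (z.2 + c *: s') * a - c *: (s' * a - chi w a *: s').
  by rewrite mulrDl scalerBr scalerA -scalerAl opprB addrACA subrr addr0.
by rewrite memvB ?rX' // memvZ // socle_mul.
Qed.

Definition glued : rmodule A := quot_module (Submodule glue_stable).

Let pi (z : (A * A)%type) : glued := quot_proj (Submodule glue_stable) z.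

Let piD x y : pi (x + y) = pi x + pi y. Proof. exact: raddfD. Qed.
Let pia z a : pi (pair_act z a) = ract (pi z) a.
Proof. exact: (quot_proj_act (Submodule glue_stable)). Qed.
Let pi0 z : pi z = 0 <-> glue_pred z.
Proof. by rewrite -YP -[_ \in Y](quot_proj_ker (Submodule glue_stable)); split=> /eqP. Qed.
Let piS y : exists z, pi z = y. Proof. exact: (quot_proj_surj (U := Submodule glue_stable) y). Qed.

Let l1 (y : glued) : K := chi u (vsval y : (A * A)%type).1.
Let l2 (y : glued) : K := chi u' (vsval y : (A * A)%type).2.

Let piB z : vsval (pi z) - z \in Y.
Proof.
have := quot_projB (Submodule glue_stable) z; rewrite -memvN opprB.
by [].
Qed.

(** The choice of representative is immaterial because s and all elements of X have character 0 at
    u. *)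
Let l1E z : l1 (pi z) = chi u z.1.
Proof.
have /YP[c [Xz _]] := piB z; case: lX => _ _ /(_ _ Xz).
by rewrite /= !raddfB /= linearZ /= us mulr0 subr0 => /eqP; rewrite subr_eq0 => /eqP.
Qed.

Let l2E z : l2 (pi z) = chi u' z.2.
Proof.
have /YP[c [_ Xz]] := piB z; case: lX' => _ _ /(_ _ Xz).
by rewrite /= raddfD raddfB /= linearZ /= us' mulr0 addr0 => /eqP; rewrite subr_eq0 => /eqP.
Qed.

Let l1D : {morph l1 : x y / x + y}.
Proof. by move=> x y; rewrite /l1 /= raddfD. Qed.
Let l2D : {morph l2 : x y / x + y}.
Proof. by move=> x y; rewrite /l2 /= raddfD. Qed.
Let l1Z c x : l1 (c *: x) = c * l1 x.
Proof. by rewrite /l1 /= linearZ. Qed.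
Let l2Z c x : l2 (c *: x) = c * l2 x.
Proof. by rewrite /l2 /= linearZ. Qed.

Let l1a y a : l1 (ract y a) = l1 y * chi u a.
Proof. by have [z <-] := piS y; rewrite -pia !l1E /= rmorphM. Qed.
Let l2a y a : l2 (ract y a) = l2 y * chi u' a.
Proof. by have [z <-] := piS y; rewrite -pia !l2E /= rmorphM. Qed.

Let p := pi (1, 0).
Let q := pi (0, 1).

Let pqE a b : pi (a, b) = ract p a + ract q b.
Proof.
rewrite -!pia -piD /pair_act /= !mul1r !mul0r; congr pi.
by congr pair; rewrite /= ?addr0 ?add0r.
Qed.

Let gen y : exists a b, y = ract p a + ract q b.
Proof. by have [[a b] <-] := piS y; exists a, b. Qed.

Let pe : ract p (e u) = p.
Proof.
apply/eqP; rewrite eq_sym -subr_eq0 -{1}[p]ract1 -ractBr; apply/eqP.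
have := pqE (1 - e u) 0; rewrite ract0r addr0 => <-; apply/pi0.
by exists 0; case: lX => _ Xu _; rewrite /= !scale0r subr0 addr0 mem0v.
Qed.

Let qe : ract q (e u') = q.
Proof.
apply/eqP; rewrite eq_sym -subr_eq0 -{1}[q]ract1 -ractBr; apply/eqP.
have := pqE 0 (1 - e u'); rewrite ract0r add0r => <-; apply/pi0.
by exists 0; case: lX' => _ Xu _; rewrite /= !scale0r subr0 addr0 mem0v.
Qed.

Lemma inl_linear : linear (fun a : A => (a, 0 : A)).
Proof. by move=> c a b; congr pair; rewrite /= scaler0 addr0. Qed.
Lemma inr_linear : linear (fun a : A => (0 : A, a)).
Proof. by move=> c a b; congr pair; rewrite /= scaler0 addr0. Qed.

Let dim_img (V W : vectType K) (f : 'Hom(V, W)) (U : {vspace V}) : (\dim (f @: U) <= \dim U)%N.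
Proof. by rewrite -(limg_ker_dim f U) leq_addl. Qed.

Let dim_glue : (\dim Y <= \dim X + \dim X' + 1)%N.
Proof.
pose f1 : {linear A -> (A * A)%type} := HB.pack (fun a : A => (a, 0 : A))
  (GRing.isLinear.Build K A (A * A)%type *:%R _ inl_linear).
pose f2 : {linear A -> (A * A)%type} := HB.pack (fun a : A => (0 : A, a))
  (GRing.isLinear.Build K A (A * A)%type *:%R _ inr_linear).
have le : (Y <= linfun f1 @: X + linfun f2 @: X' + <[(s, - s') : (A * A)%type]>)%VS.
  apply/subvP => z /YP[c [Xz Xz']].
  have -> : z = linfun f1 (z.1 - c *: s) + linfun f2 (z.2 + c *: s') +
      c *: ((s, - s') : (A * A)%type).
    rewrite !lfunE /=; case: z {Xz Xz'} => x y /=.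
    by congr pair => /=; rewrite ?addr0 ?add0r ?scalerN ?subrK ?addrK.
  by rewrite !memv_add ?memv_img // memvZ // memv_line.
apply: leq_trans (dimvS le) _; apply: leq_trans (dimv_add_leqif _ _) _.
apply: leq_add; last by rewrite dim_vline leq_b1.
apply: leq_trans (dimv_add_leqif _ _) _.
by apply: leq_add; apply: dim_img.
Qed.

Let dim_glued : (2 * \dim {:A} <= \dim {:glued} + \dim X + \dim X' + 1)%N.
Proof.
have dd : \dim {:(A * A)%type} = (2 * \dim {:A})%N by rewrite !dimvf /dim /= mul2n addnn.
have := quot_dim (Submodule glue_stable); rewrite /= -/glued => E.
have -> : (2 * \dim {:A})%N = (\dim {:glued} + \dim Y)%N by rewrite -dd -E.
by rewrite -!addnA leq_add2l !addnA.
Qed.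

(** Modulo X the elements 1, s and t are independent, so A / X has dimension at least 3 and A / X'
    at least 2; the glued module then has dimension at least 3 + 2 - 1 = 4. *)
Variable t : A.
Hypotheses (ut : chi u t = 0) (ts : forall c, t - c *: s \notin X).

Let dimX : (\dim X + 3 <= \dim {:A})%N.
Proof.
case: (sX) => nXs _ _; case: lX => _ _ X0.
have d1 := dimv_add_line nXs.
have nt : t \notin (X + <[s]>)%VS.
  apply/negP => /memv_addP[x Xx [_ /vlineP[c ->] tE]].
  by have := ts c; rewrite tE addrK Xx.
have d2 := dimv_add_line nt.
have n1 : 1 \notin (X + <[s]> + <[t]>)%VS.
  apply/negP => /memv_addP[y /memv_addP[x Xx [_ /vlineP[c ->] ->]] [_ /vlineP[d ->] E]].
  have := congr1 (chi u) E; rewrite rmorph1 !raddfD /= !linearZ /= us ut X0 // !mulr0 !addr0.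
  by move/eqP; rewrite oner_eq0.
have := dimvS (subvf (X + <[s]> + <[t]> + <[1%R]>)%VS).
by rewrite (dimv_add_line n1) d2 d1; lia.
Qed.

Let dimX' : (\dim X' + 2 <= \dim {:A})%N.
Proof.
case: (sX') => nXs _ _; case: lX' => _ _ X0.
have d1 := dimv_add_line nXs.
have n1 : 1 \notin (X' + <[s']>)%VS.
  apply/negP => /memv_addP[x Xx [_ /vlineP[c ->] E]].
  have := congr1 (chi u') E; rewrite rmorph1 !raddfD /= !linearZ /= us' X0 // !mulr0 !addr0.
  by move/eqP; rewrite oner_eq0.
have := dimvS (subvf (X' + <[s']> + <[1%R]>)%VS).
by rewrite (dimv_add_line n1) d1; lia.
Qed.

Let ker_space (l : glued -> K) : {morph l : x y / x + y} -> (forall c x, l (c *: x) = c * l x) ->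
  {W : {vspace glued} | forall x, x \in W <-> l x = 0}.
Proof.
move=> lD lZ; apply: subspace_of_pred => [|c x y x0 y0].
  by have := lZ 0 0; rewrite scale0r mul0r.
by rewrite lD lZ x0 y0 mulr0 addr0.
Qed.

Let glued_decomposable : right_nakayama A 3 -> ~ indecomposable glued.
Proof.
move=> nak ind.
have [W1 W1P] := ker_space l1D l1Z; have [W2 W2P] := ker_space l2D l2Z.
have l1p : l1 p = 1 by rewrite l1E /= rmorph1.
have l1q : l1 q = 0 by rewrite l1E /= raddf0.
have l2p : l2 p = 0 by rewrite l2E /= raddf0.
have l2q : l2 q = 1 by rewrite l2E /= rmorph1.
have s1 : stable W1 by move=> x a /W1P x0; apply/W1P; rewrite l1a x0 mul0r.
have s2 : stable W2 by move=> x a /W2P x0; apply/W2P; rewrite l2a x0 mul0r.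
have n12 : ~~ (W1 <= W2)%VS.
  apply/negP => /subvP /(_ q)/(_ (proj2 (W1P q) l1q))/W2P; rewrite l2q => /eqP.
  by rewrite oner_eq0.
have n21 : ~~ (W2 <= W1)%VS.
  apply/negP => /subvP /(_ p)/(_ (proj2 (W2P p) l2p))/W1P; rewrite l1p => /eqP.
  by rewrite oner_eq0.
have r1 : (radn glued 1 <= W1)%VS.
  by apply: (rad_space_sub (D := D) s1) => y j _ Jj; apply/W1P; rewrite l1a (jac0 u Jj) mulr0.
have r2 : (radn glued 1 <= W2)%VS.
  by apply: (rad_space_sub (D := D) s2) => y j _ Jj; apply/W2P; rewrite l2a (jac0 u' Jj) mulr0.
have le3 := nakayama3_dim (k := 1) D nak ind isT s1 s2 n12 n21 r1 r2.
by move: dim_glued dimX dimX' le3; lia.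
Qed.

(* The glued module has a two-dimensional top and dimension at least 4, hence it
   decomposes. Comparing dimensions, A / X or A / X' is a direct summand, and
   the projection onto it gives the homomorphism, which is left multiplication by m. *)
Lemma gluing : right_nakayama A 3 ->
  (exists2 m, s - m * s' \in X & forall x, x \in X' -> m * x \in X) \/
  (exists2 m, s' - m * s \in X' & forall x, x \in X -> m * x \in X').
Proof.
move=> nak; have nind := glued_decomposable nak.
have d4 : (fullv : {vspace glued}) <> 0%VS.
  move=> E; have : p \in (fullv : {vspace glued}) by apply: memvf.
  rewrite E memv0 => /eqP p0; have : l1 p = 1 by rewrite l1E /= rmorph1.
  by rewrite p0 -[0](subrr p) -scaleN1r l1D l1Z mulN1r subrr => /eqP; rewrite eq_sym oner_eq0.
have [U [W [UW1 UW0 U0 W0]]] : exists U W : submodule glued,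
    [/\ (U + W)%VS = fullv, (U :&: W)%VS = 0%VS, U != 0%VS :> {vspace glued}
      & W != 0%VS :> {vspace glued}].
  apply: contrapT => nUW; apply: nind; split=> // U W UW1 UW0.
  have [->|U0] := eqVneq (U : {vspace glued}) 0%VS; first by left.
  have [->|W0] := eqVneq (W : {vspace glued}) 0%VS; first by right.
  by case: nUW; exists U, W.
have /memv_addP[p1 Up [p2 Wp pE]] : p \in (U + W)%VS by rewrite UW1 memvf.
have /memv_addP[q1 Uq [q2 Wq qE]] : q \in (U + W)%VS by rewrite UW1 memvf.
have l1p : l1 p = 1 by rewrite l1E /= rmorph1.
have l1q : l1 q = 0 by rewrite l1E /= raddf0.
have l2p : l2 p = 0 by rewrite l2E /= raddf0.
have l2q : l2 q = 1 by rewrite l2E /= rmorph1.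
(* Exchanging U and W turns the second case of [decomposition_generators] into the first. *)
suff main (V V' : submodule glued) (x x' y y' : glued) m m' :
    (V + V')%VS = fullv -> (V :&: V')%VS = 0%VS ->
    x \in (V : {vspace glued}) -> y \in (V : {vspace glued}) ->
    x' \in (V' : {vspace glued}) -> y' \in (V' : {vspace glued}) ->
    p = x + x' -> q = y + y' -> y = ract x m -> x' = ract y' m' ->
  (exists2 m, s - m * s' \in X & forall x, x \in X' -> m * x \in X) \/
  (exists2 m, s' - m * s \in X' & forall x, x \in X -> m * x \in X').
  have sU := @submod_stable _ _ _ U; have sW := @submod_stable _ _ _ W.
  have [[m [m' [E1 E2]]]|[m [m' [E1 E2]]]] :=
    decomposition_generators l1D l2D l1a l2a l1p l1q l2p l2q pe qe gen
      sU sW UW0 U0 W0 Up Uq Wp Wq pE qE.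
    exact: (main U W p1 p2 q1 q2 m m').
  apply: (main W U p2 p1 q2 q1 m' m) => //.
  - by rewrite addvC.
  - by rewrite capvC.
  - by rewrite addrC.
  - by rewrite addrC.
move: V V' x x' y y' => {U W UW1 UW0 U0 W0 p1 Up p2 Wp pE q1 Uq q2 Wq qE}.
move=> U W p1 p2 q1 q2 UW1 UW0 Up Uq Wp Wq pE qE q1E p2E.
have sU := @submod_stable _ _ _ U; have sW := @submod_stable _ _ _ W.
have split_eq a b := @comp_split_eq _ _ _ p q U W p1 p2 q1 q2 sU sW UW0 Up Uq Wp Wq pE qE a b.
pose f1 : 'Hom(A, glued) := linfun (ract p1); pose f2 : 'Hom(A, glued) := linfun (ract q2).
have f1E x : f1 x = ract p1 x by exact: lfunE.
have f2E x : f2 x = ract q2 x by exact: lfunE.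
have pX x : x \in X -> ract p x = 0.
  move=> Xx; have := pqE x 0; rewrite ract0r addr0 => <-; apply/pi0.
  by exists 0; rewrite /= !scale0r subr0 addr0 mem0v.
have qX x : x \in X' -> ract q x = 0.
  move=> Xx; have := pqE 0 x; rewrite ract0r add0r => <-; apply/pi0.
  by exists 0; rewrite /= !scale0r subr0 addr0 mem0v.
have XK : (X <= lker f1)%VS.
  apply/subvP => x Xx; have [|E _] := split_eq x 0; first by rewrite ract0r pX.
  by rewrite memv_ker; apply/eqP; rewrite f1E E ract0r.
have XK' : (X' <= lker f2)%VS.
  apply/subvP => x Xx; have [|_ E] := split_eq 0 x; first by rewrite ract0r qX.
  by rewrite memv_ker; apply/eqP; rewrite f2E -E ract0r.
have Uf : (U <= f1 @: fullv)%VS.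
  apply/subvP => y Uy; have [a [b yE]] := gen y.
  have [] := @comp_eq _ _ _ p q U W p1 p2 q1 q2 sU sW UW0 Up Uq Wp Wq pE qE y 0 a b Uy (mem0v _).
    by rewrite addr0.
  move=> -> _; apply/memv_imgP; exists (a + m * b); first exact: memvf.
  by rewrite f1E ractDr ractM -q1E.
have Wf : (W <= f2 @: fullv)%VS.
  apply/subvP => y Wy; have [a [b yE]] := gen y.
  have [] := @comp_eq _ _ _ p q U W p1 p2 q1 q2 sU sW UW0 Up Uq Wp Wq pE qE 0 y a b (mem0v _) Wy.
    by rewrite add0r.
  move=> _ ->; apply/memv_imgP; exists (m' * a + b); first exact: memvf.
  by rewrite f2E ractDr ractM -p2E.
have dM : (\dim {:glued} <= \dim (f1 @: fullv) + \dim (f2 @: fullv))%N.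
  rewrite -UW1; apply: leq_trans (dimv_add_leqif _ _) _.
  by apply: leq_add; apply: dimvS.
have k1 : (\dim (lker f1) + \dim (f1 @: fullv) = \dim {:A})%N.
  by rewrite -[RHS](limg_ker_dim f1) capfv.
have k2 : (\dim (lker f2) + \dim (f2 @: fullv) = \dim {:A})%N.
  by rewrite -[RHS](limg_ker_dim f2) capfv.
have glue_eq : ract p s = ract q s'.
  apply/eqP; rewrite -subr_eq0 -scaleN1r -ractZr scaleN1r -pqE; apply/eqP/pi0.
  by exists 1; rewrite /= !scale1r subrr addNr !mem0v.
have [E1 E2] := split_eq s s' glue_eq.
(* The kernels of f1 and f2 contain X and X', and the images of f1 and f2 cover U and W. By
   [dim_glued] the two excess dimensions of the kernels add up to at most 1, so one of the
   inclusions is an equality. *)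
have [dX|dX] := leqP (\dim (lker f1)) (\dim X).
  left; have XE : X = lker f1 by apply/eqP; rewrite eqEdim XK dX.
  exists m; first by rewrite XE memv_ker f1E ractBr E1 q1E -ractM subrr.
  move=> x Xx; have [|E _] := split_eq 0 x; first by rewrite ract0r qX.
  by rewrite XE memv_ker f1E ractM -q1E -E ract0r.
right; have XE : X' = lker f2.
  by apply/eqP; rewrite eqEdim XK' andTb; move: dim_glued dM k1 k2 dX; lia.
exists m'; first by rewrite XE memv_ker f2E ractBr -E2 p2E -ractM subrr.
move=> x Xx; have [|_ E] := split_eq x 0; first by rewrite ract0r pX.
by rewrite XE memv_ker f2E ractM -p2E E ract0r.
Qed.

End Gluing.

(** * The arrows of the quiver *)

Section Arrows.
Variables (K : fieldType) (A : falgType K) (D : split_data A).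
Hypothesis nak : right_nakayama A 3.
Local Notation e := (@idem _ _ D).
Local Notation chi := (@chi _ _ D).
Local Notation J := (jac D).
Local Notation R := (radp D).
Local Notation I := 'I_(nvert D).

Definition arrow_like i j (a : A) := [/\ e i * a = a, a * e j = a & a \in J].

Definition is_arrow i j (a : A) := arrow_like i j a /\ a \notin R 2.

(* A chosen arrow from i to j, or 0 when there is none. *)
Definition arr i j : A :=
  if pselect (exists a, is_arrow i j a) is left h then sval (cid h) else 0.

Lemma arr_like i j : arrow_like i j (arr i j).
Proof.
rewrite /arr; case: pselect => [h|_]; first by case: cid => a [].
by split; rewrite ?mulr0 ?mul0r ?mem0v.
Qed.

Lemma e_arr i j : e i * arr i j = arr i j. Proof. by case: (arr_like i j). Qed.
Lemma arr_e i j : arr i j * e j = arr i j. Proof. by case: (arr_like i j). Qed.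
Lemma arr_J i j : arr i j \in J. Proof. by case: (arr_like i j). Qed.

Lemma arr_R2 i j : arr i j != 0 -> arr i j \notin R 2.
Proof.
rewrite /arr; case: pselect => [h _|_]; last by rewrite eqxx.
by case: cid => a [].
Qed.

Lemma arr_zero i j a : arr i j = 0 -> arrow_like i j a -> a \in R 2.
Proof.
rewrite /arr; case: pselect => [h|nh _ al].
  case: cid => b /= [_ bR] b0; by rewrite b0 mem0v in bR.
by apply: contrapT => /negP aR; apply: nh; exists a.
Qed.

Lemma jac_R1 a : (a \in J) = (a \in R 1).
Proof. by rewrite radp1. Qed.

Lemma R2J a : a \in R 2 -> a \in J.
Proof. by move=> aR; rewrite jac_R1; apply: radpW aR. Qed.

Lemma mulJJ a b : a \in J -> b \in J -> a * b \in R 2.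
Proof. by rewrite jac_R1; apply: mem_radpS. Qed.

Lemma power_ideal_space u k : {X : {vspace A} | forall a, a \in X <-> e u * a \in R k}.
Proof.
apply: subspace_of_pred => [|c a b Ra Rb]; first by rewrite mulr0 mem0v.
by rewrite mulrDr -scalerAr memvD ?memvZ.
Qed.

(** This is (1 - e_u) A + J^k, so the quotient of A by it is P_u / P_u J^k. *)
Definition power_ideal u k := sval (power_ideal_space u k).
Lemma power_idealP u k a : a \in power_ideal u k <-> e u * a \in R k.
Proof. exact: (svalP (power_ideal_space u k)). Qed.

Lemma chi_e_mul u a : chi u (e u * a) = chi u a.
Proof. by rewrite rmorphM /= chi_idem eqxx mul1r. Qed.

Lemma power_ideal_local u k : (0 < k)%N -> local_ideal u (power_ideal u k).
Proof.
move=> k0; split=> [x a /power_idealP h| |x /power_idealP h].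
- by apply/power_idealP; rewrite mulrA radp_mulr.
- by apply/power_idealP; rewrite mulrBr mulr1 idem_diag subrr mem0v.
by rewrite -chi_e_mul jac0 // jac_R1; apply: radpW h.
Qed.

(** The ring e_u A e_u is local with residue field K, so an endomorphism of P_u is a scalar up to
    left multiplication by an element of J. *)
Lemma scalar_part u (m : A) : exists2 j, j \in J &
  forall a, e u * a = a -> e u * (m * a) = chi u m *: a + j * a.
Proof.
have [j Jj mE] := corner_split u m; exists j => // a ea.
by rewrite -{1}ea !mulrA mE mulrDl -scalerAl ea.
Qed.

(* Otherwise glue two copies of P_i / J^2 along a and b. *)
Lemma no_parallel i j a b : arrow_like i j a -> arrow_like i j b -> b \notin R 2 ->
  exists c, a - c *: b \in R 2.
Proof.
move=> [ea ae Ja] [eb be Jb] bR; apply: contrapT => nc.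
have lX := @power_ideal_local i 2 isT.
have soc x : e i * x = x -> x * e j = x -> x \in J -> x \notin R 2 ->
    socle_elt j (power_ideal i 2) x.
  move=> ex xe Jx xR; split.
  - by apply/negP => /power_idealP; rewrite ex; apply/negP.
  - by rewrite xe subrr mem0v.
  by move=> y Jy; apply/power_idealP; rewrite mulrA ex mulJJ.
have aR : a \notin R 2 by apply/negP => aR; apply: nc; exists 0; rewrite scale0r subr0.
have ts c : a - c *: b \notin power_ideal i 2.
  apply/negP => /power_idealP; rewrite mulrBr -scalerAr ea eb => h.
  by apply: nc; exists c.
have [] := gluing lX lX (soc b eb be Jb bR) (soc a ea ae Ja aR) (jac0 i Jb) (jac0 i Ja)
  (jac0 i Ja) ts nak.
  move=> [m /power_idealP h _]; have [y Jy mE] := scalar_part i m.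
  move: h; rewrite mulrBr eb mE // opprD addrA => h.
  have h' : b - chi i m *: a \in R 2.
    by rewrite -[_ - _](subrK (y * a)) memvD // mulJJ.
  have [m0|m0] := eqVneq (chi i m) 0; first by rewrite m0 scale0r subr0 (negbTE bR) in h'.
  apply: nc; exists (chi i m)^-1.
  have -> : a - (chi i m)^-1 *: b = - ((chi i m)^-1 *: (b - chi i m *: a)).
    by rewrite scalerBr scalerA mulVf // scale1r opprB.
  by rewrite memvN memvZ.
move=> [m /power_idealP h _]; have [y Jy mE] := scalar_part i m.
move: h; rewrite mulrBr ea mE // opprD addrA => h.
apply: nc; exists (chi i m).
by rewrite -[_ - _](subrK (y * b)) memvD // mulJJ.
Qed.

Lemma arr_span i j a : arrow_like i j a -> exists c, a - c *: arr i j \in R 2.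
Proof.
move=> al; have [r0|r0] := eqVneq (arr i j) 0.
  by exists 0; rewrite scale0r subr0; apply: arr_zero al.
exact: no_parallel (arr_like i j) (arr_R2 r0).
Qed.

Lemma arrow_like_corner i j a : a \in J -> arrow_like i j (e i * a * e j).
Proof.
move=> Ja; split; first by rewrite !mulrA idem_diag.
  by rewrite -mulrA idem_diag.
by apply: jac_mulr; apply: jac_mull.
Qed.

(** The second clause fixes the coefficient at 0 when there is no arrow; otherwise it would be
    arbitrary there and [tcoef] could fail to be linear. *)
Lemma tcoef_exists i j a : exists c, e i * jpart D a * e j - c *: arr i j \in R 2 /\
   (arr i j = 0 -> c = 0).
Proof.
have [c h] := arr_span (arrow_like_corner i j (jpartP D a)).
have [r0|r0] := eqVneq (arr i j) 0; last by exists c; split=> // r1; rewrite r1 eqxx in r0.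
by exists 0; rewrite scale0r; split=> //; move: h; rewrite r0 scaler0.
Qed.

(* The coefficient of the arrow from i to j in a modulo J^2. *)
Definition tcoef i j a : K := sval (cid (tcoef_exists i j a)).

Lemma tcoefP i j a : e i * jpart D a * e j - tcoef i j a *: arr i j \in R 2.
Proof. by rewrite /tcoef; case: cid => c []. Qed.

Lemma tcoef0 i j a : arr i j = 0 -> tcoef i j a = 0.
Proof. by rewrite /tcoef; case: cid => c []. Qed.

Lemma tcoef_uniq i j a c : arr i j != 0 -> e i * jpart D a * e j - c *: arr i j \in R 2 ->
  tcoef i j a = c.
Proof.
move=> r0 h; apply/eqP; rewrite -subr_eq0; apply: contraNT (arr_R2 r0) => d0.
have : (tcoef i j a - c) *: arr i j \in R 2.
  rewrite scalerBl -[X in X \in _](_ : (e i * jpart D a * e j - c *: arr i j) -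
     (e i * jpart D a * e j - tcoef i j a *: arr i j) = _).
    by rewrite memvB // tcoefP.
  by rewrite opprB addrC addrA subrK.
by move/(memvZ (tcoef i j a - c)^-1); rewrite scalerA mulVf // scale1r.
Qed.

Lemma jpart_linear c a b : jpart D (c *: a + b) = c *: jpart D a + jpart D b.
Proof.
rewrite /jpart scalerBr scaler_sumr addrACA -opprD -big_split /=; congr (_ - _).
by apply: eq_bigr => i _; rewrite linearP /= scalerDl scalerA.
Qed.

Lemma tcoef_linear i j : scalar (tcoef i j).
Proof.
move=> c a b; have [r0|r0] := eqVneq (arr i j) 0; first by rewrite !tcoef0 // mulr0 addr0.
apply: tcoef_uniq => //; rewrite jpart_linear mulrDr mulrDl -scalerAr -scalerAl.
rewrite scalerDl -scalerA opprD addrACA -scalerBr.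
by rewrite memvD ?memvZ ?tcoefP.
Qed.

HB.instance Definition _ i j :=
  GRing.isLinear.Build K A K *%R (tcoef i j) (tcoef_linear i j).

Lemma jpart_jac a : a \in J -> jpart D a = a.
Proof.
by move=> Ja; rewrite /jpart big1 ?subr0 // => i _; rewrite jac0 // scale0r.
Qed.

Lemma tcoef_jac i j a : a \in J -> e i * a * e j - tcoef i j a *: arr i j \in R 2.
Proof. by move=> Ja; rewrite -{1}(jpart_jac Ja) tcoefP. Qed.

Lemma tcoef_R2 i j a : a \in R 2 -> tcoef i j a = 0.
Proof.
move=> aR; have [r0|r0] := eqVneq (arr i j) 0; first exact: tcoef0.
apply: tcoef_uniq => //; rewrite scale0r subr0 jpart_jac ?R2J //.
by apply: radp_mulr; apply: radp_mull.
Qed.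

Lemma jpart_idem k : jpart D (e k) = 0.
Proof.
apply/eqP; rewrite subr_eq0 (bigD1 k) //= chi_idem eqxx scale1r big1 ?addr0 // => i ik.
by rewrite chi_idem (negbTE ik) scale0r.
Qed.

Lemma tcoef_idem i j k : tcoef i j (e k) = 0.
Proof.
have [r0|r0] := eqVneq (arr i j) 0; first exact: tcoef0.
by apply: tcoef_uniq => //; rewrite jpart_idem mulr0 mul0r scale0r subrr mem0v.
Qed.

(** Leibniz rule: split a and b into idempotent and radical parts; the product of the radical parts
    lies in J^2 and contributes nothing. This makes [star] a right ideal and [merge_act] an
    action. *)
Lemma tcoefM i j a b : tcoef i j (a * b) = chi i a * tcoef i j b + tcoef i j a * chi j b.
Proof.
have [r0|r0] := eqVneq (arr i j) 0; first by rewrite !tcoef0 // mulr0 mul0r addr0.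
apply: tcoef_uniq => //.
have expand (x x' y y' : A) : (x + x') * (y + y') = x * y + (x' * y' + x * y' + x' * y).
  by rewrite mulrDl !mulrDr -!addrA; congr (_ + _); rewrite [LHS]addrA [LHS]addrC.
have jM : jpart D (a * b) = jpart D a * jpart D b + (\sum_k chi k a *: (e k * jpart D b)) +
    \sum_k chi k b *: (jpart D a * e k).
  rewrite {1}/jpart {1}(jpartE D a) {1}(jpartE D b) expand.
  have -> : (\sum_k chi k a *: e k) * (\sum_k chi k b *: e k) = \sum_k chi k (a * b) *: e k.
    rewrite mulr_suml; apply: eq_bigr => k _; rewrite mulr_sumr (bigD1 k) //= big1 => [|l lk].
      by rewrite addr0 -scalerAl -scalerAr idem_diag scalerA rmorphM.
    by rewrite -scalerAl -scalerAr idem_mul eq_sym (negbTE lk) !scaler0.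
  have -> : (\sum_k chi k a *: e k) * jpart D b = \sum_k chi k a *: (e k * jpart D b).
    by rewrite mulr_suml; apply: eq_bigr => k _; rewrite scalerAl.
  have -> : jpart D a * (\sum_k chi k b *: e k) = \sum_k chi k b *: (jpart D a * e k).
    by rewrite mulr_sumr; apply: eq_bigr => k _; rewrite scalerAr.
  by rewrite addrC addKr.
have distr (x y z : A) : e i * (x + y + z) * e j = e i * x * e j + e i * y * e j + e i * z * e j.
  by rewrite !mulrDr !mulrDl.
rewrite jM distr.
have -> : e i * (\sum_k chi k a *: (e k * jpart D b)) * e j = chi i a *: (e i * jpart D b * e j).
  rewrite mulr_sumr mulr_suml (bigD1 i) //= big1 => [|k ki].
    by rewrite addr0 -scalerAr -scalerAl !mulrA idem_diag.
  by rewrite -scalerAr -scalerAl !mulrA idem_mul eq_sym (negbTE ki) !mul0r scaler0.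
have -> : e i * (\sum_k chi k b *: (jpart D a * e k)) * e j = chi j b *: (e i * jpart D a * e j).
  rewrite mulr_sumr mulr_suml (bigD1 j) //= big1 => [|k ki].
    by rewrite addr0 -scalerAr -scalerAl -!mulrA idem_diag.
  by rewrite -scalerAr -scalerAl -!mulrA idem_mul (negbTE ki) !mulr0 scaler0.
set P := e i * _ * e j.
have -> : P + chi i a *: (e i * jpart D b * e j) + chi j b *: (e i * jpart D a * e j) -
   (chi i a * tcoef i j b + tcoef i j a * chi j b) *: arr i j =
   P + chi i a *: (e i * jpart D b * e j - tcoef i j b *: arr i j) +
   chi j b *: (e i * jpart D a * e j - tcoef i j a *: arr i j).
  rewrite !scalerBr !scalerA scalerDl opprD [tcoef i j a * _]mulrC -!addrA.
  by congr (_ + (_ + _)); rewrite addrCA.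
apply: memvD; last by rewrite memvZ // tcoefP.
apply: memvD; last by rewrite memvZ // tcoefP.
by apply: radp_mulr; apply: radp_mull; apply: mulJJ; apply: jpartP.
Qed.

Lemma tcoef_arr i j k l : tcoef i j (arr k l) = ((i == k) && (j == l) && (arr i j != 0))%:R.
Proof.
have [r0|r0] := eqVneq (arr i j) 0; first by rewrite tcoef0 // andbF.
apply: tcoef_uniq => //; rewrite jpart_jac ?arr_J // -{1}(e_arr k l) mulrA idem_mul andbT.
case: eqP => [->|_] /=; last by rewrite !mul0r scale0r subrr mem0v.
rewrite e_arr -{1}(arr_e k l) -mulrA idem_mul [l == j]eq_sym.
case: eqP => [->|_]; last by rewrite mulr0 scale0r subrr mem0v.
by rewrite arr_e scale1r subrr mem0v.
Qed.

End Arrows.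

(** * Vertices with several outgoing arrows *)

Section QuiverFacts.
Variables (K : fieldType) (A : falgType K) (D : split_data A).
Hypothesis nak : right_nakayama A 3.
Local Notation e := (@idem _ _ D).
Local Notation chi := (@chi _ _ D).
Local Notation J := (jac D).
Local Notation R := (radp D).
Local Notation I := 'I_(nvert D).
Local Notation arr := (@arr _ _ D).
Local Notation t := (tcoef nak).

Lemma star_space v (L : {pred I}) :
  {X : {vspace A} | forall a, a \in X <-> chi v a = 0 /\ forall j, j \in L -> t v j a = 0}.
Proof.
apply: subspace_of_pred => [|c a b [a0 ta] [b0 tb]].
  by split=> [|j _]; rewrite linear0.
split=> [|j Lj]; first by rewrite linearP /= a0 b0 mulr0 addr0.
by rewrite linearP /= ta // tb // mulr0 addr0.
Qed.

(* A / star v L has basis the vertex v and the arrows from v to L. *)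
Definition star v L := sval (star_space v L).
Lemma starP v (L : {pred I}) a :
  a \in star v L <-> chi v a = 0 /\ forall j, j \in L -> t v j a = 0.
Proof. exact: (svalP (star_space v L)). Qed.

Lemma star_local v (L : {pred I}) : local_ideal v (star v L).
Proof.
split=> [x a /starP[x0 tx]| |x /starP[] //].
  apply/starP; split=> [|j Lj]; first by rewrite rmorphM /= x0 mul0r.
  by rewrite tcoefM x0 tx // !mul0r addr0.
apply/starP; split=> [|j _]; first by rewrite linearB /= rmorph1 chi_idem eqxx subrr.
rewrite linearB /= tcoef_idem subr0 -(idem_sum D) linear_sum /= big1 // => k _.
exact: tcoef_idem.
Qed.

Lemma chi_arr u i j : chi u (arr i j) = 0.
Proof. exact/jac0/arr_J. Qed.

Lemma tcoef_arr1 i j : arr i j != 0 -> t i j (arr i j) = 1.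
Proof. by move=> r; rewrite tcoef_arr !eqxx r. Qed.

Lemma star_socle v (L : {pred I}) j : arr v j != 0 -> j \in L ->
  socle_elt j (star v L) (arr v j).
Proof.
move=> r0 Lj; split.
- apply/negP => /starP[_ /(_ j Lj)]; rewrite tcoef_arr1 // => /eqP.
  by rewrite oner_eq0.
- by rewrite arr_e subrr mem0v.
move=> y Jy; apply/starP; split=> [|k Lk]; first by rewrite rmorphM /= chi_arr mul0r.
by rewrite tcoefM chi_arr mul0r add0r (jac0 _ Jy) mulr0.
Qed.

Lemma star_third v (L : {pred I}) x k c : arr v k != 0 -> k \in L -> t v k x = 0 ->
  arr v k - c *: x \notin star v L.
Proof.
move=> r0 Lk tx; apply/negP => /starP[_ /(_ k Lk)].
rewrite linearB linearZ /= tcoef_arr1 // tx mulr0 subr0 => /eqP.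
by rewrite oner_eq0.
Qed.

Lemma tcoef_arr_neq i j k : j != k -> t i j (arr i k) = 0.
Proof. by move=> jk; rewrite tcoef_arr (negbTE jk) andbF. Qed.

(** Glue the stars with arrows to w2, w3 and to w1, w2 along the arrow to w2. A homomorphism that
    matches the two copies of this arrow has scalar part 1. It therefore cannot kill the arrow to
    w3, or to w1 in the other direction, which is zero in its source but not in its target. *)
Lemma outdegree v w1 w2 w3 : w1 != w2 -> w1 != w3 -> w2 != w3 ->
  arr v w1 != 0 -> arr v w2 != 0 -> arr v w3 != 0 -> False.
Proof.
move=> n12 n13 n23 r1 r2 r3.
pose L := pred2 w2 w3; pose L' := pred2 w1 w2.
have L2 : w2 \in L by rewrite !inE eqxx.
have L3 : w3 \in L by rewrite !inE eqxx orbT.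
have L1' : w1 \in L' by rewrite !inE eqxx.
have L2' : w2 \in L' by rewrite !inE eqxx orbT.
have X1 k : k \notin L -> arr v k \in star v L.
  move=> nk; apply/starP; split=> [|j Lj]; first exact: chi_arr.
  by apply: tcoef_arr_neq; apply: contraNneq nk => <-.
have X3 k : k \notin L' -> arr v k \in star v L'.
  move=> nk; apply/starP; split=> [|j Lj]; first exact: chi_arr.
  by apply: tcoef_arr_neq; apply: contraNneq nk => <-.
have ts c : arr v w3 - c *: arr v w2 \notin star v L.
  by apply: star_third => //; apply: tcoef_arr_neq; rewrite eq_sym.
have [] := gluing (star_local v L) (star_local v L') (star_socle r2 L2) (star_socle r2 L2')
  (chi_arr _ _ _) (chi_arr _ _ _) (chi_arr v v w3) ts nak.
  move=> [m /starP[_ /(_ w2 L2)]].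
  rewrite linearB /= tcoefM tcoef_arr1 // chi_arr mulr0 addr0 mulr1 => /eqP.
  rewrite subr_eq0 => /eqP m1 /(_ (arr v w3)) h.
  have /h/starP[_ /(_ w3 L3)] : arr v w3 \in star v L'.
    by apply: X3; rewrite !inE negb_or eq_sym n13 eq_sym n23.
  rewrite tcoefM tcoef_arr1 // chi_arr mulr0 addr0 mulr1 -m1 => /eqP.
  by rewrite oner_eq0.
move=> [m /starP[_ /(_ w2 L2')]].
rewrite linearB /= tcoefM tcoef_arr1 // chi_arr mulr0 addr0 mulr1 => /eqP.
rewrite subr_eq0 => /eqP m1 /(_ (arr v w1)) h.
have /h/starP[_ /(_ w1 L1')] : arr v w1 \in star v L.
  by apply: X1; rewrite !inE negb_or n12 n13.
rewrite tcoefM tcoef_arr1 // chi_arr mulr0 addr0 mulr1 -m1 => /eqP.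
by rewrite oner_eq0.
Qed.

Section LocalQuotient.
Variables (v : I) (X : {vspace A}).
Hypothesis lX : local_ideal v X.

Lemma local_stable : @stable _ _ (regular_module A) X.
Proof. by case: lX => rX _ _ x a; apply: rX. Qed.

Definition local_quotient : rmodule A := quot_module (Submodule local_stable).

Definition local_pi (a : A) : local_quotient := quot_proj (Submodule local_stable) a.
Local Notation pi := local_pi.

Lemma local_piD x y : pi (x + y) = pi x + pi y. Proof. exact: raddfD. Qed.
Lemma local_piB x y : pi (x - y) = pi x - pi y. Proof. exact: raddfB. Qed.
Lemma local_piZ c x : pi (c *: x) = c *: pi x. Proof. exact: linearZ. Qed.
Lemma local_pia z a : pi (z * a) = ract (pi z) a.
Proof. exact: (quot_proj_act (Submodule local_stable)). Qed.
Lemma local_pi0 z : pi z = 0 <-> z \in X.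
Proof. by rewrite -(quot_proj_ker (Submodule local_stable)); split=> /eqP. Qed.
Lemma local_piS y : exists z, pi z = y.
Proof. exact: (quot_proj_surj (U := Submodule local_stable) y). Qed.

Lemma local_quotient_dim : (\dim {:local_quotient} + \dim X = \dim {:A})%N.
Proof. exact: (quot_dim (Submodule local_stable)). Qed.

Lemma local_image (Y : {vspace A}) : (X <= Y)%VS -> (forall x a, x \in Y -> x * a \in Y) ->
  exists U : {vspace local_quotient}, stable U /\ forall a, pi a \in U <-> a \in Y.
Proof.
move=> XY rY.
have [U UP] : {U : {vspace local_quotient} | forall y, y \in U <-> exists2 a, a \in Y & y = pi a}.
  apply: subspace_of_pred => [|c x y [a Ya ->] [b Yb ->]].
    by exists 0; rewrite ?mem0v //; apply/esym/local_pi0; rewrite mem0v.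
  exists (c *: a + b); first by rewrite memvD ?memvZ.
  by rewrite local_piD local_piZ.
exists U; split=> [x a /UP[y Yy ->]|a].
  by rewrite -local_pia; apply/UP; exists (y * a) => //; apply: rY.
split=> [/UP[b Yb E]|Ya]; last by apply/UP; exists a.
rewrite -[a](subrK b) memvD // (subvP XY) //; apply/local_pi0.
by rewrite local_piB -E subrr.
Qed.

(** One of two complementary summands contains the class of an element with nonzero character at v.
    Such an element is invertible in the corner at v, so this summand contains the generator. *)
Lemma local_quotient_indecomposable : indecomposable local_quotient.
Proof.
case: (lX) => rX Xe X0; split.
  move=> E; have : pi 1 \in (fullv : {vspace local_quotient}) by apply: memvf.
  rewrite E memv0 => /eqP/local_pi0/X0; rewrite rmorph1 => /eqP.
  by rewrite oner_eq0.
suff main (U W : submodule local_quotient) a b : (U :&: W)%VS = 0%VS ->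
    pi a \in (U : {vspace local_quotient}) -> pi b \in (W : {vspace local_quotient}) ->
    pi 1 = pi a + pi b -> chi v a != 0 -> W = 0%VS :> {vspace local_quotient}.
  move=> U W UW1 UW0.
  have /memv_addP[x Ux [y Wy xy]] : pi 1 \in (U + W)%VS by rewrite UW1 memvf.
  have [a aE] := local_piS x; have [b bE] := local_piS y; subst x y.
  have [a0|a0] := eqVneq (chi v a) 0; last by right; apply: (main U W a b).
  left; apply: (main W U b a) => //; first by rewrite capvC.
    by rewrite addrC.
  have : 1 - (a + b) \in X.
    by apply/local_pi0; rewrite local_piB local_piD xy subrr.
  move/X0; rewrite linearB linearD /= rmorph1 a0 add0r => /eqP; rewrite subr_eq0 => /eqP <-.
  exact: oner_neq0.
move=> UW0 Ua Wb E a0; have [z zE] := corner_inv a0.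
have piev c : pi (e v * c) = pi c.
  apply/eqP; rewrite eq_sym -subr_eq0; apply/eqP; rewrite -local_piB; apply/local_pi0.
  by rewrite -{1}[c]mul1r -mulrBl; apply: rX.
have Ue : pi (e v) \in (U : {vspace local_quotient}).
  have -> : pi (e v) = ract (pi a) (e v * z) by rewrite -local_pia -[in LHS]zE -!mulrA piev.
  exact: (@submod_stable _ _ _ U).
have UF : (U : {vspace local_quotient}) = fullv.
  apply/eqP; rewrite eqEsubv subvf /=; apply/subvP => y _.
  have [c <-] := local_piS y; rewrite -piev local_pia; exact: (@submod_stable _ _ _ U).
by move: UW0; rewrite UF capfv.
Qed.

End LocalQuotient.

(* The second radical quotient of P_v = A / (1 - e_v) A is not uniserial, hence
   P_v has dimension at most 4. *)
Lemma two_arrows_R2 v w1 w2 y z : w1 != w2 -> arr v w1 != 0 -> arr v w2 != 0 ->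
  y \in R 2 -> z \in R 2 -> e v * y = y -> e v * z = z -> z != 0 -> exists c, y = c *: z.
Proof.
move=> n12 r1 r2 Ry Rz ey ez z0; apply: contrapT => nyz.
have [X0 XP] : {X : {vspace A} | forall a, a \in X <-> e v * a = 0}.
  apply: subspace_of_pred => [|c a b a0 b0]; first by rewrite mulr0.
  by rewrite mulrDr -scalerAr a0 b0 scaler0 addr0.
have lX : local_ideal v X0.
  split=> [x a /XP x0| |x /XP x0].
  - by apply/XP; rewrite mulrA x0 mul0r.
  - by apply/XP; rewrite mulrBr mulr1 idem_diag subrr.
  by rewrite -chi_e_mul x0 linear0.
have X0star (L : {pred I}) : (X0 <= star v L)%VS.
  apply/subvP => x /XP x0; apply/starP; split; first by rewrite -chi_e_mul x0 linear0.
  move=> j _; rewrite -[x](subrK (e v * x)) {2}x0 addr0 linearB /= tcoefM chi_idem eqxx.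
  by rewrite mul1r tcoef_idem mul0r addr0 subrr.
have rstar L : forall x a, x \in star v L -> x * a \in star v L by case: (star_local v L).
have [U1 [sU1 U1P]] := local_image lX (X0star (pred1 w1)) (rstar _).
have [U2 [sU2 U2P]] := local_image lX (X0star (pred1 w2)) (rstar _).
have [U0 [sU0 U0P]] := local_image lX (X0star pred0) (rstar _).
have notin w (L : {pred I}) : arr v w != 0 -> w \in L -> arr v w \notin star v L.
  move=> rw Lw; apply/negP => /starP[_ /(_ w Lw)]; rewrite tcoef_arr1 // => /eqP.
  by rewrite oner_eq0.
have isin w w' : w != w' -> arr v w \in star v (pred1 w').
  move=> ww; apply/starP; split=> [|j]; first exact: chi_arr.
  by rewrite inE => /eqP ->; apply: tcoef_arr_neq; rewrite eq_sym.
have n12' : ~~ (U1 <= U2)%VS.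
  apply/negP => /subvP h; case/negP: (notin w2 (pred1 w2) r2 (eqxx _)).
  by apply/U2P/h/U1P/isin; rewrite eq_sym.
have n21' : ~~ (U2 <= U1)%VS.
  apply/negP => /subvP h; case/negP: (notin w1 (pred1 w1) r1 (eqxx _)).
  by apply/U1P/h/U2P/isin.
have rad1 : (radn (local_quotient lX) 1 <= U0)%VS.
  apply: (rad_space_sub (D := D) sU0) => x j _ Jj; have [a <-] := local_piS x.
  rewrite -local_pia; apply/U0P/starP; split=> //.
  by rewrite rmorphM /= (jac0 v Jj) mulr0.
have rad2 (L : {pred I}) (U : {vspace local_quotient lX}) : stable U ->
    (forall a, local_pi lX a \in U <-> a \in star v L) ->
    (radn (local_quotient lX) 2 <= U)%VS.
  move=> sU UP; apply: (rad_space_sub (D := D) sU) => x j rx Jj.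
  have := subvP rad1 _ rx; have [a <-] := local_piS x.
  move=> /U0P/starP[a0 _]; rewrite -local_pia; apply/UP/starP.
  split=> [|k _]; first by rewrite rmorphM /= a0 mul0r.
  by rewrite tcoefM a0 mul0r add0r (jac0 k Jj) mulr0.
have le4 := nakayama3_dim (k := 2) D nak (local_quotient_indecomposable lX) isT sU1 sU2 n12' n21'
   (rad2 _ _ sU1 U1P) (rad2 _ _ sU2 U2P).
have dE := local_quotient_dim lX.
(* Five elements are adjoined to X0 in turn, namely z, y, the two arrows and 1, each outside the
   span reached so far. This contradicts [le4]. *)
have nz : z \notin X0 by apply/negP => /XP; rewrite ez; apply/eqP.
have d1 := dimv_add_line nz.
have ny : y \notin (X0 + <[z]>)%VS.
  apply/negP => /memv_addP[x /XP x0 [_ /vlineP[c ->] yE]]; apply: nyz; exists c.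
  by rewrite -ey yE mulrDr x0 add0r -scalerAr ez.
have d2 := dimv_add_line ny.
have S2 : (X0 + <[z]> + <[y]> <= star v (pred2 w1 w2))%VS.
  rewrite !subv_add X0star /= -!memvE; apply/andP; split.
    by apply/starP; split=> [|j _]; [apply/jac0/R2J|apply: tcoef_R2].
  by apply/starP; split=> [|j _]; [apply/jac0/R2J|apply: tcoef_R2].
have n1 : arr v w1 \notin (X0 + <[z]> + <[y]>)%VS.
  apply: contra (notin w1 (pred2 w1 w2) r1 _); first exact: (subvP S2).
  by rewrite !inE eqxx.
have d3 := dimv_add_line n1.
have S1 : (X0 + <[z]> + <[y]> + <[arr v w1]> <= star v (pred1 w2))%VS.
  rewrite subv_add -memvE isin // andbT; apply: subv_trans S2 _.
  apply/subvP => a /starP[a0 ta]; apply/starP; split=> // j Lj; apply: ta.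
  by move: Lj; rewrite !inE => ->; rewrite orbT.
have n2 : arr v w2 \notin (X0 + <[z]> + <[y]> + <[arr v w1]>)%VS.
  apply: contra (notin w2 (pred1 w2) r2 (eqxx _)); exact: (subvP S1).
have d4 := dimv_add_line n2.
have n3 : 1 \notin (X0 + <[z]> + <[y]> + <[arr v w1]> + <[arr v w2]>)%VS.
  apply/negP => /memv_addP[a /(subvP S1)/starP[a0 _] [_ /vlineP[c ->] E]].
  have := congr1 (chi v) E; rewrite rmorph1 linearD linearZ /= a0 chi_arr mulr0 addr0.
  by move/eqP; rewrite oner_eq0.
have := dimvS (subvf (X0 + <[z]> + <[y]> + <[arr v w1]> + <[arr v w2]> + <[1%R]>)%VS).
rewrite (dimv_add_line n3) d4 d3 d2 d1 -dE.
by rewrite -[X in (X <= _)%N]/(4.+1 + \dim X0)%N leq_add2r ltnNge le4.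
Qed.

(** The arrows from v span e_v J modulo J^2. Substituting this for the left factor of a product
    moves the error into ever higher powers of J, until the nilpotency index is reached. *)
Lemma jac_arrows v a : a \in J -> exists b : I -> A, e v * a = \sum_w arr v w * b w.
Proof.
have [S SP] : {S : {vspace A} | forall x, x \in S <-> exists b : I -> A, x = \sum_w arr v w * b w}.
  apply: subspace_of_pred => [|c x y [b ->] [b' ->]].
    by exists (fun _ => 0); rewrite big1 // => w _; rewrite mulr0.
  exists (fun w => c *: b w + b' w); rewrite scaler_sumr -big_split /=.
  by apply: eq_bigr => w _; rewrite mulrDr scalerAr.
have rS x c : x \in S -> x * c \in S.
  move=> /SP[b ->]; apply/SP; exists (fun w => b w * c).
  by rewrite mulr_suml; apply: eq_bigr => w _; rewrite mulrA.
have key k : forall x, x \in J -> e v * x \in (S + R k.+1)%VS.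
  elim: k => [|k IH] x Jx.
    by apply: (subvP (addvSr _ _)); rewrite -jac_R1; apply: jac_mull.
  have step r : r \in R 2 -> e v * r \in (S + R k.+2)%VS.
    have [W WP] : {W : {vspace A} | forall r, r \in W <-> e v * r \in (S + R k.+2)%VS}.
      apply: subspace_of_pred => [|c y z Wy Wz]; first by rewrite mulr0 mem0v.
      by rewrite mulrDr -scalerAr memvD ?memvZ.
    move=> Rr; apply/WP; move: r Rr; apply/subvP; apply: radp_subv => y z Ry Jz; apply/WP.
    have Jy : y \in J by rewrite jac_R1.
    have /memv_addP[s Ss [q Rq E]] := IH y Jy.
    by rewrite mulrA E mulrDl memv_add ?rS // mem_radpS.
  have -> : e v * x = \sum_w (t v w x *: arr v w + (e v * x * e w - t v w x *: arr v w)).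
    rewrite (eq_bigr (fun w => e v * x * e w)); last by move=> w _; rewrite addrC subrK.
    by rewrite -mulr_sumr idem_sum mulr1.
  apply: memv_suml => w _; apply: memvD.
    apply: (subvP (addvSl _ _)); rewrite memvZ //; apply/SP.
    exists (fun w' => if w' == w then 1 else 0); rewrite (bigD1 w) //= eqxx mulr1 big1 ?addr0 //.
    by move=> w' /negbTE ->; rewrite mulr0.
  have := step _ (tcoef_jac nak v w Jx).
  by rewrite mulrBr -scalerAr !mulrA idem_diag e_arr.
move=> Ja; apply/SP; have := key (nilindex D).-1 a Ja.
by rewrite prednK ?nilindex_gt0 // radp_nil addv0.
Qed.

Lemma radp_gen k v a : a \in R k.+1 -> e v * a = a ->
  exists b : I -> A, (forall w, b w \in R k /\ e w * b w = b w) /\ a = \sum_w arr v w * b w.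
Proof.
have [S SP] : {S : {vspace A} | forall x, x \in S <->
    exists b : I -> A, (forall w, b w \in R k /\ e w * b w = b w) /\
      e v * x = \sum_w arr v w * b w}.
  apply: subspace_of_pred => [|c x y [b [Rb E]] [b' [Rb' E']]].
    exists (fun _ => 0); split; first by move=> w; rewrite mem0v mulr0.
    by rewrite mulr0 big1 // => w _; rewrite mulr0.
  exists (fun w => c *: b w + b' w); split.
    move=> w; have [R1 e1] := Rb w; have [R2 e2] := Rb' w.
    by rewrite memvD ?memvZ // mulrDr -scalerAr e1 e2.
  rewrite mulrDr -scalerAr E E' scaler_sumr -big_split /=.
  by apply: eq_bigr => w _; rewrite mulrDr scalerAr.
move=> Ra ea; suff /SP : a \in S by rewrite ea.
move: a Ra {ea}; apply/subvP; apply: radp_subvl => x y Jx Ry; apply/SP.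
have [b bE] := jac_arrows v Jx; exists (fun w => e w * (b w * y)); split.
  by move=> w; split; [do 2!apply: radp_mull|rewrite !mulrA idem_diag].
rewrite mulrA bE mulr_suml; apply: eq_bigr => w _.
by rewrite [RHS]mulrA arr_e mulrA.
Qed.

End QuiverFacts.

(** * Relations of length two *)

Section Relations.
Variables (K : fieldType) (A : falgType K) (D : split_data A).
Hypothesis nak : right_nakayama A 3.
Local Notation e := (@idem _ _ D).
Local Notation chi := (@chi _ _ D).
Local Notation J := (jac D).
Local Notation R := (radp D).
Local Notation I := 'I_(nvert D).
Local Notation arr := (@arr _ _ D).
Local Notation t := (tcoef nak).

(** By [two_arrows_R2] the space e_v J^2 is at most a line, and J acts on it nilpotently, hence by
    zero. *)
Lemma two_arrows_R3 v w1 w2 y : w1 != w2 -> arr v w1 != 0 -> arr v w2 != 0 ->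
  y \in R 3 -> e v * y = 0.
Proof.
move=> n12 r1 r2.
have [W WP] : {W : {vspace A} | forall y, y \in W <-> e v * y = 0}.
  apply: subspace_of_pred => [|c a b a0 b0]; first by rewrite mulr0.
  by rewrite mulrDr -scalerAr a0 b0 scaler0 addr0.
move=> Ry; apply/WP; move: y Ry; apply/subvP; apply: radp_subv => z j Rz Jj; apply/WP.
have [z0|z0] := eqVneq (e v * z) 0; first by rewrite mulrA z0 mul0r.
have Rez : e v * z \in R 2 by apply: radp_mull.
have eez : e v * (e v * z) = e v * z by rewrite mulrA idem_diag.
have [||c cE] := two_arrows_R2 nak n12 r1 r2 _ Rez _ eez z0 (y := e v * z * j).
- exact: radp_mulr.
- by rewrite mulrA eez.
have [c0|c0] := eqVneq c 0; first by rewrite mulrA cE c0 scale0r.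
case/eqP: z0; apply: (@jac_unit _ _ D _ (c^-1 *: j)); first by rewrite memvZ.
by rewrite -scalerAr cE scalerA mulVf // scale1r.
Qed.

Lemma arr_mul_e u v w : arr u v * arr v w * e w = arr u v * arr v w.
Proof. by rewrite -mulrA arr_e. Qed.

Lemma e_arr_mul u v w : e u * (arr u v * arr v w) = arr u v * arr v w.
Proof. by rewrite mulrA e_arr. Qed.

Lemma arr_mul_R2 u v w : arr u v * arr v w \in R 2.
Proof. by apply: mulJJ; apply: arr_J. Qed.

Lemma arr_mul_eq0 u v w : arr u v * arr v w != 0 -> arr u v != 0 /\ arr v w != 0.
Proof. by move=> h; split; apply: contraNneq h => ->; rewrite ?mulr0 ?mul0r. Qed.

Lemma type_indep w1 w2 (x y : A) c : w1 != w2 -> x * e w1 = x -> y * e w2 = y ->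
  x = c *: y -> x = 0.
Proof.
move=> n12 x1 y2 xE; rewrite -x1 xE -scalerAl -y2 -mulrA idem_mul eq_sym (negbTE n12).
by rewrite mulr0 scaler0.
Qed.

Lemma power_socle u k w x : e u * x = x -> x * e w = x -> x \in R k -> x \notin R k.+1 ->
  socle_elt w (power_ideal u k.+1) x.
Proof.
move=> ex xe Rx nRx; split.
- by apply/negP => /power_idealP; rewrite ex; apply/negP.
- by rewrite xe subrr mem0v.
by move=> j Jj; apply/power_idealP; rewrite mulrA ex mem_radpS.
Qed.

(** The two products end at different vertices, so they are independent in e_u J^2. A second arrow
    out of u would make this space a line. *)
Lemma single_arrow u v w1 w2 : w1 != w2 -> arr u v * arr v w1 != 0 -> arr u v * arr v w2 != 0 ->
  forall w, w != v -> arr u w = 0.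
Proof.
move=> n12 h1 h2 w wv; apply/eqP; apply: contraT => rw; rewrite eq_sym in wv.
have [r _] := arr_mul_eq0 h1.
have [c cE] := two_arrows_R2 nak wv r rw (arr_mul_R2 u v w1) (arr_mul_R2 u v w2)
  (e_arr_mul _ _ _) (e_arr_mul _ _ _) h2.
by rewrite (type_indep n12 (arr_mul_e u v w1) (arr_mul_e u v w2) cE) eqxx in h1.
Qed.

Lemma single_arrow_gen u v k a : (forall w, w != v -> arr u w = 0) ->
  a \in R k.+1 -> e u * a = a -> exists b, [/\ b \in R k, e v * b = b & a = arr u v * b].
Proof.
move=> sg Ra ea; have [b [bP aE]] := radp_gen nak Ra ea.
exists (b v); have [Rb eb] := bP v; split=> //.
by rewrite aE (bigD1 v) //= big1 ?addr0 // => w /sg ->; rewrite mul0r.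
Qed.

(* The string module u -> v <- v -> w. *)
Lemma loop_excluded u v w : arr v v != 0 -> arr v w != 0 -> w != v -> u != v ->
  arr u v != 0 -> False.
Proof.
move=> rvv rvw wv uv ruv.
pose L := pred2 v w; pose L' := pred1 v.
have Lv : v \in L by rewrite !inE eqxx.
have Lw : w \in L by rewrite !inE eqxx orbT.
have Lv' : v \in L' by rewrite !inE eqxx.
have ts c : arr v w - c *: arr v v \notin star nak v L.
  by apply: star_third => //; apply: tcoef_arr_neq.
have [] := gluing (star_local nak v L) (star_local nak u L') (star_socle nak rvv Lv)
  (star_socle nak ruv Lv') (chi_arr _ _ _) (chi_arr _ _ _) (chi_arr v v w) ts nak.
  move=> [m /starP[_ /(_ v Lv) h] _]; move: h.
  rewrite linearB /= tcoefM !tcoef_arr chi_arr !eqxx rvv eq_sym (negbTE uv) /=.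
  by rewrite !mulr0 addr0 subr0 => /eqP; rewrite oner_eq0.
move=> [m /starP[_ /(_ v Lv') h] _]; move: h.
rewrite linearB /= tcoefM !tcoef_arr chi_arr !eqxx ruv (negbTE uv) /=.
by rewrite !mulr0 addr0 subr0 => /eqP; rewrite oner_eq0.
Qed.

(* Gluing P_v to itself along the socle elements arr v w2 and z of the same type. *)
Lemma socle_swap v w1 w2 z : w1 != w2 -> arr v w1 != 0 -> arr v w2 != 0 ->
  z != 0 -> e v * z = z -> z * e w2 = z -> z \in R 2 ->
  (forall j, j \in J -> arr v w2 * j = 0) ->
  exists2 j, j \in J & e v * (j * arr v w2) = z.
Proof.
move=> n12 r1 r2 z0 ez ze Rz b2J.
have lX := power_ideal_local v (nilindex_gt0 D).
have XP a : a \in power_ideal v (nilindex D) -> e v * a = 0.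
  by move=> /power_idealP; rewrite radp_nil memv0 => /eqP.
have soc x : e v * x = x -> x * e w2 = x -> x != 0 -> (forall j, j \in J -> x * j = 0) ->
    socle_elt w2 (power_ideal v (nilindex D)) x.
  move=> ex xe x0 xJ; split.
  - by apply/negP => /XP; rewrite ex; apply/eqP.
  - by rewrite xe subrr mem0v.
  by move=> j Jj; rewrite xJ // mem0v.
have zJ j : j \in J -> z * j = 0.
  by move=> Jj; rewrite -ez -mulrA (two_arrows_R3 n12 r1 r2) // mem_radpS.
have ts c : arr v w1 - c *: arr v w2 \notin power_ideal v (nilindex D).
  apply/negP => /XP; rewrite mulrBr -scalerAr !e_arr => /eqP; rewrite subr_eq0 => /eqP E.
  by rewrite (type_indep n12 (arr_e v w1) (arr_e v w2) E) eqxx in r1.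
have [] := gluing lX lX (soc _ (e_arr v w2) (arr_e v w2) r2 b2J) (soc _ ez ze z0 zJ)
  (chi_arr _ _ _) (jac0 v (R2J Rz)) (chi_arr v v w1) ts nak.
  move=> [m /XP]; rewrite mulrBr e_arr => /eqP; rewrite subr_eq0 => /eqP E _.
  by case/negP: (arr_R2 r2); rewrite E; do 2!apply: radp_mull.
move=> [m /XP]; have [j Jj mE] := scalar_part v m.
rewrite mulrBr ez mE ?e_arr // => /eqP; rewrite subr_eq0 => /eqP E _.
exists j => //.
(* With a nonzero scalar part the arrow itself would lie in J^2, since z and the product of j with
   the arrow do. *)
suff m0 : chi v m = 0.
  by move: E; rewrite m0 scale0r add0r => <-.
apply/eqP; apply: contraT => m0; case/negP: (arr_R2 r2).
have : chi v m *: arr v w2 \in R 2.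
  by rewrite -[_ *: _](addrK (j * arr v w2)) -E memvB // mulJJ // arr_J.
by move/(memvZ (chi v m)^-1); rewrite scalerA mulVf // scale1r.
Qed.

(** Only one arrow leaves u, so the product through w2 also equals arr u v times some z in e_v J^2.
    Then J kills arr v w2, and [socle_swap] writes z as e_v j arr v w2. Up to terms in e_v J^3 = 0
    only the loop at v contributes to e_v j e_v, so there is a loop, and [loop_excluded] applies. *)
Lemma no_branch_R3 u v w1 w2 : w1 != w2 -> arr v w1 != 0 -> arr u v * arr v w1 != 0 ->
  arr u v * arr v w2 != 0 -> arr u v * arr v w2 \in R 3 -> u != v -> False.
Proof.
move=> n12 r1 h1 h2 R3 uv; have [ruv r2] := arr_mul_eq0 h2.
have [z' [Rz' ez' zE']] := single_arrow_gen (single_arrow n12 h1 h2) R3 (e_arr_mul _ _ _).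
pose z := z' * e w2.
have ez : e v * z = z by rewrite mulrA ez'.
have ze : z * e w2 = z by rewrite -mulrA idem_diag.
have Rz : z \in R 2 by apply: radp_mulr.
have zE : arr u v * arr v w2 = arr u v * z by rewrite mulrA -zE' arr_mul_e.
have z0 : z != 0 by apply: contraNneq h2 => z0; rewrite zE z0 mulr0.
have b2J j : j \in J -> arr v w2 * j = 0.
  move=> Jj; apply/eqP; apply: contraT => y0.
  have ey : e v * (arr v w2 * j) = arr v w2 * j by rewrite mulrA e_arr.
  have Ry : arr v w2 * j \in R 2 by apply: mulJJ => //; apply: arr_J.
  have [c cE] := two_arrows_R2 nak n12 r1 r2 Rz Ry ez ey y0.
  case/eqP: h2; apply: (@jac_unit _ _ D _ (c *: j)); first by rewrite memvZ.
  by rewrite {1}zE cE -!scalerAr mulrA.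
have [j Jj jE] := socle_swap n12 r1 r2 z0 ez ze Rz b2J.
have [c] := arr_span nak (arrow_like_corner v v Jj).
set r := _ - _ => Rr.
have er : e v * r = r by rewrite /r mulrBr -scalerAr e_arr !mulrA idem_diag.
have zc : z = c *: (arr v v * arr v w2).
  have -> : z = (e v * j * e v) * arr v w2 by rewrite -mulrA e_arr -mulrA jE.
  have -> : e v * j * e v = r + c *: arr v v by rewrite subrK.
  rewrite mulrDl -scalerAl -{1}er -mulrA (two_arrows_R3 n12 r1 r2) ?add0r //.
  by rewrite mem_radpS // arr_J.
have rvv : arr v v != 0.
  by apply: contraNneq z0 => E; rewrite zc E mul0r scaler0.
have w2v : w2 != v.
  apply: contraNneq z0 => E; rewrite zc (_ : arr v v = arr v w2); last by rewrite E.
  by rewrite b2J ?arr_J // scaler0.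
exact: (loop_excluded rvv r2 w2v uv ruv).
Qed.

(** If neither product is in J^3, glue P_u / P_u J^3 to the star of v with the single arrow to w2,
    along the product through w2 and that arrow. A homomorphism out of the star is left
    multiplication by c arr u v modulo J^2: it kills arr v w1, so c = 0, and it matches the socle
    elements, so c = 1. One out of P_u would put arr v w2 into J^2. *)
Lemma no_branch u v w1 w2 : w1 != w2 ->
  arr u v * arr v w1 = 0 \/ arr u v * arr v w2 = 0.
Proof.
move=> n12; apply: contrapT => nh.
have h1 : arr u v * arr v w1 != 0 by apply/eqP => E; apply: nh; left.
have h2 : arr u v * arr v w2 != 0 by apply/eqP => E; apply: nh; right.
have [ruv r1] := arr_mul_eq0 h1; have [_ r2] := arr_mul_eq0 h2.
have sg := single_arrow n12 h1 h2.
have uv : u != v.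
  apply/eqP => E; rewrite E in sg.
  have [E1|N1] := eqVneq w1 v; last by rewrite sg ?eqxx in r1.
  by rewrite sg ?eqxx // in r2; rewrite -E1 eq_sym.
have n21 : w2 != w1 by rewrite eq_sym.
have [R1|R1] := boolP (arr u v * arr v w1 \in R 3).
  exact: (no_branch_R3 n21 r2 h2 h1 R1 uv).
have [R2|R2] := boolP (arr u v * arr v w2 \in R 3).
  exact: (no_branch_R3 n12 r1 h1 h2 R2 uv).
have soc := power_socle (e_arr_mul u v w2) (arr_mul_e u v w2) (arr_mul_R2 u v w2) R2.
have L2 : w2 \in pred1 w2 by rewrite inE.
have ts c : arr u v - c *: (arr u v * arr v w2) \notin power_ideal u 3.
  apply/negP => /power_idealP; rewrite mulrBr -scalerAr e_arr_mul e_arr => h.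
  case/negP: (arr_R2 ruv); rewrite -[arr u v](subrK (c *: (arr u v * arr v w2))).
  by rewrite memvD ?memvZ ?arr_mul_R2 //; apply: radpW h.
have [] := gluing (power_ideal_local u (isT : 0 < 3)%N) (star_local nak v (pred1 w2)) soc
  (star_socle nak r2 L2) (jac0 u (R2J (arr_mul_R2 u v w2))) (chi_arr _ _ _)
  (chi_arr u u v) ts nak.
  move=> [m /power_idealP]; rewrite mulrBr e_arr_mul => h /(_ (arr v w1)).
  have /[swap] /[apply] /power_idealP : arr v w1 \in star nak v (pred1 w2).
    apply/starP; split=> [|k]; first exact: chi_arr.
    by rewrite inE => /eqP ->; apply: tcoef_arr_neq; rewrite eq_sym.
  have al : arrow_like u v (e u * m * e v).
    split; [by rewrite !mulrA idem_diag|by rewrite -mulrA idem_diag|exact: idem_off].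
  have [c] := arr_span nak al; set r := _ - _ => Rr.
  have mE k : e u * (m * arr v k) = c *: (arr u v * arr v k) + r * arr v k.
    by rewrite scalerAl -mulrDl addrC subrK -!mulrA e_arr.
  have Rrk k : r * arr v k \in R 3 by apply: mem_radpS => //; apply: arr_J.
  rewrite mE => h1'; rewrite mE opprD addrA in h.
  have {}h1' : c *: (arr u v * arr v w1) \in R 3.
    by rewrite -[_ *: _](addrK (r * arr v w1)) memvB.
  have {}h : (1 - c) *: (arr u v * arr v w2) \in R 3.
    by rewrite scalerBl scale1r -[_ - _](subrK (r * arr v w2)) memvD.
  have [c1|c1] := eqVneq (1 - c) 0.
    have E : c = 1 by apply/eqP; rewrite eq_sym -subr_eq0 c1.
    by move: h1'; rewrite E scale1r (negbTE R1).
  move/(memvZ (1 - c)^-1): h; rewrite scalerA mulVf // scale1r.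
  by rewrite (negbTE R2).
move=> [m /starP[_ /(_ w2 L2) h] _]; move: h.
rewrite linearB /= tcoef_arr1 // tcoef_R2 ?subr0; last exact/radp_mull/arr_mul_R2.
by move/eqP; rewrite oner_eq0.
Qed.

(** If several arrows leave u, then e_u J^3 = 0. Otherwise write the product as arr u v z with z in
    e_v J^2 and expand z along the arrows out of v. By [no_branch] only the arrow to w survives, so
    the product equals itself times an element of J. *)
Lemma arr_mul_notin_R3 u v w : arr u v * arr v w != 0 -> arr u v * arr v w \notin R 3.
Proof.
move=> h; have [ruv rvw] := arr_mul_eq0 h; apply/negP => R3.
have [sg|] := pselect (forall k, k != v -> arr u k = 0); last first.
  move=> nsg; have [k [kv rk]] : exists k, v != k /\ arr u k != 0.
    apply: contrapT => nk; apply: nsg => k kv; apply: contrapT => /eqP rk.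
    by apply: nk; exists k; rewrite eq_sym.
  by case/eqP: h; rewrite -e_arr_mul (two_arrows_R3 kv ruv rk).
have [z [Rz ez zE]] := single_arrow_gen sg R3 (e_arr_mul _ _ _).
have [b [bP bE]] := radp_gen nak Rz ez.
case/eqP: (h); apply: (@jac_unit _ _ D _ (b w)); first by rewrite jac_R1; case: (bP w).
rewrite {1}zE bE mulr_sumr (bigD1 w) //= big1 => [|k kw]; first by rewrite addr0 mulrA.
have [E|E] := no_branch u v kw; first by rewrite mulrA E mul0r.
by rewrite E eqxx in h.
Qed.

(** Glue P_u1 and P_u2, both modulo J^3, along the two products. As u1 and u2 differ, a homomorphism
    is left multiplication by an element of J and moves the products into J^3. *)
Lemma no_merge u1 u2 v w : u1 != u2 -> arr u1 v * arr v w = 0 \/ arr u2 v * arr v w = 0.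
Proof.
move=> n12; apply: contrapT => nh.
have h1 : arr u1 v * arr v w != 0 by apply/eqP => E; apply: nh; left.
have h2 : arr u2 v * arr v w != 0 by apply/eqP => E; apply: nh; right.
have [r1 _] := arr_mul_eq0 h1.
have soc u (h : arr u v * arr v w != 0) := power_socle (e_arr_mul u v w) (arr_mul_e u v w)
   (arr_mul_R2 u v w) (arr_mul_notin_R3 h).
have ts c : arr u1 v - c *: (arr u1 v * arr v w) \notin power_ideal u1 3.
  apply/negP => /power_idealP; rewrite mulrBr -scalerAr e_arr_mul e_arr => h.
  case/negP: (arr_R2 r1); rewrite -[arr u1 v](subrK (c *: (arr u1 v * arr v w))).
  by rewrite memvD ?memvZ ?arr_mul_R2 //; apply: radpW h.
have main u u' m (h : arr u v * arr v w != 0) : u != u' ->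
    arr u v * arr v w - m * (arr u' v * arr v w) \in power_ideal u 3 -> False.
  move=> uu' /power_idealP; rewrite mulrBr e_arr_mul => h3.
  case/negP: (arr_mul_notin_R3 h).
  rewrite -[_ * _](subrK (e u * (m * (arr u' v * arr v w)))) memvD //.
  have -> : e u * (m * (arr u' v * arr v w)) = e u * m * e u' * (arr u' v * arr v w).
    by rewrite -!mulrA [e u' * _]mulrA e_arr.
  by apply: mem_radpSl; [apply: idem_off|apply: arr_mul_R2].
have [] := gluing (power_ideal_local u1 (isT : 0 < 3)%N) (power_ideal_local u2 (isT : 0 < 3)%N)
   (soc u1 h1) (soc u2 h2) (jac0 u1 (R2J (arr_mul_R2 u1 v w))) (jac0 u2 (R2J (arr_mul_R2 u2 v w)))
   (chi_arr u1 u1 v) ts nak.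
  by move=> [m h _]; apply: (main _ _ m h1 n12 h).
by move=> [m h _]; apply: (main _ _ m h2 _ h); rewrite eq_sym.
Qed.

(** * Three arrows into one vertex *)

Section InDegree.
Variables (u : 'I_3 -> I) (w : I).
Hypothesis u_inj : injective u.
Hypothesis ru : forall i, arr (u i) w != 0.

Local Notation V := ({ffun 'I_3 -> K^o} * K^o)%type.

(* The basis vectors p_0, p_1, p_2 generate and s spans the socle:
   p_i a = chi (u i) a p_i + t (u i) w a s. *)
Definition merge_act (x : V) (a : A) : V :=
  ([ffun i => x.1 i * chi (u i) a], \sum_i x.1 i * t (u i) w a + x.2 * chi w a).

Lemma merge_act_linear_l a : linear (merge_act^~ a).
Proof.
move=> c [f k] [g l]; congr pair => /=.
  by apply/ffunP => i; rewrite !ffunE /= mulrDl scalerAl.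
rewrite scalerDr scaler_sumr addrACA -big_split /=; congr (_ + _).
  by apply: eq_bigr => i _; rewrite !ffunE /= mulrDl scalerAl.
by rewrite mulrDl scalerAl.
Qed.

Lemma merge_act_linear_r x : linear (merge_act x).
Proof.
move=> c a b; case: x => f k; congr pair => /=.
  by apply/ffunP => i; rewrite !ffunE /= linearP /= mulrDr mulrCA.
rewrite scalerDr scaler_sumr addrACA -big_split /=; congr (_ + _).
  by apply: eq_bigr => i _; rewrite linearP /= mulrDr mulrCA.
by rewrite linearP /= mulrDr mulrCA.
Qed.

Lemma tcoef1 (i j : I) : t i j 1 = 0.
Proof. by rewrite -(idem_sum D) linear_sum /= big1 // => k _; rewrite tcoef_idem. Qed.

Lemma merge_act1 x : merge_act x 1 = x.
Proof.
case: x => f k; congr pair => /=.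
  by apply/ffunP => i; rewrite !ffunE rmorph1 mulr1.
by rewrite rmorph1 mulr1 big1 ?add0r // => i _; rewrite tcoef1 mulr0.
Qed.

Lemma merge_actM x a b : merge_act x (a * b) = merge_act (merge_act x a) b.
Proof.
case: x => f k; congr pair => /=.
  by apply/ffunP => i; rewrite !ffunE rmorphM /= mulrA.
rewrite mulrDl mulr_suml addrA -big_split /= rmorphM /= mulrA; congr (_ + _).
by apply: eq_bigr => i _; rewrite ffunE tcoefM mulrDr !mulrA.
Qed.

Definition merge_module : rmodule A :=
  RModule merge_act_linear_l merge_act_linear_r merge_act1 merge_actM.

(** If the top part f of an element is nonzero at i, the arrow from u i to w sends the element to f
    i times the socle vector; injectivity of [u] removes the other summands. *)
Lemma merge_socle (U : {vspace merge_module}) : stable U -> U != 0%VS ->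
  ((0, 1) : V) \in U.
Proof.
move=> sU U0; have [[f k] Ux x0] : exists2 x, x \in U & x != 0.
  by exists (vpick U); [apply: memv_pick|rewrite vpick0].
have scale (c : K) : c != 0 -> ((0, c) : V) \in U -> ((0, 1) : V) \in U.
  move=> c0 /(memvZ c^-1); congr (_ \in U); congr pair; first exact: scaler0.
  exact: mulVf.
have [f0|f0] := eqVneq f 0.
  apply: (scale k); last by rewrite -f0.
  by apply: contraNneq x0 => k0; rewrite f0 k0.
have [i fi] : exists i, f i != 0.
  apply: contrapT => nf; case/eqP: f0; apply/ffunP => i; rewrite ffunE.
  by apply: contrapT => /eqP fi; apply: nf; exists i.
apply: (scale (f i)) => //.
have := sU _ (arr (u i) w) Ux; congr (_ \in U); congr pair => /=.
  by apply/ffunP => j; rewrite !ffunE chi_arr mulr0.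
rewrite chi_arr mulr0 addr0 (bigD1 i) //= tcoef_arr1 // mulr1 big1 ?addr0 // => j ji.
by rewrite tcoef_arr (inj_eq u_inj) (negbTE ji) mulr0.
Qed.

Lemma merge_indecomposable : indecomposable merge_module.
Proof.
split=> [E|U W _ UW0].
  have : ((0, 1) : V) \in (fullv : {vspace merge_module}) by apply: memvf.
  rewrite E memv0 => /eqP/(congr1 snd)/eqP; by rewrite /= oner_eq0.
have [->|U0] := eqVneq (U : {vspace merge_module}) 0%VS; first by left.
have [->|W0] := eqVneq (W : {vspace merge_module}) 0%VS; first by right.
have : ((0, 1) : V) \in (U :&: W : {vspace merge_module})%VS.
  by rewrite memv_cap !merge_socle //; apply: submod_stable.
by rewrite UW0 memv0 => /eqP/(congr1 snd)/eqP; rewrite /= oner_eq0.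
Qed.

Lemma no_triple_merge : False.
Proof.
have sp (i : 'I_3) : {U : {vspace merge_module} | forall x, x \in U <-> x.1 i = 0}.
  apply: subspace_of_pred => [|c x y x0 y0]; first by rewrite ffunE.
  by rewrite /= !ffunE x0 y0 scaler0 addr0.
have st i (U : {vspace merge_module}) : (forall x, x \in U <-> x.1 i = 0) -> stable U.
  by move=> UP x a /UP x0; apply/UP; rewrite /= ffunE x0 mul0r.
have rd i (U : {vspace merge_module}) : (forall x, x \in U <-> x.1 i = 0) ->
   (radn merge_module 1 <= U)%VS.
  move=> UP; apply: (rad_space_sub (D := D) (st i U UP)) => x j _ Jj.
  by apply/UP; rewrite /= ffunE (jac0 _ Jj) mulr0.
have inc i j (U W : {vspace merge_module}) : i != j -> (forall x, x \in U <-> x.1 i = 0) ->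
    (forall x, x \in W <-> x.1 j = 0) -> ~~ (U <= W)%VS.
  move=> ij UP WP; apply/negP => /subvP UW.
  have /UW/WP : (([ffun k => if k == j then 1 else 0], 0) : V) \in U.
    by apply/UP; rewrite /= ffunE (negbTE ij).
  by rewrite /= ffunE eqxx => /eqP; rewrite oner_eq0.
pose i0 : 'I_3 := ord0; pose i1 : 'I_3 := lift ord0 ord0.
have [[U UP] [W WP]] := (sp i0, sp i1).
have := nakayama3_dim (k := 1) D nak merge_indecomposable isT (st _ _ UP) (st _ _ WP)
  (inc i0 i1 _ _ isT UP WP) (inc i1 i0 _ _ isT WP UP) (rd _ _ UP) (rd _ _ WP).
have dE : dim merge_module = (#|'I_3| * 1 + 1)%N by exact: erefl.
by rewrite dimvf dE card_ord.
Qed.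

End InDegree.

Lemma indegree w u1 u2 u3 : u1 != u2 -> u1 != u3 -> u2 != u3 ->
  arr u1 w != 0 -> arr u2 w != 0 -> arr u3 w != 0 -> False.
Proof.
move=> n12 n13 n23 r1 r2 r3.
pose u (i : 'I_3) := nth u1 [:: u1; u2; u3] i.
apply: (@no_triple_merge u w).
  move=> i j /eqP; rewrite /u nth_uniq //=; last first.
    by rewrite !inE !negb_or n12 n13 n23.
  by move/eqP/val_inj.
by case=> -[|[|[|]]].
Qed.

End Relations.

(** * The presentation by quiver and relations *)

Section Presentation.
Variables (K : fieldType) (A : falgType K) (D : split_data A).
Hypothesis nak : right_nakayama A 3.
Local Notation e := (@idem _ _ D).
Local Notation chi := (@chi _ _ D).
Local Notation J := (jac D).
Local Notation R := (radp D).
Local Notation I := 'I_(nvert D).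
Local Notation arr := (@arr _ _ D).
Local Notation t := (tcoef nak).

Lemma nvert_gt0 : (0 < #|{: I}|)%N.
Proof.
rewrite card_ord lt0n; apply/eqP => n0; have := idem_sum D.
rewrite big1 => [/eqP|i _]; first by rewrite eq_sym oner_eq0.
by have := leq_ltn_trans (leq0n i) (ltn_ord i); rewrite n0.
Qed.

(** By [no_parallel] there is at most one arrow from a given vertex to another, so an ordered pair
    of vertices names it. *)
Definition gabriel_quiver : quiver :=
  @Quiver I {p : I * I | arr p.1 p.2 != 0} (fun a => (val a).1) (fun a => (val a).2) nvert_gt0.
Local Notation Q := gabriel_quiver.

Definition arrow_val (a : arrow Q) : A := arr (src a) (tgt a).

Definition path_val (p : qpath Q) : A :=
  e (path_src p) * \prod_(a <- path_arrows p) arrow_val a.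

Lemma arrow_ext (a b : arrow Q) : src a = src b -> tgt a = tgt b -> a = b.
Proof.
by case: a b => [[i j] /= pa] [[k l] /= pb] /= ik jl; apply: val_inj => /=; rewrite ik jl.
Qed.

Lemma arrow_val_neq0 (a : arrow Q) : arrow_val a != 0.
Proof. by case: a => [[i j] pa]. Qed.

Lemma walk_val v (s : seq (arrow Q)) : walk v s ->
  e v * \prod_(a <- s) arrow_val a * e (walk_end v s) = e v * \prod_(a <- s) arrow_val a.
Proof.
elim: s v => [|a s IH] v /=; first by rewrite big_nil mulr1 idem_diag.
case/andP=> /eqP <- /IH; rewrite big_cons -[walk_end _ (a :: s)]/(walk_end (tgt a) s) => E.
have av : arrow_val a = arrow_val a * e (tgt a) by rewrite arr_e.
by rewrite av -!mulrA [in e (tgt a) * _]mulrA E.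
Qed.

Lemma path_val_cat p q : path_val p * path_val q = oapp path_val 0 (path_cat p q).
Proof.
have pe : path_val p * e (path_tgt p) = path_val p by apply: walk_val; apply: qpath_walk.
have [pq|pq] := eqVneq (path_tgt p) (path_src q); last first.
  rewrite path_cat_none //= -pe /path_val mulrA -[_ * e (path_tgt p) * _]mulrA idem_mul.
  by rewrite (negbTE pq) mulr0 mul0r.
have [r -> er] := path_cat_some pq => /=.
rewrite {2}/path_val mulrA -pq pe /path_val /path_src /path_arrows er /= big_cat /=.
by rewrite mulrA.
Qed.

Lemma path_val_radp p : path_val p \in R (path_length p).
Proof.
rewrite /path_val /path_length; apply: radp_mull; elim: (path_arrows p) => [|a s IH].
  by rewrite memvf.
by rewrite big_cons; apply: mem_radpSl => //; apply: arr_J.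
Qed.

Definition eval (f : path_alg K Q) : A := \sum_(p <- msupp f) f@_p *: path_val p.

Lemma evalEw (d : {fset qpath Q}) f : (msupp f `<=` d)%fset ->
  eval f = \sum_(p <- d) f@_p *: path_val p.
Proof.
move=> fd; rewrite /eval (big_fset_incl _ fd) // => p _ pf.
by rewrite (mcoeff_outdom pf) scale0r.
Qed.

Lemma eval_linear : linear eval.
Proof.
move=> c f g; pose d := (msupp f `|` msupp g)%fset.
have dcf : (msupp (c *: f + g) `<=` d)%fset.
  apply: fsubset_trans (msuppD_le _ _) _; apply: fsetSU; exact: msuppZ_le.
rewrite (evalEw dcf) (@evalEw d f) ?fsubsetUl // (@evalEw d g) ?fsubsetUr //.
rewrite scaler_sumr -big_split /=; apply: eq_bigr => p _.
by rewrite mcoeffD mcoeffZ scalerDl scalerA.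
Qed.

HB.instance Definition _ := GRing.isLinear.Build K (path_alg K Q) A *:%R eval eval_linear.

Lemma evalD (f g : path_alg K Q) : eval (f + g) = eval f + eval g. Proof. exact: raddfD. Qed.
Lemma evalZ c (f : path_alg K Q) : eval (c *: f) = c *: eval f. Proof. exact: linearZ. Qed.

Lemma eval_path p : eval (path_elt K p) = path_val p.
Proof. by rewrite /eval msuppU oner_eq0 big_seq_fset1 mcoeffUU scale1r. Qed.

Lemma path_alg_ind (P : path_alg K Q -> Prop) :
  P 0 -> (forall f g : path_alg K Q, P f -> P g -> P (f + g)) ->
  (forall c (f : path_alg K Q), P f -> P (c *: f)) -> (forall p, P (path_elt K p)) -> forall f, P f.
Proof. exact: malg_ind. Qed.

Lemma path_scaleAl c (f g : path_alg K Q) : (c *: f) * g = c *: (f * g).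
Proof. by rewrite -[RHS]/(c *: malg_mul (@path_cat Q) f g) malg_scaleAl. Qed.

Lemma path_scaleAr c (f g : path_alg K Q) : f * (c *: g) = c *: (f * g).
Proof. by rewrite -[RHS]/(c *: malg_mul (@path_cat Q) f g) malg_scaleAr. Qed.

Lemma eval_monoid : monoid_morphism eval.
Proof.
split=> [|f g].
  rewrite [1]/(path_alg_one K Q) raddf_sum /= -[RHS](idem_sum D).
  apply: eq_bigr => v _; rewrite eval_path /path_val big_nil mulr1; by [].
elim/path_alg_ind: f => [|f f' Hf Hf'|c f Hf|p].
- by rewrite mul0r raddf0 mul0r.
- by rewrite mulrDl !evalD mulrDl Hf Hf'.
- apply: etrans (congr1 eval (path_scaleAl c f g)) _.
  apply: etrans (evalZ c (f * g)) _; apply: etrans (congr1 ( *:%R c) Hf) _.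
  by apply: etrans (scalerAl _ _ _) _; congr (_ * _); apply/esym/evalZ.
elim/path_alg_ind: g => [|g g' Hg Hg'|c g Hg|q].
- by rewrite mulr0 raddf0 mulr0.
- by rewrite mulrDr !evalD mulrDr Hg Hg'.
- apply: etrans (congr1 eval (path_scaleAr c _ g)) _.
  apply: etrans (evalZ c (_ * g)) _; apply: etrans (congr1 ( *:%R c) Hg) _.
  by apply: etrans (scalerAr _ _ _) _; congr (_ * _); apply/esym/evalZ.
apply: etrans (congr1 eval (path_elt_mul K p q)) _.
apply: etrans (_ : _ = path_val p * path_val q) _.
  rewrite path_val_cat; case: path_cat => [r|] /=; [exact: eval_path|exact: raddf0].
by congr (_ * _); apply/esym/eval_path.
Qed.

HB.instance Definition _ := GRing.isMonoidMorphism.Build (path_alg K Q) A eval eval_monoid.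

Definition eval_ker : ideal (path_alg K Q).
Proof.
refine (@Ideal _ [pred f | eval f == 0] _ _ _ _).
- split=> [|f g]; rewrite !inE ?raddf0 // => /eqP f0 /eqP g0.
  by rewrite raddfB /= f0 g0 subrr.
- by move=> a f; rewrite !inE rmorphM /= => /eqP ->; rewrite mulr0.
- by move=> a f; rewrite !inE rmorphM /= => /eqP ->; rewrite mul0r.
by rewrite inE rmorph1 oner_eq0.
Defined.

Lemma eval_kerP f : (f \in ideal_pred eval_ker) = (eval f == 0).
Proof. by []. Qed.

Lemma path_length0 (p : qpath Q) : path_length p = 0%N -> p = stationary (path_src p).
Proof.
move=> /size0nil E; apply: val_inj; rewrite /= [LHS]surjective_pairing.
by rewrite -[(val p).2]/(path_arrows p) E.
Qed.

Lemma path_length1 (p : qpath Q) : path_length p = 1%N ->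
  exists2 a, p = arrow_path a & path_val p = arrow_val a.
Proof.
rewrite /path_length; case: p => [[v s] ws] /=; rewrite /path_arrows /=.
case: s ws => [|a [|b s]] //= ws _; exists a.
  by apply: val_inj => /=; case/andP: (ws) => /eqP ->.
case/andP: (ws) => /eqP E _.
by rewrite /path_val /path_arrows /path_src /= big_seq1 -E e_arr.
Qed.

(** A functional that sees only the path p reads off its coefficient. Characters serve for
    stationary paths and [tcoef] for arrows, which forces relations into the span of the paths of
    length at least 2. *)
Lemma path_val_coef (l : A -> K) f p : (forall c x y, l (c *: x + y) = c * l x + l y) ->
  l (path_val p) = 1 -> (forall q, q != p -> l (path_val q) = 0) -> eval f = 0 -> f@_p = 0.
Proof.
move=> ll lp lq f0.
have l0 : l 0 = 0.
  by apply: (@addrI _ (1 * l 0)); rewrite -ll scaler0 !addr0 mul1r.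
have : l (eval f) = f@_p.
  have E (s : seq (qpath Q)) : l (\sum_(q <- s) f@_q *: path_val q) =
      \sum_(q <- s) f@_q * l (path_val q).
    by elim: s => [|q s IH]; rewrite ?big_nil // !big_cons ll IH.
  have [pf|pf] := boolP (p \in msupp f).
    rewrite /eval E (big_fsetD1 p) //= lp mulr1 big_seq big1 ?addr0 // => q.
    by rewrite in_fsetD1 => /andP[qp _]; rewrite lq ?mulr0.
  rewrite (mcoeff_outdom pf) /eval E big_seq big1 // => q qf.
  by rewrite lq ?mulr0 //; apply: contraNneq pf => <-.
by rewrite f0 l0.
Qed.

Lemma eval_ker_admissible : admissible eval_ker.
Proof.
split.
  move=> f; rewrite eval_kerP => /eqP f0 p pf; rewrite leqNgt; apply/negP => lt2.
  have fp : f@_p != 0 by rewrite mcoeff_neq0.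
  case/eqP: fp.
  have [l0|l0] := eqVneq (path_length p) 0%N.
    apply: (@path_val_coef (chi (path_src p))) f0.
    - by move=> c x y; rewrite linearP.
    - rewrite /path_val (_ : path_arrows p = [::]); last exact: size0nil.
      by rewrite big_nil mulr1 chi_idem eqxx.
    move=> q qp; have [l0'|l0'] := eqVneq (path_length q) 0%N.
      rewrite /path_val (_ : path_arrows q = [::]); last exact: size0nil.
      rewrite big_nil mulr1 chi_idem; case: eqP => // E; case/eqP: qp.
      by rewrite (path_length0 l0) (path_length0 l0') E.
    apply: jac0; rewrite jac_R1; apply: radpW (path_val_radp q).
    by rewrite lt0n.
  have l1 : path_length p = 1%N by apply/eqP; rewrite eqn_leq lt0n l0 andbT -ltnS.
  have [a pa va] := path_length1 l1.
  apply: (@path_val_coef (t (src a) (tgt a))) f0.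
  - by move=> c x y; rewrite linearP.
  - by rewrite va tcoef_arr1 //; apply: arrow_val_neq0.
  move=> q qp; have [l0'|l0'] := eqVneq (path_length q) 0%N.
    rewrite /path_val (_ : path_arrows q = [::]); last exact: size0nil.
    by rewrite big_nil mulr1 tcoef_idem.
  have [l1'|l1'] := eqVneq (path_length q) 1%N.
    have [b qb vb] := path_length1 l1'; rewrite vb tcoef_arr.
    case: eqP => //= E1; case: eqP => //= E2; case/eqP: qp.
    by rewrite qb pa (arrow_ext E1 E2).
  apply: tcoef_R2; apply: radpW (path_val_radp q).
  by case: (path_length q) l0' l1' => [|[|]].
(* Admissibility asks for an exponent of at least 2, while the nilpotency index may be 1. *)
exists (maxn 2 (nilindex D)); first exact: leq_maxl.
move=> f fm; rewrite eval_kerP /eval big_seq big1 // => p pf.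
have := radpW (leq_trans (leq_maxr 2 (nilindex D)) (fm p pf)) (path_val_radp p).
by rewrite radp_nil memv0 => /eqP ->; rewrite scaler0.
Qed.

Lemma eval_arrow a : eval (arrow_elt K a) = arrow_val a.
Proof.
by rewrite eval_path /path_val /path_arrows /path_src /= big_seq1 e_arr.
Qed.

Lemma eval_surj a : exists f, eval f = a.
Proof.
have [W WP] : {W : {vspace A} | forall a, a \in W <-> exists f, eval f = a}.
  apply: subspace_of_pred => [|c x y [f <-] [g <-]]; first by exists 0; rewrite raddf0.
  by exists (c *: f + g); rewrite linearP.
have WM x y : x \in W -> y \in W -> x * y \in W.
  by move=> /WP[f <-] /WP[g <-]; apply/WP; exists (f * g); rewrite rmorphM.
have We i : e i \in W.
  apply/WP; exists (path_elt K (@stationary Q i)).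
  by rewrite eval_path /path_val big_nil mulr1.
have Wa i j : arr i j \in W.
  have [->|r] := eqVneq (arr i j) 0; first exact: mem0v.
  by apply/WP; exists (arrow_elt K (Sub (i, j) r : arrow Q)); rewrite eval_arrow.
(* The arrows span J modulo J^2. An element of J^2 is a sum of products, and replacing both factors
   by their approximations improves the error by one power of J. *)
have key k x : x \in J -> x \in (W + R k.+2)%VS.
  elim: k x => [|k IH] x Jx; last first.
    have step r : r \in R 2 -> r \in (W + R k.+3)%VS.
      move: r; apply/subvP; apply: radp_subv => y z; rewrite -jac_R1 => Jy Jz.
      have /memv_addP[w Ww [s Rs yE]] := IH y Jy.
      have /memv_addP[w' Ww' [s' Rs' zE]] := IH z Jz.
      have Jw : w \in J.
        have -> : w = y - s by rewrite yE addrK.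
        by rewrite memvB // jac_R1; apply: radpW Rs.
      rewrite {1}yE mulrDl {1}zE mulrDr -addrA; apply: memv_add; first exact: WM.
      by apply: memvD; [apply: mem_radpSl|apply: mem_radpS].
    have /memv_addP[w Ww [s Rs xE]] : x \in (W + R 2)%VS.
      have /memv_addP[w Ww [s Rs ->]] := IH x Jx.
      by apply: memv_add => //; apply: radpW Rs.
    have /memv_addP[w' Ww' [s' Rs' sE]] := step s Rs.
    by rewrite xE sE addrA; apply: memv_add => //; apply: memvD.
  have -> : x = \sum_i \sum_j (t i j x *: arr i j + (e i * x * e j - t i j x *: arr i j)).
    rewrite -[LHS]mul1r -(idem_sum D) mulr_suml; apply: eq_bigr => i _.
    rewrite -[LHS]mulr1 -(idem_sum D) mulr_sumr; apply: eq_bigr => j _.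
    by rewrite addrC subrK.
  apply: memv_suml => i _; apply: memv_suml => j _.
  by apply: memv_add; [apply: memvZ|apply: tcoef_jac].
apply/WP; rewrite (jpartE D a) memvD //.
  by apply: memv_suml => i _; apply: memvZ.
have := key (nilindex D) _ (jpartP D a).
rewrite (_ : R (nilindex D).+2 = 0%VS) ?addv0 //.
apply/eqP; rewrite -subv0 -(radp_nil D); apply/subvP => y; apply: radpW.
by rewrite -addn2 leq_addr.
Qed.

Definition eval_quot (x : quot_alg eval_ker) : A := eval (repr x).

Lemma eval_quot_pi f : eval_quot (quot_pi eval_ker f) = eval f.
Proof.
have := quot_repr_pi eval_ker f; rewrite eval_kerP raddfB /= subr_eq0.
by move/eqP.
Qed.

Lemma eval_quot_linear : linear eval_quot.
Proof.
move=> c x y; rewrite -[x]quot_reprK -[y]quot_reprK.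
rewrite [c *: _](_ : _ = quot_pi eval_ker (c *: repr x)); last by rewrite quot_piZ.
by rewrite -quot_piD !eval_quot_pi linearP.
Qed.

Lemma eval_quot_monoid : monoid_morphism eval_quot.
Proof.
split=> [|x y]; first by rewrite [1]/(quot_pi eval_ker 1) eval_quot_pi rmorph1.
rewrite -[x]quot_reprK -[y]quot_reprK.
rewrite [_ * _](_ : _ = quot_pi eval_ker (repr x * repr y)); last by rewrite quot_piM.
by rewrite !eval_quot_pi rmorphM.
Qed.

Lemma eval_quot_bij : bijective eval_quot.
Proof.
have surj a : exists x, eval_quot x = a.
  by have [f <-] := eval_surj a; exists (quot_pi eval_ker f); rewrite eval_quot_pi.
exists (fun a => sval (cid (surj a))) => [x|a]; last by case: (cid (surj a)).
case: cid => y /= E; rewrite -[y]quot_reprK -[x]quot_reprK; apply/quot_piP.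
by rewrite eval_kerP raddfB /= subr_eq0; apply/eqP.
Qed.

Lemma arrow_mul_composable (a b : arrow Q) : arrow_val a * arrow_val b != 0 -> tgt a = src b.
Proof.
move=> h; apply: contrapT => /eqP ab; case/eqP: h.
rewrite /arrow_val -(arr_e (src a)) -(e_arr (src b)) mulrA -[_ * _ * e (src b)]mulrA idem_mul.
by rewrite (negbTE ab) mulr0 mul0r.
Qed.

Lemma eval_ker_special_biserial : special_biserial_pair eval_ker.
Proof.
have memE (a b : arrow Q) : arrow_elt K a * arrow_elt K b \notin ideal_pred eval_ker ->
    arrow_val a * arrow_val b != 0.
  rewrite eval_kerP (_ : eval _ = arrow_val a * arrow_val b) //.
  by apply: etrans (eval_monoid.2 _ _) _; congr (_ * _); apply: eval_arrow.
split.
- move=> v; rewrite leqNgt; apply/negP => /card_gt2P[a [b [c [[]]]]].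
  rewrite !inE => /eqP av /eqP bv /eqP cv [ab bc ca].
  have r x : src x = v -> arr v (tgt x) != 0 by move=> <-; apply: arrow_val_neq0.
  have ne x y : src x = v -> src y = v -> x != y -> tgt x != tgt y.
    by move=> xv yv; apply: contraNneq => E; rewrite (arrow_ext _ E) // xv yv.
  apply: (outdegree nak (ne _ _ av bv ab) _ (ne _ _ bv cv bc) (r _ av) (r _ bv) (r _ cv)).
  by rewrite eq_sym ne.
- move=> v; rewrite leqNgt; apply/negP => /card_gt2P[a [b [c [[]]]]].
  rewrite !inE => /eqP av /eqP bv /eqP cv [ab bc ca].
  have r x : tgt x = v -> arr (src x) v != 0 by move=> <-; apply: arrow_val_neq0.
  have ne x y : tgt x = v -> tgt y = v -> x != y -> src x != src y.
    by move=> xv yv; apply: contraNneq => E; rewrite (arrow_ext E) // xv yv.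
  apply: (indegree nak (ne _ _ av bv ab) _ (ne _ _ bv cv bc) (r _ av) (r _ bv) (r _ cv)).
  by rewrite eq_sym ne.
- move=> a b b' /memE h /memE h'.
  have E := arrow_mul_composable h; have E' := arrow_mul_composable h'.
  apply: arrow_ext; first by rewrite -E -E'.
  apply: contrapT => /eqP ne; move: h h'; rewrite /arrow_val -E -E' => h h'.
  by case: (no_branch nak (src a) (tgt a) ne) => z; rewrite z eqxx in h h'.
move=> a c c' /memE h /memE h'.
have E := arrow_mul_composable h; have E' := arrow_mul_composable h'.
apply: arrow_ext; last by rewrite E E'.
apply: contrapT => /eqP ne; move: h h'; rewrite /arrow_val E' -E => h h'.
by case: (no_merge nak (tgt c) (tgt a) ne) => z; [rewrite z eqxx in h|rewrite z eqxx in h'].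
Qed.

Lemma nakayama3_special_biserial : special_biserial A.
Proof.
pose f : {lrmorphism quot_alg eval_ker -> A} := HB.pack eval_quot
  (GRing.isLinear.Build K (quot_alg eval_ker) A *:%R _ eval_quot_linear)
  (GRing.isMonoidMorphism.Build _ _ _ eval_quot_monoid).
exists Q, eval_ker; split; [exact: eval_ker_admissible|exact: eval_ker_special_biserial|].
by exists f; apply: eval_quot_bij.
Qed.

End Presentation.

(** * Classification of the indecomposable modules *)

(** Equal relations make the map p a + q b to p' a + q' b well defined in both directions. A local
    module is covered by taking 0 as the second generator. *)
Lemma iso_of_relations (K : fieldType) (A : falgType K) (M M' : rmodule A)
    (p q : M) (p' q' : M') :
  (forall y, exists a b, y = ract p a + ract q b) ->
  (forall y, exists a b, y = ract p' a + ract q' b) ->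
  (forall a b, ract p a + ract q b = 0 <-> ract p' a + ract q' b = 0) ->
  rm_iso M M'.
Proof.
move=> gen gen' rel.
have ex (N N' : rmodule A) (x y : N) (x' y' : N') :
    (forall z, exists a b, z = ract x a + ract y b) ->
    (forall a b, ract x a + ract y b = 0 -> ract x' a + ract y' b = 0) ->
    exists f : N -> N', forall a b, f (ract x a + ract y b) = ract x' a + ract y' b.
  move=> g r.
  have /choice[f fP] : forall z, exists w, exists a b,
      z = ract x a + ract y b /\ w = ract x' a + ract y' b.
    by move=> z; have [a [b zE]] := g z; exists (ract x' a + ract y' b), a, b.
  exists f => a b; have [a' [b' [zE ->]]] := fP (ract x a + ract y b).
  apply/eqP; rewrite -subr_eq0; apply/eqP.
  rewrite opprD addrACA -!ractBr; apply: r.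
  by rewrite !ractBr addrACA -opprD -zE subrr.
have [f fE] := ex _ _ _ _ _ _ gen (fun a b => proj1 (rel a b)).
have [g gE] := ex _ _ _ _ _ _ gen' (fun a b => proj2 (rel a b)).
have flin : linear f.
  move=> c x y; have [a [b ->]] := gen x; have [a' [b' ->]] := gen y.
  rewrite scalerDr -!ractZr addrACA -!ractDr !fE !ractDr !ractZr scalerDr.
  by rewrite addrACA.
pose f' : {linear M -> M'} := HB.pack f (GRing.isLinear.Build K M M' *:%R f flin).
exists f'.
  exists g => x; first by have [a [b ->]] := gen x; rewrite /= fE gE.
  by have [a [b ->]] := gen' x; rewrite /= gE fE.
move=> x a; have [b [c ->]] := gen x.
by rewrite /= fE !ractDl -!ractM fE.
Qed.

Section FiniteType.
Variables (K : fieldType) (A : falgType K) (D : split_data A).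
Hypothesis nak : right_nakayama A 3.
Local Notation e := (@idem _ _ D).
Local Notation chi := (@chi _ _ D).
Local Notation J := (jac D).
Local Notation R := (radp D).
Local Notation I := 'I_(nvert D).
Local Notation arr := (@arr _ _ D).
Local Notation t := (tcoef nak).

Lemma ract_idem_off (M : rmodule A) (x : M) v k : ract x (e v) = x -> k != v -> ract x (e k) = 0.
Proof. by move=> <- kv; rewrite -ractM idem_mul eq_sym (negbTE kv) ract0r. Qed.

Lemma ract_local (M : rmodule A) (x : M) v a : ract x (e v) = x ->
  ract x a = chi v a *: x + ract x (jpart D a).
Proof.
move=> xe; rewrite (ract_split D) (bigD1 v) //= xe big1 ?addr0 // => k kv.
by rewrite (ract_idem_off xe kv) scaler0.
Qed.

Lemma ract_jac_unit (M : rmodule A) (x : M) y : y \in J -> x = ract x y -> x = 0.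
Proof.
move=> Jy xE; have [z zE] := jac_inv Jy.
by rewrite -[x]ract1 -zE ractM ractBr ract1 -xE subrr ract0l.
Qed.

Section Radical.
Variable M : rmodule A.

(** The subspace M J, as the smallest one that contains all x j. *)
Definition mrad : {vspace M} :=
  sval (family_cap (fun U : {vspace M} => forall x j, j \in J -> ract x j \in U)).

Lemma mradP y : y \in mrad <->
  forall U : {vspace M}, (forall x j, j \in J -> ract x j \in U) -> y \in U.
Proof. exact: (svalP (family_cap _)). Qed.

Lemma mrad_jac x j : j \in J -> ract x j \in mrad.
Proof. by move=> Jj; apply/mradP => U; apply. Qed.

Lemma mrad_stable : stable mrad.
Proof.
move=> y a /mradP h; apply/mradP => U UP.
have [W WP] : {W : {vspace M} | forall z, z \in W <-> ract z a \in U}.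
  apply: subspace_of_pred => [|c x z Ux Uz]; first by rewrite ract0l mem0v.
  by rewrite ractDl ractZl memvD ?memvZ.
apply/WP/h => x j Jj; apply/WP; rewrite -ractM; apply: UP; exact: jac_mulr.
Qed.

(** Nakayama's lemma. A subspace containing N and M J^(k+1) contains M J^k, because M = N + M J;
    going down to k = 0 it is all of M. For k the nilpotency index this applies to N. *)
Lemma mrad_nakayama (N : {vspace M}) : stable N -> (N + mrad = fullv)%VS -> N = fullv.
Proof.
move=> sN NR.
have key k : forall U : {vspace M}, (N <= U)%VS ->
    (forall x a, a \in R k -> ract x a \in U) -> U = fullv.
  elim: k => [|k IH] U NU UP.
    apply/eqP; rewrite eqEsubv subvf /=; apply/subvP => x _.
    by rewrite -[x]ract1; apply: UP; apply: memvf.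
  apply: IH => // y b Rb.
  have [W WP] : {W : {vspace M} | forall z, z \in W <-> forall b, b \in R k -> ract z b \in U}.
    apply: subspace_of_pred => [b' _|c x z Ux Uz b' Rb']; first by rewrite ract0l mem0v.
    by rewrite ractDl ractZl memvD ?memvZ ?Ux ?Uz.
  suff /subvP/(_ y (memvf y))/WP : (fullv <= W)%VS by apply.
  rewrite -NR subv_add; apply/andP; split; apply/subvP => z.
    by move=> Nz; apply/WP => b' _; apply: (subvP NU); apply: sN.
  move/mradP; apply=> x j Jj; apply/WP => b' Rb'.
  by rewrite -ractM; apply: UP; apply: mem_radpSl.
apply: (key (nilindex D)) => // x a; rewrite radp_nil memv0 => /eqP ->.
by rewrite ract0r mem0v.
Qed.

Lemma add_line_stable (p : M) v (N : {vspace M}) : ract p (e v) = p -> (mrad <= N)%VS ->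
  stable N -> stable (N + <[p]>)%VS.
Proof.
move=> pe RN sN y a /memv_addP[n Nn [_ /vlineP[c ->] ->]].
rewrite ractDl ractZl (ract_local a pe) memvD ?memvZ //.
  by apply: (subvP (addvSl _ _)); apply: sN.
apply: memvD; last by apply: (subvP (addvSl _ _)); apply: (subvP RN); apply/mrad_jac/jpartP.
by apply: (subvP (addvSr _ _)); rewrite memvZ // memv_line.
Qed.

Lemma rad_mrad : (radn M 1 <= mrad)%VS.
Proof. by apply: (rad_space_sub (D := D) mrad_stable) => y j _ Jj; apply: mrad_jac. Qed.

(** The line of x is stable because J kills x, and [hyperplane] provides a submodule that
    complements it. *)
Lemma simple_summand v (x : M) : indecomposable M -> ract x (e v) = x -> x \notin mrad ->
  (forall j, j \in J -> ract x j = 0) -> (fullv = <[x]> :> {vspace M})%VS.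
Proof.
move=> [_ ind] xe nx xJ.
have sF : stable (fullv : {vspace M}) by move=> ? ? _; rewrite memvf.
have [H [[sH _ _ _] _ nHx HF]] := hyperplane sF mrad_stable (fun y j _ Jj => mrad_jac y Jj)
  (memvf x) xe nx.
have sx : stable <[x]>%VS.
  move=> y a /vlineP[c ->]; rewrite ractZl (ract_local a xe) xJ ?addr0 ?jpartP //.
  by rewrite !memvZ // memv_line.
have HF' : (H + <[x]>)%VS = fullv by apply/eqP; rewrite eqEsubv subvf HF.
have Hx0 : (H :&: <[x]>)%VS = 0%VS.
  apply/eqP; rewrite -subv0; apply/subvP => y; rewrite memv_cap => /andP[Hy /vlineP[c yE]].
  have [c0|c0] := eqVneq c 0; first by rewrite yE c0 scale0r mem0v.
  by case/negP: nHx; rewrite -[x]scale1r -(mulVf c0) -scalerA -yE memvZ.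
have [/= H0|/= x0] := ind (Submodule sH) (Submodule sx) HF' Hx0.
  by rewrite -HF' H0 add0v.
case/negP: nx; have : x \in <[x]>%VS by apply: memv_line.
by rewrite x0 memv0 => /eqP ->; rewrite mem0v.
Qed.

Definition local_gen v (p : M) := ract p (e v) = p /\ forall y, exists a, y = ract p a.

(* p and q span the top, at the vertices v and v', and the arrows from v and v'
   to w send both of them to the same generator of the simple socle. *)
Definition peak_gen v v' w (p q : M) :=
  (forall y, exists a b, y = ract p a + ract q b) /\
  forall a b, ract p a + ract q b = 0 <->
    [/\ chi v a = 0, chi v' b = 0 & t v w a + t v' w b = 0].

Lemma generator_line v (p : M) : ract p (e v) = p -> (<[p]> + mrad = fullv)%VS ->
  local_gen v p.
Proof.
move=> pe pR; split=> //.
have [W WP] : {W : {vspace M} | forall y, y \in W <-> exists a, y = ract p a}.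
  apply: subspace_of_pred => [|c x y [a ->] [b ->]]; first by exists 0; rewrite ract0r.
  by exists (c *: a + b); rewrite ractDr ractZr.
have sW : stable W by move=> y a /WP[b ->]; apply/WP; exists (b * a); rewrite ractM.
move=> y; apply/WP; rewrite (mrad_nakayama sW) ?memvf //.
apply/eqP; rewrite eqEsubv subvf -pR subv_add addvSr andbT -memvE.
by apply: (subvP (addvSl _ _)); apply/WP; exists 1; rewrite ract1.
Qed.

(** If the top is not a line, the dimension is at most 3. A top vector killed by J would split off
    by [simple_summand], so M J is a nonzero line at some vertex w. Every vector outside M J that
    sits at one vertex is then sent by the arrow to w to a nonzero multiple of the generator s of
    this line. *)
Lemma indecomposable_cases : indecomposable M ->
  (exists v p, p != 0 /\ local_gen v p) \/ (exists v v' w p q, peak_gen v v' w p q).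
Proof.
move=> ind.
have [x nx] : exists x, x \notin mrad.
  apply: contrapT => nx; case: ind => n0 _; apply: n0.
  apply/esym/mrad_nakayama; first by move=> y a; rewrite !memv0 => /eqP ->; rewrite ract0l.
  rewrite add0v; apply/eqP; rewrite eqEsubv subvf /=; apply/subvP => y _.
  by apply: contrapT => /negP ny; apply: nx; exists y.
have [v np] := exists_component D nx.
set p := ract x (e v) in np.
have pe : ract p (e v) = p by rewrite -ractM idem_diag.
have p0 : p != 0 by apply: contraNneq np => ->; rewrite mem0v.
have [pR|pR] := eqVneq (<[p]> + mrad)%VS fullv.
  by left; exists v, p; split=> //; apply: generator_line.
right.
pose N := (mrad + <[p]>)%VS.
have sN : stable N by apply: add_line_stable pe _ mrad_stable; apply: subvv.
have [y nNy] : exists y, y \notin N.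
  apply: contrapT => ny; case/eqP: pR; apply/eqP; rewrite addvC eqEsubv subvf /=.
  apply/subvP => y _; by apply: contrapT => /negP ?; apply: ny; exists y.
have [v' nq] := exists_component D nNy.
set q := ract y (e v') in nq.
have qe : ract q (e v') = q by rewrite -ractM idem_diag.
have nqR : q \notin mrad by apply: contra nq; apply: (subvP (addvSl _ _)).
have npq : p \notin (mrad + <[q]>)%VS.
  apply/negP => /memv_addP[r Rr [_ /vlineP[c ->] pE]].
  have [c0|c0] := eqVneq c 0; first by rewrite pE c0 scale0r addr0 Rr in np.
  case/negP: nq; have -> : q = c^-1 *: (p - r) by rewrite pE addrC addKr scalerA mulVf // scale1r.
  rewrite memvZ // memvB //; first by apply: (subvP (addvSr _ _)); apply: memv_line.
  exact: (subvP (addvSl _ _)).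
have sN' : stable (mrad + <[q]>)%VS by apply: add_line_stable qe _ mrad_stable; apply: subvv.
have le3 : (\dim {:M} <= 1 + 2)%N.
  apply: (nakayama3_dim (k := 1) D nak ind isT sN sN').
  - apply/negP => /subvP h; case/negP: npq; apply: h.
    by apply: (subvP (addvSr _ _)); apply: memv_line.
  - apply/negP => /subvP h; case/negP: nq; apply: h.
    by apply: (subvP (addvSr _ _)); apply: memv_line.
  - exact: subv_trans rad_mrad (addvSl _ _).
  - exact: subv_trans rad_mrad (addvSl _ _).
have d1 := dimv_add_line np; have d2 := dimv_add_line nq.
have dR : (\dim mrad <= 1)%N.
  have := leq_trans (dimvS (subvf (N + <[q]>)%VS)) le3.
  by rewrite d2 d1.
have nJ u (z : M) : ract z (e u) = z -> z \notin mrad -> exists2 j, j \in J & ract z j != 0.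
  move=> ze nz; apply: contrapT => nj.
  have zJ j : j \in J -> ract z j = 0.
    by move=> Jj; apply: contrapT => /eqP zj; apply: nj; exists j.
  have F := simple_summand ind ze nz zJ.
  have : p \in <[z]>%VS by rewrite -F memvf.
  have : q \in <[z]>%VS by rewrite -F memvf.
  move=> /vlineP[c qE] /vlineP[d pE].
  have d0 : d != 0 by apply: contraNneq p0 => d0; rewrite pE d0 scale0r.
  case/negP: nq; have -> : q = (c / d) *: p by rewrite qE pE scalerA mulfVK.
  by rewrite memvZ // (subvP (addvSr _ _)) // memv_line.
have [j0 Jj0 s00] := nJ v p pe np.
set s0 := ract p j0 in s00.
have n0 : s0 \notin (0%VS : {vspace M}) by rewrite memv0.
have s0st : stable (0%VS : {vspace M}) by move=> z a; rewrite !memv0 => /eqP ->; rewrite ract0l.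
have [w nw] := exists_component D n0.
set s := ract s0 (e w) in nw.
have sn0 : s != 0 by rewrite -memv0.
have se : ract s (e w) = s by rewrite -ractM idem_diag.
have Rs : s \in mrad by apply: mrad_stable; apply: mrad_jac.
have RE : mrad = <[s]>%VS.
  apply/esym/eqP; rewrite eqEdim -memvE Rs /= dim_vline sn0; exact: dR.
have sJ j : j \in J -> ract s j = 0.
  move=> Jj; have /vlineP[c sE] : ract s j \in <[s]>%VS by rewrite -RE mrad_jac.
  have [c0|c0] := eqVneq c 0; first by rewrite sE c0 scale0r.
  case/eqP: sn0; apply: (@ract_jac_unit _ _ (c^-1 *: j)); first by rewrite memvZ.
  by rewrite ractZr sE scalerA mulVf // scale1r.
have R2z (z : M) r : r \in R 2 -> ract z r = 0.
  have [W WP] : {W : {vspace A} | forall r, r \in W <-> ract z r = 0}.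
    apply: subspace_of_pred => [|c a b a0 b0]; first exact: ract0r.
    by rewrite ractDr ractZr a0 b0 scaler0 addr0.
  move=> Rr; apply/WP; move: r Rr; apply/subvP; apply: radp_subv => a b; rewrite -jac_R1 => Ja Jb.
  have /vlineP[c zE] : ract z a \in <[s]>%VS by rewrite -RE mrad_jac.
  by apply/WP; rewrite ractM zE ractZl sJ // scaler0.
have act u (z : M) j : ract z (e u) = z -> j \in J -> ract z j = t u w j *: ract z (arr u w).
  move=> ze Jj.
  have /vlineP[c zE] : ract z j \in <[s]>%VS by rewrite -RE mrad_jac.
  have E : ract z (e u * j * e w) = ract z j by rewrite !ractM ze zE ractZl se.
  rewrite -E -ractZr; apply/eqP; rewrite -subr_eq0 -ractBr; apply/eqP/R2z.
  exact: tcoef_jac.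
have narr u (z : M) : ract z (e u) = z -> z \notin mrad ->
    exists2 c, c != 0 & ract z (arr u w) = c *: s.
  move=> ze nz; have [j Jj zj] := nJ u z ze nz.
  have /vlineP[c zE] : ract z (arr u w) \in <[s]>%VS by rewrite -RE mrad_jac ?arr_J.
  exists c => //; apply: contraNneq zj => c0.
  by rewrite (act u) // zE c0 scale0r scaler0.
have [c c0 cE] := narr v p pe np.
have [d d0 dE] := narr v' q qe nqR.
(* With equal vertices, d p - c q would lie outside M J and be killed by the arrow to w. *)
have vv' : v != v'.
  apply/eqP => E; pose z := d *: p - c *: q.
  have ze : ract z (e v) = z by rewrite /z ractDl -scaleNr !ractZl pe E qe.
  have nz : z \notin mrad.
    apply/negP => Rz; case/negP: nq.
    have -> : q = c^-1 *: (d *: p - z) by rewrite /z subKr scalerA mulVf // scale1r.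
    rewrite memvZ // memvB //; last exact: (subvP (addvSl _ _)).
    by rewrite memvZ // (subvP (addvSr _ _)) // memv_line.
  have [c' c'0] := narr v z ze nz.
  rewrite /z ractDl -scaleNr !ractZl cE E dE !scalerA -scalerDl mulNr mulrC subrr scale0r.
  by move/esym/eqP; rewrite scaler_eq0 (negbTE c'0) (negbTE sn0).
(* Rescaling q makes both arrows hit the same vector, which leaves the three vertices as the only
   data. *)
pose s' := c *: s; pose q' := (c / d) *: q.
have s'0 : s' != 0 by rewrite scaler_eq0 negb_or c0.
have cd0 : c / d != 0 by rewrite mulf_neq0 ?invr_neq0.
have q'e : ract q' (e v') = q' by rewrite ractZl qe.
have q's : ract q' (arr v' w) = s' by rewrite ractZl dE scalerA divfK.
have full (z : M) (u : I) a : ract z (e u) = z -> ract z (arr u w) = s' ->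
    ract z a = chi u a *: z + t u w a *: s'.
  move=> ze zs; rewrite (ract_local a ze) (act u) ?jpartP // zs; congr (_ + _ *: _).
  rewrite /jpart linearB /= linear_sum /= big1 ?subr0 // => k _.
  by rewrite linearZ /= tcoef_idem mulr0.
exists v, v', w, p, q'; split=> [z|a b].
  have F : (N + <[q]> = fullv)%VS.
    apply/eqP; rewrite eqEdim subvf d2 d1; apply: leq_trans le3 _.
    by rewrite RE dim_vline sn0.
  have : z \in (N + <[q]>)%VS by rewrite F memvf.
  move=> /memv_addP[_ /memv_addP[r Rr [_ /vlineP[x1 ->] ->]] [_ /vlineP[x2 ->] ->]].
  move: Rr; rewrite RE => /vlineP[x3 ->].
  exists ((x3 / c) *: arr v w + x1 *: 1), ((x2 / (c / d)) *: 1).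
  rewrite ractDr !ractZr !ract1 cE !scalerA; congr (_ *: _ + _ + _ *: _).
    by rewrite divfK.
  by rewrite divfK.
have pf := full p v a pe cE; have qf := full q' v' b q'e q's.
split; last first.
  by case=> a0 b0 tt; rewrite pf qf a0 b0 !scale0r !add0r -scalerDl tt scale0r.
rewrite pf qf addrACA -scalerDl => E.
have a0 : chi v a = 0.
  apply/eqP; apply: contraT => a0; case/negP: npq.
  have -> : p = - (chi v a)^-1 *: (chi v' b *: q' + (t v w a + t v' w b) *: s').
    have -> : chi v' b *: q' + (t v w a + t v' w b) *: s' = - (chi v a *: p).
      by apply/eqP; rewrite -addr_eq0 addrC addrA E.
    by rewrite scaleNr scalerN opprK scalerA mulVf // scale1r.
  rewrite memvZ // addrC; apply: memv_add; first by rewrite memvZ // RE memvZ // memv_line.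
  by rewrite !memvZ // memv_line.
have b0 : chi v' b = 0.
  apply/eqP; apply: contraT => b0; case/negP: nqR; rewrite RE.
  have h : chi v' b *: q' = - ((t v w a + t v' w b) *: s').
    by apply/eqP; rewrite -addr_eq0 -E a0 scale0r add0r.
  have -> : q = (c / d)^-1 *: ((chi v' b)^-1 *: (chi v' b *: q')).
    by rewrite [(chi v' b)^-1 *: _]scalerA mulVf // scale1r /q' scalerA mulVf // scale1r.
  by rewrite h !memvZ // memvN !memvZ // memv_line.
split=> //; move: E; rewrite a0 b0 !scale0r !add0r => /eqP.
by rewrite scaler_eq0 (negbTE s'0) orbF => /eqP.
Qed.

End Radical.
End FiniteType.

(** * Normal forms of local modules and finitely many codes *)

Section LocalModules.
Variables (K : fieldType) (A : falgType K) (D : split_data A).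
Hypothesis nak : right_nakayama A 3.
Local Notation e := (@idem _ _ D).
Local Notation chi := (@chi _ _ D).
Local Notation J := (jac D).
Local Notation R := (radp D).
Local Notation I := 'I_(nvert D).
Local Notation arr := (@arr _ _ D).
Local Notation t := (tcoef nak).

Definition branching v := exists w w', [/\ w != w', arr v w != 0 & arr v w' != 0].

(** The part of e_v a in J^2 that is left after removing idempotent and arrows. *)
Definition rem v a : A := e v * a - chi v a *: e v - \sum_w t v w a *: arr v w.

Section Generator.
Variable M : rmodule A.
Implicit Types p : M.

(* The annihilator of p in e_v A is spanned by arrows and a power of the radical. *)
Definition monomial_gen v p := forall a, ract p a = 0 ->
  [/\ chi v a = 0, forall w, t v w a != 0 -> ract p (arr v w) = 0 &
      rem v a != 0 -> forall r, r \in R 2 -> ract p r = 0].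

Definition chain_gen v p := exists i, forall a, ract p a = 0 <-> e v * a \in R i.

Lemma remP v a : rem v a \in R 2 /\ e v * rem v a = rem v a.
Proof.
split; last first.
  rewrite /rem !mulrBr mulrA idem_diag -scalerAr idem_diag mulr_sumr.
  by congr (_ - _); apply: eq_bigr => w _; rewrite -scalerAr e_arr.
have -> : rem v a = \sum_w (e v * jpart D a * e w - t v w a *: arr v w).
  rewrite sumrB -mulr_sumr idem_sum mulr1; congr (_ - _).
  rewrite /jpart mulrBr; congr (_ - _); rewrite mulr_sumr (bigD1 v) //= -scalerAr idem_diag.
  rewrite big1 ?addr0 // => k kv.
  by rewrite -scalerAr idem_mul eq_sym (negbTE kv) scaler0.
by apply: memv_suml => w _; apply: tcoefP.
Qed.

Lemma ract_e v p a : ract p (e v) = p -> ract p (e v * a) = ract p a.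
Proof. by move=> pe; rewrite ractM pe. Qed.

Lemma ract_rem v p a : ract p (e v) = p ->
  ract p a = chi v a *: p + \sum_w t v w a *: ract p (arr v w) + ract p (rem v a).
Proof.
move=> pe; rewrite -(ract_e a pe).
have {1}-> : e v * a = chi v a *: e v + (\sum_w t v w a *: arr v w) + rem v a.
  by rewrite /rem -[X in _ = _ + X]addrA -opprD [RHS]addrC subrK.
rewrite !ractDr ractZr pe ract_sumr; congr (_ + _ + _).
by apply: eq_bigr => w _; rewrite ractZr.
Qed.

Lemma local_gen_chi v p a : p != 0 -> ract p (e v) = p -> ract p a = 0 -> chi v a = 0.
Proof.
move=> p0 pe pa; apply/eqP; apply: contraT => a0; case/eqP: p0.
have [z zE] := corner_inv a0.
by rewrite -pe -zE !ractM pe pa !ract0l.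
Qed.

Lemma ract_component v p a k : ract p (e v) = p -> chi v a = 0 -> ract p a = 0 ->
  ract p (t v k a *: arr v k + rem v a * e k) = 0.
Proof.
move=> pe a0 pa.
have -> : t v k a *: arr v k + rem v a * e k = e v * a * e k.
  rewrite /rem a0 scale0r subr0 mulrBl mulr_suml (bigD1 k) //= -scalerAl arr_e.
  rewrite [X in _ - (_ + X)]big1 ?addr0; last first.
    by move=> l lk; rewrite -scalerAl -(arr_e v l) -mulrA idem_mul (negbTE lk) mulr0 scaler0.
  by rewrite addrC subrK.
by rewrite -mulrA ract_e // ractM pa ract0l.
Qed.

(* z detects the one-dimensional space e_v J^2, which p does not annihilate. *)
Lemma monomial_of_socle v w p z : branching v -> p != 0 -> ract p (e v) = p ->
  z \in R 2 -> e v * z = z -> z * e w = z -> ract p z != 0 ->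
  (forall a, ract p a = 0 -> t v w a != 0 -> ract p (arr v w) = 0) -> monomial_gen v p.
Proof.
move=> [w1 [w2 [n12 r1 r2]]] p0 pe Rz ez ze pz pw a pa.
have z0 : z != 0 by apply: contraNneq pz => ->; rewrite ract0r.
have line r : r \in R 2 -> e v * r = r -> exists c, r = c *: z.
  by move=> Rr er; apply: (two_arrows_R2 nak n12 r1 r2 Rr Rz er ez z0).
have kill r : r \in R 2 -> e v * r = r -> ract p r = 0 -> r = 0.
  move=> Rr er pr; have [c rE] := line r Rr er.
  have [c0|c0] := eqVneq c 0; first by rewrite rE c0 scale0r.
  by move: pr; rewrite rE ractZr => /eqP; rewrite scaler_eq0 (negbTE c0) (negbTE pz).
have a0 := local_gen_chi p0 pe pa.
have comp k := ract_component k pe a0 pa.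
have [Rrem erem] := remP v a.
have remk k : k != w -> rem v a * e k = 0.
  move=> kw; have [c rE] := line _ Rrem erem.
  by rewrite rE -scalerAl -ze -mulrA idem_mul eq_sym (negbTE kw) mulr0 scaler0.
have tk k : t v k a != 0 -> ract p (arr v k) = 0.
  have [->|kw] := eqVneq k w; first exact: pw.
  move=> tk0; have := comp k; rewrite remk // addr0 ractZr => /eqP.
  by rewrite scaler_eq0 (negbTE tk0) => /eqP.
have rem0 : rem v a = 0.
  rewrite -[LHS]mulr1 -(idem_sum D) mulr_sumr big1 // => k _.
  have [kw|kw] := eqVneq k w; last exact: remk.
  apply: kill; [exact: radp_mulr|by rewrite mulrA erem|].
  have := comp k; rewrite ractDr ractZr.
  have [->|tk0] := eqVneq (t v k a) 0; first by rewrite scale0r add0r.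
  by rewrite (tk k tk0) scaler0 add0r.
by split=> //; rewrite rem0 eqxx.
Qed.

(** When p does not kill J^2, the only obstruction is a relation p (arr v w + r) = 0 with r in e_v
    J^2 e_w and p arr v w nonzero. Then J kills arr v w, and [socle_swap] gives j with e_v j arr v w
    = r. The automorphism 1 + e_v j e_v of P_v carries the arrow to arr v w + r, so the generator
    moved by it kills the arrow. *)
Lemma branching_normal v p : branching v -> p != 0 -> local_gen v p ->
  exists p', [/\ p' != 0, local_gen v p' & monomial_gen v p'].
Proof.
move=> br p0 [pe pgen]; have [w1 [w2 [n12 r1 r2]]] := br.
have [K2|nK2] := pselect (forall r, r \in R 2 -> ract p r = 0).
  exists p; split=> // a pa; have a0 := local_gen_chi p0 pe pa; split=> // w tw.
  have := ract_component w pe a0 pa; rewrite ractDr ractZr [ract p (_ * _)]K2 ?addr0.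
    by move/eqP; rewrite scaler_eq0 (negbTE tw) => /eqP.
  by apply: radp_mulr; case: (remP v a).
have [z [w [Rz ez ze pz]]] : exists z w,
    [/\ z \in R 2, e v * z = z, z * e w = z & ract p z != 0].
  have [z [Rz pz]] : exists z, z \in R 2 /\ ract p z != 0.
    apply: contrapT => nz; apply: nK2 => r Rr; apply: contrapT => /eqP pr.
    by apply: nz; exists r.
  have nz : ract p z \notin (0%VS : {vspace M}) by rewrite memv0.
  have [w nw] := exists_component D nz; exists (e v * z * e w), w; split.
  - by apply: radp_mulr; apply: radp_mull.
  - by rewrite !mulrA idem_diag.
  - by rewrite -mulrA idem_diag.
  by rewrite -mulrA ract_e // ractM -memv0.
have z0 : z != 0 by apply: contraNneq pz => ->; rewrite ract0r.
have [px|px] := pselect (forall a, ract p a = 0 -> t v w a != 0 -> ract p (arr v w) = 0).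
  by exists p; split=> //; apply: (monomial_of_socle br p0 pe Rz ez ze pz px).
have [a [pa ta pw]] : exists a, [/\ ract p a = 0, t v w a != 0 & ract p (arr v w) != 0].
  apply: contrapT => na; apply: px => a pa ta; apply: contrapT => /eqP pw.
  by apply: na; exists a.
have a0 := local_gen_chi p0 pe pa; have [Rrem erem] := remP v a.
have rw : arr v w != 0 by apply: contraNneq pw => ->; rewrite ract0r.
pose r := (t v w a)^-1 *: (rem v a * e w).
have Rr : r \in R 2 by rewrite memvZ // radp_mulr.
have er : e v * r = r by rewrite -scalerAr mulrA erem.
have re : r * e w = r by rewrite -scalerAl -mulrA idem_diag.
have pxr : ract p (arr v w) + ract p r = 0.
  have := congr1 ( *:%R (t v w a)^-1) (ract_component w pe a0 pa).
  by rewrite scaler0 -ractZr scalerDr scalerA mulVf // scale1r ractDr.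
have r0 : r != 0.
  by apply: contraNneq pw => r0; rewrite -pxr r0 ract0r addr0.
have R3 y : y \in R 3 -> e v * y = 0 by apply: two_arrows_R3 n12 r1 r2.
(* Otherwise z is a multiple of arr v w j, but p arr v w j = - p r j = 0 because r j lies in e_v
   J^3. *)
have xJ j : j \in J -> arr v w * j = 0.
  move=> Jj; have Rxj : arr v w * j \in R 2 by apply: mulJJ => //; apply: arr_J.
  have exj : e v * (arr v w * j) = arr v w * j by rewrite mulrA e_arr.
  have [c cE] := two_arrows_R2 nak n12 r1 r2 Rxj Rz exj ez z0.
  have [c0|c0] := eqVneq c 0; first by rewrite cE c0 scale0r.
  case/eqP: pz; have -> : z = c^-1 *: (arr v w * j) by rewrite cE scalerA mulVf // scale1r.
  rewrite ractZr ractM.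
  have -> : ract p (arr v w) = - ract p r by apply/eqP; rewrite -addr_eq0 pxr.
  rewrite -scaleN1r ractZl -ractM -(ract_e _ pe) R3 ?ract0r ?scaler0 //.
  exact: mem_radpS.
have [w' [nww' rw']] : exists w', w' != w /\ arr v w' != 0.
  have [E|N1] := eqVneq w1 w; last by exists w1.
  by exists w2; rewrite -E eq_sym.
have [j Jj jE] := socle_swap nak nww' rw' rw r0 er re Rr xJ.
have Jj' : e v * j * e v \in J by apply: jac_mulr; apply: jac_mull.
pose p' := ract p (1 + e v * j * e v).
have [y yE] : exists y, (1 - - (e v * j * e v)) * y = 1 by apply: (jac_inv (D := D)); rewrite memvN.
rewrite opprK in yE.
have pE' : ract p' y = p by rewrite -ractM yE ract1.
have p'0 : p' != 0 by apply: contraNneq p0 => p'0; rewrite -pE' p'0 ract0l.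
have p'e : ract p' (e v) = p'.
  by rewrite /p' -ractM mulrDl mul1r -mulrA idem_diag !ractDr pe ract1.
have p'z : ract p' z = ract p z.
  rewrite -ractM mulrDl mul1r ractDr -!mulrA (R3 (j * _)) ?ract0r ?addr0 // ez.
  exact: mem_radpSl.
have p'x : ract p' (arr v w) = 0.
  by rewrite -ractM mulrDl mul1r ractDr -!mulrA e_arr jE pxr.
exists p'; split=> //.
  split=> // x; have [b ->] := pgen x; exists (y * b).
  by rewrite -[in LHS]pE' ractM.
apply: (monomial_of_socle (w := w) br p'0 p'e Rz ez ze); first by rewrite p'z.
by move=> *; apply: p'x.
Qed.

(** By [no_branch] a path out of v continues in at most one way, so each e_v J^(i+1) is generated by
    one path. Its last arrow is kept apart because [no_branch] compares products of two arrows. *)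
Lemma unibranch_layers v i : ~ branching v -> exists u w c, c * arr u w \in R i.+1 /\
  forall b, b \in R i.+1 -> exists y, e v * b = c * arr u w * y.
Proof.
move=> nb; elim: i => [|i [u [w [c [Rc cP]]]]].
  have [w wP] : exists w, forall k, k != w -> arr v k = 0.
    have [[w rw]|nw] := pselect (exists w, arr v w != 0).
      exists w => k kw; apply: contrapT => /eqP rk; apply: nb; by exists k, w.
    by exists v => k _; apply: contrapT => /eqP rk; apply: nw; exists k.
  exists v, w, 1; rewrite mul1r -jac_R1 arr_J; split=> // b; rewrite -jac_R1 => Jb.
  have [y yE] := jac_arrows nak v Jb; exists (y w).
  by rewrite yE (bigD1 w) //= big1 ?addr0 // => k kw; rewrite wP // mul0r.
have [w1 wP] : exists w1, forall k, k != w1 -> c * arr u w * arr w k = 0.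
  have [[w1 h1]|nw] := pselect (exists w1, arr u w * arr w w1 != 0).
    exists w1 => k kw; rewrite -mulrA.
    have [->|E] := no_branch nak u w kw; first by rewrite mulr0.
    by rewrite E eqxx in h1.
  (* Without a continuation any vertex will do, since all products vanish. *)
  exists v => k _; rewrite -mulrA; apply: contrapT => h; apply: nw; exists k.
  by apply/eqP => E; apply: h; rewrite E mulr0.
exists w, w1, (c * arr u w); split; first by apply: mem_radpS => //; apply: arr_J.
have [S SP] : {S : {vspace A} | forall b,
    b \in S <-> exists y, e v * b = c * arr u w * arr w w1 * y}.
  apply: subspace_of_pred => [|k x y [y1 E1] [y2 E2]]; first by exists 0; rewrite !mulr0.
  by exists (k *: y1 + y2); rewrite !mulrDr -!scalerAr E1 E2.
move=> b Rb; apply/SP; move: b Rb; apply/subvP; apply: radp_subv => b j Rb Jj; apply/SP.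
have [y yE] := cP b Rb.
have [z zE] := jac_arrows nak w (jac_mull y Jj).
exists (z w1); rewrite mulrA yE -mulrA.
rewrite -(arr_e u w) -!mulrA zE !mulr_sumr (bigD1 w1) //= big1 ?addr0.
  by rewrite [e w * _]mulrA e_arr.
by move=> k kw; rewrite !mulrA wP // mul0r.
Qed.

Lemma unibranch_simple_layers v i : ~ branching v -> exists c,
  [/\ c \in R i, e v * c = c & forall b, b \in R i -> exists k, e v * b - k *: c \in R i.+1].
Proof.
move=> nb; case: i => [|i].
  exists (e v); split; rewrite ?memvf ?idem_diag // => b _; exists (chi v b).
  rewrite -[e v in X in _ *: X]mulr1 scalerAr -mulrBr -jac_R1.
  apply: (@left_corner_jac _ _ D v); first by rewrite mulrA idem_diag.
  by rewrite chi_e_mul linearB linearZ /= rmorph1 mulr1 subrr.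
have [u [w [c [Rc cP]]]] := unibranch_layers i nb.
exists (e v * (c * arr u w)); split; first exact: radp_mull.
  by rewrite mulrA idem_diag.
move=> b Rb; have [y yE] := cP b Rb; exists (chi w y).
have -> : e v * b - chi w y *: (e v * (c * arr u w)) =
   e v * (c * arr u w * (e w * y - chi w y *: e w)).
  have ce : c * arr u w * e w = c * arr u w by rewrite -mulrA arr_e.
  rewrite [_ * (_ - _)]mulrBr [c * _ * (e w * y)]mulrA -scalerAr ce -yE.
  by rewrite mulrBr [e v * (e v * b)]mulrA idem_diag -scalerAr.
apply: radp_mull; apply: mem_radpS => //.
rewrite -[e w in X in _ *: X]mulr1 scalerAr -mulrBr.
apply: (@left_corner_jac _ _ D w); first by rewrite mulrA idem_diag.
by rewrite chi_e_mul linearB linearZ /= rmorph1 mulr1 subrr.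
Qed.

(** Let i be least with p J^i = 0. If p kills an a with e_v a in J^k but not in J^(k+1), and k < i,
    then e_v a spans e_v J^k modulo J^(k+1), so p J^k = p J^(k+1). Multiplying by J repeats this in
    all higher layers and gives p J^k = 0, against minimality. *)
Lemma unibranch_normal v p : ~ branching v -> local_gen v p -> chain_gen v p.
Proof.
move=> nb [pe _].
pose P i := `[< forall b, b \in R i -> ract p b = 0 >].
have exP : exists i, P i.
  by exists (nilindex D); apply/asboolP => b; rewrite radp_nil memv0 => /eqP ->; rewrite ract0r.
case: (ex_minnP exP) => i /asboolP Pi mini; exists i => a; split=> [pa|]; last first.
  by move=> Ra; rewrite -(ract_e a pe); apply: Pi.
apply: contrapT => /negP nRa.
have exQ : exists k, e v * a \notin R k by exists i.
case: (ex_minnP exQ) => -[|k] nk mink; first by rewrite memvf in nk.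
have Rk : e v * a \in R k by apply: contraT => /mink; rewrite ltnn.
have ki : (k < i)%N by apply: mink.
suff Pk : P k by have := mini k Pk; rewrite leqNgt ki.
apply/asboolP.
have [c [Rc ec cP]] := unibranch_simple_layers k nb.
have [k1 k1P] := cP _ Rk; rewrite mulrA idem_diag in k1P.
have k10 : k1 != 0 by apply: contraNneq nk => k10; rewrite k10 scale0r subr0 in k1P.
have step0 d : d \in R k -> exists2 r, r \in R k.+1 & ract p d = ract p r.
  move=> Rd; have [k2 k2P] := cP _ Rd.
  exists (e v * d - (k2 / k1) *: (e v * a)).
    have -> : e v * d - (k2 / k1) *: (e v * a) =
       (e v * d - k2 *: c) - (k2 / k1) *: (e v * a - k1 *: c).
      by rewrite scalerBr scalerA divfK // opprB addrA subrK.
    by rewrite memvB // memvZ.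
  by rewrite ractBr ractZr !ract_e // pa scaler0 subr0.
have step l d : d \in R (k + l) -> exists2 r, r \in R (k + l).+1 & ract p d = ract p r.
  elim: l d => [|l IH] d; first by rewrite addn0; apply: step0.
  have [S SP] : {S : {vspace A} | forall d, d \in S <->
      exists2 r, r \in R (k + l.+1).+1 & ract p d = ract p r}.
    apply: subspace_of_pred => [|x y z [r Rr E] [r' Rr' E']]; first by exists 0; rewrite ?mem0v.
    by exists (x *: r + r'); rewrite ?memvD ?memvZ // !ractDr !ractZr E E'.
  move=> Rd; apply/SP; move: d Rd; rewrite addnS; apply/subvP; apply: radp_subv => d j Rd Jj.
  apply/SP; have [r Rr E] := IH d Rd; exists (r * j); first by rewrite addnS mem_radpS.
  by rewrite !ractM E.
have kill l d : d \in R k -> exists2 r, r \in R (k + l) & ract p d = ract p r.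
  move=> Rd; elim: l => [|l [r Rr ->]]; first by exists d; rewrite ?addn0.
  by rewrite addnS; apply: step.
move=> d Rd; have [r Rr ->] := kill (nilindex D) d Rd.
have : r \in R (nilindex D) by apply: radpW Rr; apply: leq_addl.
by rewrite radp_nil memv0 => /eqP ->; rewrite ract0r.
Qed.

End Generator.

Definition normal_gen (M : rmodule A) v (p : M) :=
  (branching v /\ monomial_gen v p) \/ (~ branching v /\ chain_gen v p).

Lemma local_normal (M : rmodule A) v (p : M) : p != 0 -> local_gen v p ->
  exists p' : M, [/\ p' != 0, local_gen v p' & normal_gen v p'].
Proof.
move=> p0 pg; have [br|nb] := pselect (branching v).
  have [p' [p'0 pg' mp']] := branching_normal br p0 pg.
  by exists p'; split=> //; left.
by exists p; split=> //; right; split=> //; apply: unibranch_normal.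
Qed.

(** The left summand is for local modules, the right one for those with two top vertices. The
    exponents run beyond the nilpotency index so that 2 is always among them. *)
Definition code := ((I * {set I} * {set 'I_(nilindex D).+3}) + (I * I * I))%type.

Definition arrow_code (M : rmodule A) v (p : M) : {set I} := [set w | ract p (arr v w) == 0].

Definition layer_code (M : rmodule A) (p : M) : {set 'I_(nilindex D).+3} :=
  [set i : 'I_(nilindex D).+3 | `[< forall b, b \in R i -> ract p b = 0 >]].

Definition has_code (M : rmodule A) (c : code) : Prop :=
  match c with
  | inl (v, W, L) => exists p : M,
      [/\ p != 0, local_gen v p, normal_gen v p, W = arrow_code v p & L = layer_code p]
  | inr (v, v', w) => exists p q : M, peak_gen nak v v' w p q
  end.

Lemma indecomposable_code M : indecomposable M -> exists c, has_code M c.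
Proof.
move=> /(indecomposable_cases D nak)[[v [p [p0 pg]]]|[v [v' [w [p [q pq]]]]]].
  have [p' [p'0 pg' np']] := local_normal p0 pg.
  by exists (inl (v, arrow_code v p', layer_code p')), p'.
by exists (inr (v, v', w)), p, q.
Qed.

Lemma layer_codeP (M : rmodule A) (p : M) i : (i < (nilindex D).+3)%N ->
  reflect (forall b, b \in R i -> ract p b = 0) (inord i \in layer_code p).
Proof. by move=> lt; rewrite inE inordK //; apply: asboolP. Qed.

Lemma normal_annihilator (M M' : rmodule A) v (p : M) (p' : M') a :
  ract p (e v) = p -> ract p' (e v) = p' -> normal_gen v p -> normal_gen v p' ->
  arrow_code v p = arrow_code v p' -> layer_code p = layer_code p' ->
  ract p a = 0 -> ract p' a = 0.
Proof.
move=> pe p'e np np' Ea El pa.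
case: np np' => [[br mp]|[nb [i ip]]] [[br' mp']|[nb' [i' ip']]] //.
  have [a0 ta ra] := mp a pa.
  rewrite (ract_rem a p'e) a0 scale0r add0r big1 ?add0r => [|w _].
    have [->|r0] := eqVneq (rem v a) 0; first by rewrite ract0r.
    have lt2 : (2 < (nilindex D).+3)%N by [].
    have /(layer_codeP p lt2) : forall r, r \in R 2 -> ract p r = 0 by apply: ra.
    by rewrite El => /(layer_codeP p' lt2); apply; case: (remP v a).
  have [->|tw] := eqVneq (t v w a) 0; first by rewrite scale0r.
  have : w \in arrow_code v p by rewrite inE ta.
  by rewrite Ea inE => /eqP ->; rewrite scaler0.
(* Powers beyond the nilpotency index are zero, so the exponent of the annihilator can be cut down
   to the range of [layer_code]. *)
have bound (j : nat) x : (x \in R j) = (x \in R (minn j (nilindex D))).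
  apply/idP/idP; first by apply: radpW; apply: geq_minl.
  case: (leqP j (nilindex D)) => // le; rewrite radp_nil memv0 => /eqP ->.
  exact: mem0v.
have lt : (minn i (nilindex D) < (nilindex D).+3)%N.
  by rewrite !ltnS; apply: leq_trans (geq_minr _ _) _; rewrite -addn2 leq_addr.
have /(layer_codeP p lt) : forall b, b \in R (minn i (nilindex D)) -> ract p b = 0.
  by move=> b; rewrite -bound => Rb; apply/ip; apply: radp_mull.
rewrite El => /(layer_codeP p' lt) h.
by rewrite -(ract_e a p'e); apply: h; rewrite -bound; apply/ip.
Qed.

Lemma code_iso M M' c : has_code M c -> has_code M' c -> rm_iso M M'.
Proof.
case: c => [[[v W] L]|[[v v'] w]] /=.
  move=> [p [_ [pe pg] np -> ->]] [p' [_ [p'e pg'] np' EW ES]].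
  apply: (@iso_of_relations _ _ _ _ p 0 p' 0).
  - by move=> y; have [a ->] := pg y; exists a, 0; rewrite ract0l addr0.
  - by move=> y; have [a ->] := pg' y; exists a, 0; rewrite ract0l addr0.
  move=> a b; rewrite !ract0l !addr0; split.
    exact: (normal_annihilator pe p'e np np' EW ES).
  exact: (normal_annihilator p'e pe np' np (esym EW) (esym ES)).
move=> [p [q [g r]]] [p' [q' [g' r']]].
apply: (iso_of_relations g g') => a b.
by split=> [/r/r'|/r'/r].
Qed.

Lemma nakayama3_finite_type : finite_type A.
Proof.
pose F (i : 'I_#|{: code}|) : rmodule A :=
  if pselect (exists M, has_code M (enum_val i)) is left h then sval (cid h) else regular_module A.
exists #|{: code}|, F => M /indecomposable_code[c Mc].
exists (enum_rank c); rewrite /F enum_rankK; case: pselect => [h|[]]; last by exists M.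
exact: code_iso Mc (svalP (cid h)).
Qed.

End LocalModules.

Theorem proposition3p2 (K : closedFieldType) (A : falgType K) :
  basic_alg A -> connected_alg A -> right_nakayama A 3 ->
  special_biserial A /\ finite_type A.
Proof.
move=> /basic_split[D _] _ nak.
split; [exact: nakayama3_special_biserial D nak|exact: nakayama3_finite_type D nak].
Qed.
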